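(* Let $k\ge 2$ be an integer and let $(\Delta_s)_{s>0}$ be a family of real numbers such that, for each $s>0$, $\Delta_s$ is weight-uniform admissible for $s$. Define \[ \tau(k)=\max_{w\in\mathbb N}\frac{k-2\Delta_{2w}}{4w^2},\qquad \sigma(k)^{-1}=\inf_{t>k+1}\Bigl(t+\frac{1+\Delta_t}{2\tau(k)}\Bigr),\qquad \lambda=1-\frac{\sigma(k)}{2\tau(k)}. \] Suppose that $1/2<\lambda<1$. Then for each $\varepsilon>0$ there exists $\eta>0$ such that, whenever $2\le R\le P^\eta$, one has \[ \sup_{\alpha\in\mathfrak m(P^\lambda R)}|f(\alpha;P,R)|\ll P^{1-\sigma(k)+\varepsilon}. \]
   Context: For $2\le R\le P$, $\mathscr A(P,R)$ is the set of natural numbers not exceeding $P$ all of whose prime factors are at most $R$, and $f(\alpha;P,R)=\sum_{n\in\mathscr A(P,R)}e(\alpha n^k)$ with $e(z)=\mathrm e^{2\pi i z}$. A real number $\Delta_t$ is weight-uniform admissible (for $t>0$) if for each $\varepsilon>0$ there exists $\eta>0$ such that whenever $2\le R\le P^\eta$, uniformly over all $w:\mathbb N\to\mathbb C$, one has $\int_0^1|\sum_{n\in\mathscr A(P,R)}w(n)e(\alpha n^k)|^t\,\mathrm d\alpha\ll \|w\|_P^t P^{t-k+\Delta_t+\varepsilon}$, where $\|w\|_P=\max_{1\le n\le P}|w(n)|$. For $1\le Q\le P^{k/2}$, $\mathfrak M(Q)$ denotes the union of the sets $\{\alpha\in[0,1):|q\alpha-a|\le QP^{-k}\}$ over integers $0\le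 a\le q\le Q$ with $(q,a)=1$, and $\mathfrak m(Q)=[0,1)\setminus\mathfrak M(Q)$. *)

(* Defs.v *)
From HB Require Import structures.
From mathcomp Require Export all_boot all_order all_algebra.
From mathcomp Require Export all_classical all_reals all_analysis.
From mathcomp Require Export complex.

Set Implicit Arguments.
Unset Strict Implicit.
Unset Printing Implicit Defensive.

Import Order.TTheory GRing.Theory Num.Theory.
Import numFieldNormedType.Exports.

Local Open Scope classical_set_scope.
Local Open Scope ring_scope.

(* The complex modulus is written [Normc.normc : F[i] -> F] throughout:
   in [F[i]] the generic norm [`|z|] is complex-valued. *)

(* e(z) = exp(2 pi i z) for real z *)
Definition expe (F : realType) (z : F) : F[i] :=
  Complex (cos (2 * pi * z)) (sin (2 * pi * z)).

(* [n \in A(P, R)]: the natural numbers start at 1, and P, R are real. *)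
Definition smooth (F : realType) (P R : F) (n : nat) : bool :=
  [&& (0 < n)%N, n%:R <= P & all (fun p : nat => p%:R <= R) (primes n)].

(* \sum_(n in A(P, R)) w(n) e(alpha n^k); the index range is exactly
   1 <= n <= P when 0 <= P. *)
Definition weyl_sum (F : realType) (k : nat) (P R : F) (w : nat -> F[i])
    (alpha : F) : F[i] :=
  \sum_(1 <= n < (Num.truncn P).+1 | smooth P R n)
     w n * expe (alpha * n%:R ^+ k).

Definition smooth_weyl_sum (F : realType) (k : nat) (alpha P R : F) : F[i] :=
  weyl_sum k P R (fun=> 1) alpha.

Definition weight_norm (F : realType) (P : F) (w : nat -> F[i]) : F :=
  \big[Num.max/0]_(1 <= n < (Num.truncn P).+1) Normc.normc (w n).

(* The implicit constant C may depend on k, t, Delta, eps and eta, but not on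
   P, R or the weight w. *)
Definition weight_uniform_admissible (F : realType) (k : nat) (t Delta : F) :
    Prop :=
  forall eps : F, 0 < eps ->
  exists2 eta : F, 0 < eta &
  exists2 C : F, 0 < C &
  forall P R : F, 2 <= R -> R <= P -> R <= P `^ eta ->
  forall w : nat -> F[i],
    (\int[@lebesgue_measure F]_(alpha in `[0%R, 1%R])
        ((Normc.normc (weyl_sum k P R w alpha) `^ t)%R)%:E
     <= (C * weight_norm P w `^ t * P `^ (t - k%:R + Delta + eps))%:E)%E.

(* q >= 1 is implied: q = 0 forces a = 0, and 0, 0 are not coprime. *)
Definition major_arcs (F : realType) (k : nat) (P Q : F) : set F :=
  [set alpha | 0 <= alpha < 1 /\
     exists q a : nat, [/\ (a <= q)%N, q%:R <= Q, coprime q a &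
       `|q%:R * alpha - a%:R| <= Q * P `^ (- k%:R)]].

Definition minor_arcs (F : realType) (k : nat) (P Q : F) : set F :=
  [set alpha | 0 <= alpha < 1] `\` major_arcs k P Q.

Definition is_maximum (F : realType) (A : set F) (m : F) : Prop :=
  A m /\ ubound A m.

(* Main.v *)
Require Import Defs.
From mathcomp Require Import measurable_realfun ring lra zify.
Import Order.TTheory GRing.Theory Num.Theory.
Import numFieldNormedType.Exports.
Local Open Scope classical_set_scope.
Local Open Scope ring_scope.
Set Implicit Arguments.
Unset Strict Implicit.
Unset Printing Implicit Defensive.

(* By Dirichlet, [alpha = a / q + beta] with [q <= P^(k/2)] and [|q beta| <= 2 P^(-k/2)]. Splitting [n = d m] with
   [d | q^oo] and [m] coprime to [q], and then [m] dyadically, reduces the claim to blocks of length [P / W],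
   where [d <= W]; those with [W > P^sigma] are trivial. Put [M = P^lambda] and [X = P / M].
   If [q <= X^k] and [|q beta| <= (M R)^(-k) / 2], then [m = u v] with [u] about [M / W] and [v] about [X]; the
   minor arc hypothesis makes the points [alpha d^k u^k] well spaced, and Hoelder's inequality with exponent [t] and the
   large sieve give the bound, [t] being nearly optimal in the definition of [sigma].
   Otherwise [L = max (q, P^k |q beta|)] is at least about [X^k], and [m = x y z] with [x] and [y] of size about
   [(L / W^(k/2))^(1/k)]; a bilinear argument with the exponent [2w] attaining [tau] saves about
   [X^(2 tau) = P^sigma].
   When [k - Delta_(2w) >= w^2], where this second case breaks down, the mean value alone shows that
   there are at most [P^(1 - sigma + eps)] smooth numbers up to [P]. *)

(** The mean values hold uniformly in the weights, and the proof lives on this: translations, the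
    averaging factor of the large sieve, coprimality, rotations and cutoffs all move into weights.
    The obstacle is that the large sieve compares one fixed weighted sum at many points, so its
    weights may not depend on the outer variable. In [n = u v] they do so in two ways. The primes of
    [v] are bounded by the least prime of [u]; this prime is summed outermost, at the cost of a
    factor [R]. The range of [v] depends on [u]; it is replaced by a fixed family of weights, at the
    cost of a logarithm. Powers of [R] and logarithms are harmless, being [O(P ^ eps)]. The factor
    [d] is split off because congruences modulo [q] can be cancelled, or their roots counted, only
    for variables coprime to [q]. The modulus that remains is [q / gcd (q, d ^ k)], a loss of up to
    [d ^ k <= W ^ k], paid for by the shorter length [P / W]. In the first case this balance rests
    on [t > k + 1], in the second on [k - Delta_(2w) < w ^ 2]. *)

(** * Complex modulus, exponential, and exact integrals of trigonometric polynomials *)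

Section Complex.
Context {F : realType}.
Local Notation normc := (@Normc.normc F).
Implicit Types z : F[i].

Lemma normc_ge0 z : 0 <= normc z.
Proof. by case: z => a b; exact: sqrtr_ge0. Qed.

Lemma normcX z n : normc (z ^+ n) = normc z ^+ n.
Proof.
by elim: n => [|n IH]; rewrite ?expr0 ?Normc.normc1 // !exprS Normc.normcM IH.
Qed.

Lemma normc_sum (I : Type) (s : seq I) (p : pred I) (a : I -> F[i]) :
  normc (\sum_(i <- s | p i) a i) <= \sum_(i <- s | p i) normc (a i).
Proof.
elim/big_rec2: _ => [|i y x _ h]; first by rewrite Normc.normc0.
exact: le_trans (le_normcD _ _) (lerD (lexx _) h).
Qed.

Lemma Re_le_normc z : complex.Re z <= normc z.
Proof.
case: z => a b /=; apply: le_trans (ler_norm a) _.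
by rewrite -sqrtr_sqr ler_sqrt ?addr_ge0 ?sqr_ge0// lerDl sqr_ge0.
Qed.

Lemma normc_sqr z : normc z ^+ 2 = complex.Re z ^+ 2 + complex.Im z ^+ 2.
Proof. by case: z => a b /=; rewrite sqr_sqrtr // addr_ge0 ?sqr_ge0. Qed.

(** Linearises the modulus: after a rotation it is a real part, which can be integrated term by term
    or carried through an exchange of sums. *)
Lemma normc_rot z : exists2 u, normc u = 1 & u * z = (normc z)%:C%C.
Proof.
have [->|z0] := eqVneq z 0.
  by exists 1; rewrite ?Normc.normc1 // Normc.normc0 mulr0.
have n0 : normc z != 0 by apply: contra z0 => /eqP/Normc.eq0_normc ->.
exists ((normc z)%:C%C / z).
  rewrite Normc.normcM Normc.normcV /= expr0n /= addr0 sqrtr_sqr.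
  by rewrite ger0_norm ?normc_ge0 // divff.
by rewrite -mulrA mulVf // mulr1.
Qed.

Lemma normc_real (x : F) : normc x%:C%C = `|x|.
Proof. by rewrite /= expr0n /= addr0 sqrtr_sqr. Qed.

Lemma normc_expe (x : F) : normc (expe x) = 1.
Proof. by rewrite /expe /= cos2Dsin2 sqrtr1. Qed.

Lemma expeD (x y : F) : expe (x + y) = expe x * expe y.
Proof.
rewrite /expe mulrDr cosD sinD.
by apply/eqP; rewrite eq_complex /= eqxx /= addrC mulrC [sin _ * _]mulrC eqxx.
Qed.

Lemma expe0 : expe (0 : F) = 1.
Proof. by rewrite /expe mulr0 cos0 sin0. Qed.

Lemma expe_nat n : expe (n%:R : F) = 1.
Proof.
elim: n => [|n IH]; first exact: expe0.
rewrite -natr1 expeD IH mul1r /expe mulr1 [2 * _]mulr_natl cos2pi sin2pi.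
by [].
Qed.

Lemma expe_int (m : int) : expe (m%:~R : F) = 1.
Proof.
case: m => n; first exact: expe_nat.
have := expeD (n.+1%:R : F) (- n.+1%:R).
by rewrite NegzE mulrNz subrr expe0 expe_nat mul1r.
Qed.

Lemma expe_sum (I : Type) (s : seq I) (p : pred I) (f : I -> F) :
  expe (\sum_(i <- s | p i) f i) = \prod_(i <- s | p i) expe (f i).
Proof.
by elim/big_rec2: _ => [|i y x _ h]; rewrite ?expe0 // expeD h.
Qed.

End Complex.

Section FTC.
Context {F : realType}.

Lemma integral_of_derivative (f G : F -> F) (a b : F) : a < b ->
  continuous f -> (forall x : F, is_derive x 1 G (f x)) ->
  (\int[@lebesgue_measure F]_(x in `[a, b]) (f x)%:E = (G b - G a)%:E)%E.
Proof.
move=> ab cf dG.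
have cG : continuous G.
  by move=> x; apply/differentiable_continuous/derivable1_diffP; case: (dG x).
rewrite EFinB; apply: continuous_FTC2 => //.
- exact: continuous_subspaceT.
- split.
  + by move=> x _; case: (dG x).
  + by apply: cvg_at_right_filter; exact: cG.
  + by apply: cvg_at_left_filter; exact: cG.
- by move=> x _; rewrite derive1E; apply: derive_val.
Qed.

Lemma continuous_trig (I : Type) (s : seq I) (a b c : I -> F) :
  continuous (fun x : F => \sum_(i <- s) (a i * cos (c i * x) + b i * sin (c i * x))).
Proof.
move=> x; elim: s => [|i s IH].
  under eq_fun do rewrite big_nil; exact: cvg_cst.
under eq_fun do rewrite big_cons.
apply: cvgD => //.
have cl : (fun y : F => c i * y) @ x --> c i * x by apply: cvgMr; exact: cvg_id.
apply: cvgD; apply: cvgMr.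
  apply: (continuous_comp cl); exact: continuous_cos.
apply: (continuous_comp cl); exact: continuous_sin.
Qed.

(** Serves the average of a Weyl sum over a short interval and Parseval's identity. The constant
    term [C] stands apart because the antiderivative divides by the frequencies. *)
Lemma integral_trig (I : Type) (s : seq I) (a b c : I -> F) (u v C : F) :
  u < v -> (forall i, c i != 0) ->
  (\int[@lebesgue_measure F]_(x in `[u, v])
     (C + \sum_(i <- s) (a i * cos (c i * x) + b i * sin (c i * x)))%:E =
   (C * (v - u) + \sum_(i <- s) (a i * (sin (c i * v) - sin (c i * u))
        - b i * (cos (c i * v) - cos (c i * u))) / c i)%:E)%E.
Proof.
move=> uv c0.
pose G x := C * x + \sum_(i <- s) (a i * sin (c i * x) - b i * cos (c i * x)) / c i.
pose f x := C + \sum_(i <- s) (a i * cos (c i * x) + b i * sin (c i * x)).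
have cf : continuous f.
  by move=> x; apply: cvgD; [exact: cvg_cst|exact: continuous_trig].
have dG (x : F) : is_derive x 1 G (f x).
  rewrite /G /f; apply: is_deriveD.
    by apply: is_derive_eq; rewrite /GRing.scale /= mulr1.
  elim: s {G f cf} => [|i s IH].
    under eq_fun do rewrite big_nil; rewrite big_nil; exact: is_derive_cst.
  under eq_fun do rewrite big_cons.
  rewrite big_cons; apply: is_deriveD => //.
  have dl : is_derive x 1 (fun y : F => c i * y) (c i).
    by apply: is_derive_eq; rewrite /GRing.scale /= mulr1.
  have ds : is_derive x 1 (fun y : F => sin (c i * y)) (cos (c i * x) * c i).
    exact: (@is_derive1_comp F sin).
  have dc : is_derive x 1 (fun y : F => cos (c i * y)) (- sin (c i * x) * c i).
    exact: (@is_derive1_comp F cos).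
  apply: is_derive_eq.
  rewrite /GRing.scale /= ; field; exact: c0.
have := integral_of_derivative uv cf dG; rewrite /f => ->.
congr EFin; rewrite /G opprD addrACA -mulrBr -sumrB; congr (_ + _).
by apply: eq_bigr => i _; rewrite -mulrBl; congr (_ / _); ring.
Qed.

End FTC.

(** * A large sieve for weighted smooth Weyl sums *)

Section Sinc.
Context {F : realType}.

Lemma sin_le_id (x : F) : 0 <= x -> sin x <= x.
Proof.
rewrite le_eqVlt => /predU1P[<-|x0]; first by rewrite sin0.
have [c _] := @MVT F sin cos 0 x x0 (fun c _ => is_derive_sin c)
  (continuous_subspaceT (@continuous_sin F)).
rewrite sin0 !subr0 => ->; rewrite -[leRHS]mul1r ler_pM2r //; exact: cos_le1.
Qed.

Lemma cos_ge_half (x : F) : 0 <= x <= 1 -> 1 / 2 <= cos x.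
Proof.
move=> /andP[x0 x1].
have h : cos x = 1 - 2 * sin (x / 2) ^+ 2.
  have -> : cos x = cos (x / 2 *+ 2) by congr cos; rewrite -mulr_natr; field.
  by rewrite cos_mulr2n cos2sin2; ring.
have s0 : 0 <= sin (x / 2).
  by apply: sin_ge0_pi; have := @pi_ge2 F; lra.
have s1 : sin (x / 2) <= 1 / 2.
  by apply: le_trans (sin_le_id _) _; lra.
rewrite h; nra.
Qed.

Lemma sin_ge_half (x : F) : 0 <= x <= 1 -> x / 2 <= sin x.
Proof.
move=> /andP[]; rewrite le_eqVlt => /predU1P[<- _|x0 x1]; first by rewrite sin0 mul0r.
have [c cx] := @MVT F sin cos 0 x x0 (fun c _ => is_derive_sin c)
  (continuous_subspaceT (@continuous_sin F)).
rewrite sin0 !subr0 => ->; rewrite mulrC ler_pM2r // -[leLHS]mul1r.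
apply: cos_ge_half; move: cx; rewrite in_itv /= => /andP[a b]; lra.
Qed.

(** The multiplier by which averaging over an interval acts on a Fourier mode. Its value at 0 is 0
    by the division convention, but it matters only on (0, 1], where it stays away from 0. *)
Definition sinc (y : F) : F := sin y / y.

Lemma sinc_bounds (y : F) : 0 < y <= 1 -> 1 / 2 <= sinc y <= 1.
Proof.
move=> /andP[y0 y1]; apply/andP; split.
  rewrite /sinc ler_pdivlMr // -mulrA mul1r [2^-1 * _]mulrC.
  by apply: sin_ge_half; rewrite ltW.
by rewrite /sinc ler_pdivrMr // mul1r sin_le_id // ltW.
Qed.

End Sinc.

Section WeylIntegral.
Context {F : realType}.
Local Notation normc := (@Normc.normc F).
Local Notation mu := (@lebesgue_measure F).
Implicit Types (w : nat -> F[i]) (u : F[i]).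

(** [n.-1.+1] is [n] for positive [n], and keeps the frequency nonzero at 0 as well, since
    [integral_trig] asks this of every index. *)
Let freq k n : F := 2 * pi * n.-1.+1%:R ^+ k.

Let freq_gt0 k n : 0 < freq k n.
Proof. by rewrite !mulr_gt0 ?pi_gt0 ?exprn_gt0. Qed.

Let smooth_range (P R : F) := [seq n <- index_iota 1 (Num.truncn P).+1 | smooth P R n].

Let in_smooth_range P R n : n \in smooth_range P R -> (0 < n)%N /\ n%:R <= P.
Proof. by rewrite mem_filter => /andP[/and3P[]]. Qed.

Let Re_weyl k P R w u (x : F) :
  complex.Re (u * weyl_sum k P R w x) =
  \sum_(n <- smooth_range P R) (complex.Re (u * w n) * cos (freq k n * x)
     + (- complex.Im (u * w n)) * sin (freq k n * x)).
Proof.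
rewrite /weyl_sum mulr_sumr raddf_sum -big_filter [LHS]big_seq [RHS]big_seq.
apply: eq_bigr => n /in_smooth_range[n0 _].
have -> : freq k n * x = 2 * pi * (x * n%:R ^+ k).
  by rewrite /freq prednK //; ring.
by rewrite mulrA; case: (u * w n) => a b; rewrite /expe /= mulNr.
Qed.

Lemma continuous_normc_weyl k P R w :
  continuous (fun x => normc (weyl_sum k P R w x)).
Proof.
have cR u : continuous (fun x => complex.Re (u * weyl_sum k P R w x)).
  by under eq_fun do rewrite Re_weyl; exact: continuous_trig.
pose f x := complex.Re (1 * weyl_sum k P R w x).
pose g x := complex.Re ((- 'i)%C * weyl_sum k P R w x).
have -> : (fun x => normc (weyl_sum k P R w x)) =
  (fun x => Num.sqrt (f x * f x + g x * g x)).
  apply/funext => x; rewrite /f /g mul1r; case: (weyl_sum _ _ _ _ _) => a b /=.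
  by congr Num.sqrt; ring.
move=> x; apply: (@continuous_comp _ _ _ (fun x => f x * f x + g x * g x) (@Num.sqrt F)).
  by apply: cvgD; apply: cvgM; exact: cR.
exact: sqrt_continuous.
Qed.

Lemma measurable_normc_weyl_powR k P R w (t : F) (D : set F) : measurable D ->
  measurable_fun D (fun x : F => normc (weyl_sum k P R w x) `^ t).
Proof.
move=> mD; apply: (@measurableT_comp _ _ _ _ _ _ (fun y : F => y `^ t)).
  exact: measurable_powR.
apply: measurable_funTS; apply: continuous_measurable_fun.
exact: continuous_normc_weyl.
Qed.

(** Undoes the averaging factor in advance, so that the average of the modified sum is the original
    sum. *)
Definition sinc_weight (k : nat) (d : F) w : nat -> F[i] :=
  fun n => w n / (sinc (2 * pi * d * n%:R ^+ k))%:C%C.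

(* Averaging over [th - d, th + d] multiplies the n-th Fourier mode by a sinc factor. *)
Lemma weyl_sum_average k P R w (th d : F) :
  0 < d -> 2 * pi * d * P ^+ k <= 1 ->
  ((normc (weyl_sum k P R w th) * (2 * d))%:E <=
   \int[mu]_(x in `[(th - d)%R, (th + d)%R])
      (normc (weyl_sum k P R (sinc_weight k d w) x))%:E)%E.
Proof.
move=> d0 hd; set w' := sinc_weight k d w.
have [u u1 hu] := normc_rot (weyl_sum k P R w th).
have ab : th - d < th + d by rewrite ltrD2l; lra.
have ci (f : F -> F) : continuous f -> mu.-integrable `[(th - d)%R, (th + d)%R] (EFin \o f).
  move=> cf; apply: continuous_compact_integrable; first exact: segment_compact.
  exact: continuous_subspaceT.
have cR : continuous (fun x => complex.Re (u * weyl_sum k P R w' x)).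
  by under eq_fun do rewrite Re_weyl; exact: continuous_trig.
apply: (@le_trans _ _ (\int[mu]_(x in `[(th - d)%R, (th + d)%R])
      (complex.Re (u * weyl_sum k P R w' x))%:E)%E); last first.
  apply: le_integral => //.
  - exact: (ci _ cR).
  - exact: (ci _ (@continuous_normc_weyl k P R w')).
  - move=> x _; rewrite lee_fin; apply: le_trans (Re_le_normc _) _.
    by rewrite Normc.normcM u1 mul1r.
have := @integral_trig F _ (smooth_range P R) (fun n => complex.Re (u * w' n))
  (fun n => - complex.Im (u * w' n)) (freq k) _ _ 0 ab
  (fun n => lt0r_neq0 (freq_gt0 k n)).
under eq_integral do rewrite add0r -Re_weyl.
move=> ->; rewrite mul0r add0r lee_fin.
have -> : normc (weyl_sum k P R w th) = complex.Re (u * weyl_sum k P R w th) by rewrite hu.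
rewrite Re_weyl mulr_suml le_eqVlt; apply/orP; left; apply/eqP.
rewrite [LHS]big_seq [RHS]big_seq; apply: eq_bigr => n nin.
have [n0 nP] := in_smooth_range nin.
set c := freq k n.
have c0 : 0 < c by exact: freq_gt0.
have ->: w n = w' n * (sinc (c * d))%:C%C.
  have -> : c * d = 2 * pi * d * n%:R ^+ k by rewrite /c /freq prednK //; ring.
  rewrite /w' /sinc_weight mulfVK // -(rmorph0 (real_complex F)).
  rewrite (inj_eq (@complexI F)).
  have /sinc_bounds/andP[] : 0 < 2 * pi * d * n%:R ^+ k <= 1; last by move=> h _; lra.
    rewrite !mulr_gt0 ?pi_gt0 ?exprn_gt0 ?ltr0n //=.
    apply: le_trans hd; rewrite ler_pM2l ?mulr_gt0 ?pi_gt0 //.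
    by rewrite lerXn2r ?nnegrE // (le_trans _ nP).
rewrite mulrA; case: (u * w' n) => a b /=.
rewrite !mulr0 subr0 add0r ![c * (_ + _)]mulrDr mulrN sinB sinD cosB cosD /sinc.
by field; rewrite !gt_eqF.
Qed.

(** A pointwise stand-in for Hoelder's inequality: above the level [A] one has
    [(g / A) ^ (t - 1) >= 1], below it the first term suffices. The caller chooses the level. *)
Lemma powR_split (g A t : F) : 0 <= g -> 0 < A -> 1 <= t ->
  g <= A + A `^ (1 - t) * g `^ t.
Proof.
move=> g0 A0 t1; have [gA|Ag] := leP g A.
  by rewrite (le_trans gA) // lerDl mulr_ge0 ?powR_ge0.
rewrite -[leLHS]add0r lerD ?(ltW A0) //.
have -> : 1 - t = - (t - 1) by ring.
rewrite powRN mulrC ler_pdivlMr ?powR_gt0 //.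
rewrite -(@mulr_powRB1 _ g t) ?(lt_le_trans _ t1) // ler_wpM2l //.
by apply: ge0_ler_powR; rewrite ?nnegrE ?subr_ge0 // ltW.
Qed.

(** [powR_split] is applied inside [weyl_sum_average] at half the value of the sum at [th]. The
    constant term then accounts for exactly half of the left side and cancels; this is where the
    division by 2 comes from. *)
Lemma weyl_sum_pow_average k P R w (th d t : F) : 1 <= t ->
  0 < d -> 2 * pi * d * P ^+ k <= 1 ->
  (((normc (weyl_sum k P R w th) / 2) `^ t * (2 * d))%:E <=
   \int[mu]_(x in `[(th - d)%R, (th + d)%R])
      (normc (weyl_sum k P R (sinc_weight k d w) x) `^ t)%:E)%E.
Proof.
move=> t1 d0 hd; set w' := sinc_weight k d w.
set A := normc (weyl_sum k P R w th) / 2.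
have g0 x : 0 <= normc (weyl_sum k P R w' x) by exact: normc_ge0.
have : 0 <= A by rewrite divr_ge0 ?normc_ge0.
rewrite le_eqVlt => /predU1P[<-|A0].
  rewrite powR0 ?mul0r ?integral_ge0 // ?gt_eqF ?(lt_le_trans _ t1) // => x _.
  by rewrite lee_fin powR_ge0.
have mI : measurable (`[(th - d)%R, (th + d)%R] : set F) by exact: measurable_itv.
set J := (X in (_ <= X)%E).
have J0 : (0 <= J)%E by apply: integral_ge0 => x _; rewrite lee_fin powR_ge0.
have h : ((2 * A * (2 * d))%:E <= (A * (2 * d))%:E + (A `^ (1 - t))%:E * J)%E.
  have -> : 2 * A = normc (weyl_sum k P R w th) by rewrite /A; field.
  apply: le_trans (weyl_sum_average R w th d0 hd) _; rewrite -/w'.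
  have /measurable_EFinP mp := measurable_normc_weyl_powR k P R w' t mI.
  have -> : (A * (2 * d))%:E = (\int[mu]_(x in `[(th - d)%R, (th + d)%R]) (cst A%:E x))%E.
    rewrite integral_cst //; have := lebesgue_measure_itv `[th - d, th + d].
    rewrite /= lte_fin ltrD2l => ->.
    have -> : - d < d by lra.
    by rewrite -EFinB -EFinM; congr (A * _)%:E; ring.
  rewrite -ge0_integralZl_EFin ?powR_ge0 //; last by move=> x _; rewrite lee_fin powR_ge0.
  rewrite -ge0_integralD //.
  - apply: ge0_le_integral => //.
    + by move=> x _; rewrite lee_fin.
    + apply/measurable_EFinP; apply: measurable_funTS.
      by apply: continuous_measurable_fun; exact: continuous_normc_weyl.
    + apply: emeasurable_funD; first exact: measurable_cst.
      by apply: measurable_funeM.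
    + move=> x _; rewrite /= -EFinM -EFinD lee_fin; exact: powR_split.
  - by move=> x _ /=; rewrite lee_fin ltW.
  - by move=> x _; rewrite -EFinM lee_fin mulr_ge0 ?powR_ge0.
  - exact: measurable_funeM.
have : ((A * (2 * d))%:E <= (A `^ (1 - t))%:E * J)%E.
  move: h; have -> : 2 * A * (2 * d) = A * (2 * d) + A * (2 * d) by ring.
  by rewrite EFinD leeD2lE.
have -> : A `^ t * (2 * d) = A `^ (t - 1) * (A * (2 * d)).
  by rewrite -(@mulr_powRB1 _ A t) ?(ltW A0) ?(lt_le_trans _ t1) //; ring.
move=> h2; rewrite EFinM.
apply: (@le_trans _ _ ((A `^ (t - 1))%R%:E * ((A `^ (1 - t))%R%:E * J))%E).
  by rewrite lee_pmul2l ?lte_fin ?powR_gt0.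
rewrite muleA -EFinM -powRD; last by apply/implyP => _; rewrite gt_eqF.
by rewrite addrA subrK subrr powRr0 mul1e.
Qed.

(** All averaging intervals lie in [0, 1], so the integrals add up to that of [f] times the number
    of intervals covering a point, which is at most [m]. *)
Let half_sieve (I : Type) (s : seq I) (p : pred I) (th : I -> F) (d t m : F) k P R w :
  1 <= t -> 0 < d -> 2 * pi * d * P ^+ k <= 1 ->
  (forall i, p i -> 0 <= th i - d /\ th i + d <= 1) ->
  (forall x : F, (count (fun i => p i && (`|th i - x| <= d)) s)%:R <= m) ->
  ((\sum_(i <- s | p i) (normc (weyl_sum k P R w (th i)) / 2) `^ t * (2 * d))%:E
   <= m%:E * \int[mu]_(x in `[0%R, 1%R])
        (normc (weyl_sum k P R (sinc_weight k d w) x) `^ t)%:E)%E.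
Proof.
move=> t1 d0 hd th01 hm; set w' := sinc_weight k d w.
pose f (x : F) : \bar F := (normc (weyl_sum k P R w' x) `^ t)%:E.
have f0 x : (0 <= f x)%E by rewrite lee_fin powR_ge0.
have mD : measurable (`[0, 1] : set F) by exact: measurable_itv.
have mf D : measurable D -> measurable_fun D f.
  by move=> mD'; apply/measurable_EFinP; exact: measurable_normc_weyl_powR.
pose K i : set F := `[th i - d, th i + d]%classic.
have mK i : measurable (K i) by exact: measurable_itv.
pose g i : F -> \bar F := f \_ (K i).
have g0 i x : (0 <= g i x)%E by rewrite /g patchE; case: ifP.
have mg i : measurable_fun (`[0, 1]%classic : set F) (g i).
  by apply/measurable_restrict => //; apply: mf; exact: measurableI.
have m0 : 0 <= m by exact: le_trans (hm 0).
apply: (@le_trans _ _ (\sum_(i <- s | p i) \int[mu]_(x in `[0%R, 1%R]) g i x)%E).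
  rewrite -sumEFin.
  apply: lee_sum => i pi; have [h1 h2] := th01 i pi.
  rewrite /g -integral_mkcondr.
  have -> : `[0, 1]%classic `&` K i = K i.
    rewrite setIidr // => x; rewrite /K /= !in_itv /= => /andP[a b].
    by rewrite (le_trans h1 a) (le_trans b h2).
  exact: weyl_sum_pow_average.
rewrite -big_filter -ge0_integral_sum //.
rewrite -ge0_integralZl_EFin //; [|by move=> x _; exact: f0|exact: mf].
apply: ge0_le_integral => //.
- by move=> x _; rewrite sume_ge0.
- apply: emeasurable_fun_sum => i; exact: mg.
- by apply: measurable_funeM; exact: mf.
move=> x _; rewrite big_filter.
have -> : (\sum_(i <- s | p i) g i x)%E =
  ((count (fun i => p i && (`|th i - x| <= d)) s)%:R%:E * f x)%E.
  rewrite /f -EFinM -sum1_count natr_sum mulr_suml -sumEFin big_mkcondr.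
  apply: eq_bigr => i pi; rewrite /g patchE /K mem_setE in_itv /= mul1r.
  by rewrite ler_distlC; case: ifP.
by apply: lee_wpmul2r => //; rewrite lee_fin.
Qed.

Definition twist (k : nat) (d : F) w : nat -> F[i] :=
  fun n => w n * expe (d * n%:R ^+ k).

Lemma weyl_sum_twist k P R w (th d : F) :
  weyl_sum k P R w th = weyl_sum k P R (twist k (- d) w) (th + d).
Proof.
apply: eq_bigr => n _; rewrite /twist -mulrA -expeD; congr (_ * expe _); ring.
Qed.

Lemma weyl_sum_frac k P R w (th : F) (m : int) :
  weyl_sum k P R w (th + m%:~R) = weyl_sum k P R w th.
Proof.
apply: eq_bigr => n _; congr (_ * _); rewrite mulrDl expeD -natrX.
by rewrite -[(n ^ k)%:R]/((n ^ k)%:Z%:~R) -intrM expe_int mulr1.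
Qed.

(* The points are moved by [+ d] or [- d] so that every averaging interval stays inside [0, 1]. *)
Lemma large_sieve (I : Type) (s : seq I) (p : pred I) (th : I -> F) (d t m : F) k P R w :
  1 <= t -> 0 < d -> 8 * d * P ^+ k <= 1 -> 4 * d <= 1 ->
  (forall i, p i -> 0 <= th i <= 1) ->
  (forall x : F, (count (fun i => p i && (`|th i - x| <= 2 * d)) s)%:R <= m) ->
  ((\sum_(i <- s | p i) (normc (weyl_sum k P R w (th i)) / 2) `^ t * (2 * d))%:E
   <= m%:E * \int[mu]_(x in `[0%R, 1%R])
        (normc (weyl_sum k P R (sinc_weight k d (twist k (- d) w)) x) `^ t)%:E
    + m%:E * \int[mu]_(x in `[0%R, 1%R])
        (normc (weyl_sum k P R (sinc_weight k d (twist k d w)) x) `^ t)%:E)%E.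
Proof.
move=> t1 d0 hd d1 th01 hm.
have hd' : 2 * pi * d * P ^+ k <= 1.
  have [P0|P0] := leP 0 (P ^+ k).
    by apply: le_trans hd; rewrite !ler_wpM2r ?(ltW d0) //; have := @pihalf_lt2 F; lra.
  apply: (@le_trans _ _ 0) => //; rewrite mulr_ge0_le0 ?(ltW P0) //.
  by rewrite !mulr_ge0 ?pi_ge0 ?(ltW d0).
have sgn (p' : pred I) (e : F) : `|e| = d -> (forall i, p' i -> p i) ->
    (forall i, p' i -> 0 <= th i + e - d /\ th i + e + d <= 1) ->
    ((\sum_(i <- s | p' i) (normc (weyl_sum k P R w (th i)) / 2) `^ t * (2 * d))%:E
   <= m%:E * \int[mu]_(x in `[0%R, 1%R])
        (normc (weyl_sum k P R (sinc_weight k d (twist k (- e) w)) x) `^ t)%:E)%E.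
  move=> ed pp' h.
  under eq_bigr do rewrite (weyl_sum_twist k P R w _ e).
  apply: (@half_sieve _ s p' (fun i => th i + e)) => // x.
  (* The shift by [e] costs a further [d], hence the radius [2 * d] in the hypothesis on the
     counts. *)
  apply: le_trans (hm (x)); rewrite ler_nat; apply: sub_count => i /= /andP[/pp' -> /=].
  have -> : th i + e - x = th i - x + e by ring.
  move=> h1; rewrite -(addrK e (th i - x)); apply: le_trans (ler_normB _ _) _.
  by rewrite ed; lra.
rewrite (bigID (fun i => th i <= 1 / 2)) /= EFinD.
apply: leeD.
  apply: sgn; first by rewrite ger0_norm ?ltW.
    by move=> i /andP[].
  by move=> i /andP[/th01/andP[a b] c]; split; lra.
rewrite -[d in twist k d w]opprK; apply: sgn; first by rewrite normrN ger0_norm ?ltW.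
  by move=> i /andP[].
by move=> i /andP[/th01/andP[a b]]; rewrite -ltNge => c; split; lra.
Qed.

Lemma weight_norm_le P w (B : F) : 0 <= B ->
  (forall n, (0 < n)%N -> n%:R <= P -> normc (w n) <= B) -> weight_norm P w <= B.
Proof.
move=> B0 h; rewrite /weight_norm big_seq.
elim/big_rec: _ => // i x; rewrite mem_index_iota => /andP[i0 iP] xB.
rewrite ge_max xB andbT; apply: h => //.
by rewrite -(prednK i0) -truncn_gt_nat (prednK i0).
Qed.

Lemma weight_norm_ge0 P w : 0 <= weight_norm P w.
Proof.
rewrite /weight_norm; elim/big_ind: _ => // [x y x0 y0|i _]; last exact: normc_ge0.
by rewrite le_max x0.
Qed.

Lemma sinc_twist_le k P d e w : 0 < d -> 8 * d * P ^+ k <= 1 ->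
  (forall n, normc (w n) <= 1) ->
  weight_norm P (sinc_weight k d (twist k e w)) <= 2.
Proof.
move=> d0 hd w1; apply: weight_norm_le => // n n0 nP.
rewrite /sinc_weight /twist Normc.normcM Normc.normcV Normc.normcM normc_expe mulr1 normc_real.
have : 0 < 2 * pi * d * n%:R ^+ k <= 1.
  rewrite !mulr_gt0 ?pi_gt0 ?exprn_gt0 ?ltr0n //=.
  apply: le_trans hd; apply: ler_pM => //; rewrite ?mulr_ge0 ?pi_ge0 ?(ltW d0) ?exprn_ge0 //.
    by rewrite ler_pM2r //; have := @pihalf_lt2 F; lra.
  by rewrite lerXn2r ?nnegrE // (le_trans _ nP).
move=> /sinc_bounds/andP[h1 _]; rewrite ger0_norm; last by lra.
rewrite ler_pdivrMr; last by lra.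
by have := w1 n; lra.
Qed.

(* A large sieve form of admissibility. *)
Lemma mean_value_at_points k (t D eps : F) : 1 <= t -> 0 < eps ->
  weight_uniform_admissible k t D ->
  exists2 eta : F, 0 < eta & exists2 C : F, 0 < C &
  forall P R : F, 2 <= R -> R <= P -> R <= P `^ eta ->
  forall w : nat -> F[i], (forall n, normc (w n) <= 1) ->
  forall (I : eqType) (s : seq I) (g : I -> F) (d m : F),
  0 < d -> 8 * d * P ^+ k <= 1 -> 4 * d <= 1 -> 0 <= m ->
  (forall i, i \in s ->
    (count (fun j => `|(g j - (Num.floor (g j))%:~R) - (g i - (Num.floor (g i))%:~R)| <= 4 * d) s)%:R
      <= m) ->
  \sum_(i <- s) normc (weyl_sum k P R w (g i)) `^ t
    <= C * (m / d) * P `^ (t - k%:R + D + eps).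
Proof.
move=> t1 e0 adm; have [eta eta0 [C C0 h]] := adm _ e0.
exists eta => //; exists (C * 2 `^ t * 2 `^ t) => [|P R R2 RP Re w w1 I s g d m d0 dP d1 m0 hm].
  by rewrite !mulr_gt0 ?powR_gt0.
have P0 : 0 < P by apply: lt_le_trans RP; lra.
pose th i := g i - (Num.floor (g i))%:~R.
have th01 i : 0 <= th i <= 1.
  by rewrite /th subr_ge0 floor_le /= ltW // ltrBlDl -[1]/(1%:~R) -intrD floorD1_gt.
(* A count around an arbitrary centre is at most the count of twice the radius around any one of the
   points found there. *)
have cnt x : (count (fun i => xpredT i && (`|th i - x| <= 2 * d)) s)%:R <= m.
  have [/hasP[i iI /= hi]|/hasPn hn] := boolP (has (fun i => `|th i - x| <= 2 * d) s).
    apply: le_trans (hm i iI); rewrite ler_nat; apply: sub_count => j /= hj.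
    have -> : g j - (Num.floor (g j))%:~R - (g i - (Num.floor (g i))%:~R) =
      (th j - x) - (th i - x) by rewrite /th; ring.
    by apply: le_trans (ler_normB _ _) _; lra.
  rewrite (eq_in_count (a2 := pred0)) ?count_pred0 // => i /hn /negbTE.
  by rewrite /= => ->.
have := @large_sieve I s xpredT th d t m k P R w t1 d0 dP d1 (fun i _ => th01 i) cnt.
have bnd e : (\int[mu]_(x in `[0%R, 1%R])
        (normc (weyl_sum k P R (sinc_weight k d (twist k e w)) x) `^ t)%:E
     <= (C * 2 `^ t * P `^ (t - k%:R + D + eps))%:E)%E.
  apply: le_trans (h P R R2 RP Re _) _; rewrite lee_fin.
  rewrite ler_wpM2r ?powR_ge0 // ler_wpM2l ?(ltW C0) //.
  rewrite ge0_ler_powR ?nnegrE ?weight_norm_ge0 ?(le_trans _ t1) //.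
  exact: sinc_twist_le.
have up e := lee_wpmul2l (x := m%:E) m0 (bnd e).
move=> /le_trans /(_ (leeD (up _) (up _))).
rewrite -!EFinM -EFinD lee_fin => le1.
move: le1; set S := (X in X <= _) => le1.
have S0 : 0 <= S by apply: sumr_ge0 => i _; rewrite mulr_ge0 ?powR_ge0 //; lra.
set T := \sum_(_ <- _) _.
have -> : T = S * 2 `^ t / (2 * d).
  rewrite /T /S mulr_suml mulr_suml; apply: eq_bigr => i _.
  have -> : weyl_sum k P R w (th i) = weyl_sum k P R w (g i).
    by rewrite /th -mulrNz weyl_sum_frac.
  have h2 : (2^-1 : F) `^ t = (2 `^ t)^-1.
    by rewrite -powR_inv1 // -powRrM mulN1r powRN.
  rewrite powRM ?normc_ge0 ?invr_ge0 // h2.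
  by field; rewrite !gt_eqF ?powR_gt0 //=; lra.
rewrite ler_pdivrMr; last by lra.
apply: (@le_trans _ _ ((m * (C * 2 `^ t * P `^ (t - k%:R + D + eps)) +
         m * (C * 2 `^ t * P `^ (t - k%:R + D + eps))) * 2 `^ t)).
  by rewrite ler_wpM2r ?powR_ge0.
by rewrite le_eqVlt; apply/orP; left; apply/eqP; field; rewrite gt_eqF.
Qed.

End WeylIntegral.

(** * Finite inequalities, and even moments as counts of equal power sums *)

Section FiniteInequalities.
Context {F : realFieldType}.

Lemma cauchy_schwarz_sum (I : Type) (s : seq I) (a b : I -> F) :
  (\sum_(i <- s) a i * b i) ^+ 2 <= (\sum_(i <- s) a i ^+ 2) * (\sum_(i <- s) b i ^+ 2).
Proof.
set C := \sum_(i <- s) _ * _; set A := (X in _ <= X * _); set B := (X in _ <= _ * X).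
have h (x y : F) : 0 <= x ^+ 2 * A - 2 * x * y * C + y ^+ 2 * B.
  have -> : x ^+ 2 * A - 2 * x * y * C + y ^+ 2 * B = \sum_(i <- s) (x * a i - y * b i) ^+ 2.
    rewrite !mulr_sumr -sumrB -big_split /=; apply: eq_bigr => i _; ring.
  by apply: sumr_ge0 => i _; exact: sqr_ge0.
have A0 : 0 <= A by apply: sumr_ge0 => i _; exact: sqr_ge0.
move: A0; rewrite le_eqVlt => /predU1P[A0|A0].
  have := h B C; have := h C 1; have := h (- C) 1; rewrite -A0; nra.
have := h C A.
have -> : C ^+ 2 * A - 2 * C * A * C + A ^+ 2 * B = A * (A * B - C ^+ 2) by ring.
by rewrite pmulr_rge0 // subr_ge0.
Qed.

(** The factor [2 ^ n.+1] allows an elementary proof: [g i] is compared with the threshold [c], half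
    the weighted mean, and the terms below it make up at most half of the left side. *)
Lemma holder_sum (I : Type) (s : seq I) (p : pred I) (a g : I -> F) (n : nat) :
  (forall i, 0 <= a i) -> (forall i, 0 <= g i) ->
  (\sum_(i <- s | p i) a i * g i) ^+ n.+1 <=
  2 ^+ n.+1 * (\sum_(i <- s | p i) a i) ^+ n * \sum_(i <- s | p i) a i * g i ^+ n.+1.
Proof.
move=> a0 g0; set S := \sum_(i <- s | p i) a i * g i.
set A := (X in _ * X ^+ n * _); set T := (X in _ <= _ * X).
have S0 : 0 <= S by apply: sumr_ge0 => i _; rewrite mulr_ge0.
have A0 : 0 <= A by apply: sumr_ge0.
have T0 : 0 <= T by apply: sumr_ge0 => i _; rewrite mulr_ge0 ?exprn_ge0.
move: S0; rewrite le_eqVlt => /predU1P[<-|S0].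
  by rewrite expr0n /= !mulr_ge0 ?exprn_ge0.
have {A0} : 0 < A.
  move: A0; rewrite le_eqVlt => /predU1P[A0|//].
  suff : S = 0 by move=> S1; rewrite S1 ltxx in S0.
  move: A0; rewrite /A /S => A0.
  apply/eqP; rewrite eq_le sumr_ge0 ?andbT; last by move=> i _; rewrite mulr_ge0.
  elim: s A0 {S0 S A T T0} => [|i s IH]; first by rewrite !big_nil.
  rewrite !big_cons; case: ifP => // pi A0.
  have h1 : 0 <= \sum_(j <- s | p j) a j by apply: sumr_ge0.
  have h2 := a0 i.
  have -> : a i = 0 by lra.
  by rewrite mul0r add0r; apply: IH; lra.
move=> A0.
pose c := S / (2 * A).
have c0 : 0 < c by rewrite divr_gt0 ?mulr_gt0.
have key : S * c ^+ n <= A * c ^+ n.+1 + T.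
  rewrite /S /A /T mulr_suml mulr_suml -big_split /=.
  apply: ler_sum => i _; rewrite -mulrA -mulrDr ler_wpM2l // !exprS.
  have [gc|cg] := leP (g i) c.
    by rewrite -[leLHS]addr0 lerD ?mulr_ge0 ?exprn_ge0 // ler_wpM2r ?exprn_ge0 // ltW.
  rewrite -[leLHS]add0r lerD //.
    exact: mulr_ge0 (ltW c0) (exprn_ge0 _ (ltW c0)).
  rewrite ler_wpM2l //; apply: lerXn2r; rewrite ?nnegrE //; exact: ltW.
have e1 : A * c ^+ n.+1 = S * c ^+ n / 2.
  by rewrite exprS /c; field; rewrite gt_eqF.
have key2 : S * c ^+ n <= 2 * T by move: key; rewrite e1; lra.
have -> : S ^+ n.+1 = (S * c ^+ n) * (2 * A) ^+ n.
  by rewrite -mulrA -exprMn /c mulfVK ?exprS // mulf_neq0 ?gt_eqF.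
apply: le_trans (ler_wpM2r _ key2) _; first by rewrite exprn_ge0 ?mulr_ge0 ?ltW.
by rewrite exprMn exprS le_eqVlt; apply/orP; left; apply/eqP; ring.
Qed.

End FiniteInequalities.

Section Parseval.
Context {F : realType}.
Local Notation normc := (@Normc.normc F).
Local Notation mu := (@lebesgue_measure F).

Lemma sin_cos_2pi_int (m : int) : sin (2 * pi * m%:~R) = 0 :> F /\ cos (2 * pi * m%:~R) = 1 :> F.
Proof.
have /eqP := @expe_int F m.
by rewrite /expe eq_complex /= => /andP[/eqP -> /eqP ->].
Qed.

Lemma parseval (T : finType) (p : pred T) (g : T -> nat) :
  (\int[mu]_(x in `[0%R, 1%R]) (normc (\sum_(f | p f) expe (x * (g f)%:R)) ^+ 2)%:E =
   (\sum_(f | p f) \sum_(f' | p f') (g f == g f')%:R)%:E)%E.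
Proof.
(* When [g] agrees on the pair, [a] vanishes; the value 1 of [c] only keeps the frequency nonzero
   there. *)
pose c (ff : T * T) : F := if g ff.1 == g ff.2 then 1 else 2 * pi * ((g ff.1)%:Z - (g ff.2)%:Z)%:~R.
pose a (ff : T * T) : F := (g ff.1 != g ff.2)%:R.
pose s := enum [pred ff : T * T | p ff.1 && p ff.2].
have c0 ff : c ff != 0.
  rewrite /c; case: ifP => [_|/negbT h]; first by rewrite oner_neq0.
  rewrite !mulf_neq0 ?(gt_eqF (pi_gt0 F)) ?pnatr_eq0 // intr_eq0 subr_eq0.
  by rewrite eqz_nat.
have sE (G : T * T -> F) :
    \sum_(ff <- s) G ff = \sum_(f | p f) \sum_(f' | p f') G (f, f').
  by rewrite /s big_enum pair_big_dep; apply: eq_big => [[f f']|[f f'] _].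
have e x : normc (\sum_(f | p f) expe (x * (g f)%:R)) ^+ 2 =
   \sum_(f | p f) \sum_(f' | p f') (g f == g f')%:R
     + \sum_(ff <- s) (a ff * cos (c ff * x) + 0 * sin (c ff * x)).
  rewrite normc_sqr !raddf_sum /= !expr2 !mulr_suml -big_split /=.
  rewrite sE.
  rewrite -big_split /=; apply: eq_bigr => f pf.
  rewrite !mulr_sumr -!big_split /=; apply: eq_bigr => f' pf'.
  rewrite /a /c /= mul0r addr0.
  have -> : cos (2 * pi * (x * (g f)%:R)) * cos (2 * pi * (x * (g f')%:R)) +
      sin (2 * pi * (x * (g f)%:R)) * sin (2 * pi * (x * (g f')%:R)) =
      cos (2 * pi * ((g f)%:Z - (g f')%:Z)%:~R * x).
    by rewrite -cosB; congr cos; rewrite intrB /=; ring.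
  case: eqP => [->|_] /=; last by rewrite add0r mul1r.
  by rewrite subrr mulr0 mul0r cos0 mul0r addr0.
under eq_integral do rewrite e.
rewrite integral_trig // subr0 mulr1 [X in (_ + X)%R]big1 ?addr0 // => ff _.
rewrite !mulr0 mulr1 mul0r subr0 sin0 subr0 /a /c; case: eqP => _ /=; first by rewrite !mul0r.
by have [-> _] := sin_cos_2pi_int ((g ff.1)%:Z - (g ff.2)%:Z); rewrite mulr0 mul0r.
Qed.

Lemma weyl_sum_pow (k w : nat) (V R : F) (c : nat -> F[i]) (x : F) :
  weyl_sum k V R c x ^+ w =
  \sum_(f : {ffun 'I_w -> 'I_(Num.truncn V).+1} | [forall i, smooth V R (f i)])
     (\prod_i c (f i)) * expe (x * (\sum_i f i ^ k)%:R).
Proof.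
rewrite /weyl_sum.
(* The index 0 may be added, as it is not smooth. *)
have -> (G : nat -> F[i]) : \sum_(1 <= n < (Num.truncn V).+1 | smooth V R n) G n =
    \sum_(n < (Num.truncn V).+1 | smooth V R n) G n.
  by rewrite -(big_mkord (smooth V R) G) [in RHS]big_ltn_cond.
rewrite -[w in LHS]card_ord -prodr_const bigA_distr_big /=.
apply: eq_big => [f|f _].
  by apply/idP/forallP => [/ffun_onP //|h]; apply/ffun_onP.
rewrite big_split /=; congr (_ * _).
by rewrite natr_sum mulr_sumr expe_sum; apply: eq_bigr => i _; rewrite natrX.
Qed.

Definition power_sum_reps (k w : nat) (V R : F) (h : nat) : nat :=
  #|[pred f : {ffun 'I_w -> 'I_(Num.truncn V).+1} |
       [forall i, smooth V R (f i)] && (\sum_i f i ^ k == h)%N]|.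

Lemma sum_power_sum (k w : nat) (V R : F) (H : nat) (G : nat -> F) :
  (w * (Num.truncn V) ^ k < H)%N ->
  \sum_(f : {ffun 'I_w -> 'I_(Num.truncn V).+1} | [forall i, smooth V R (f i)])
     G (\sum_i f i ^ k)%N = \sum_(h < H) (power_sum_reps k w V R h)%:R * G h.
Proof.
move=> hH.
have b (f : {ffun 'I_w -> 'I_(Num.truncn V).+1}) : (\sum_i f i ^ k < H)%N.
  apply: leq_ltn_trans hH; rewrite -[w in leqRHS]card_ord -sum_nat_const.
  apply: leq_sum => i _; case: k => [|k]; first by rewrite !expn0.
  by rewrite leq_exp2r // -ltnS.
rewrite (partition_big (fun f => Ordinal (b f)) xpredT) //=.
apply: eq_bigr => h _.
rewrite /power_sum_reps -sum1_card natr_sum mulr_suml.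
by apply: eq_big => [f|f /andP[_ /eqP <-]]; rewrite ?mul1r.
Qed.

Lemma sum_power_sum_reps_sq (k w : nat) (V R : F) (H : nat) : (w * (Num.truncn V) ^ k < H)%N ->
  ((\sum_(h < H) (power_sum_reps k w V R h)%:R ^+ 2)%:E =
   \int[mu]_(x in `[0%R, 1%R]) (normc (weyl_sum k V R (fun=> 1) x) ^+ (2 * w))%:E)%E.
Proof.
move=> hH.
have E x : normc (weyl_sum k V R (fun=> 1) x) ^+ (2 * w) =
    normc (\sum_(f : {ffun 'I_w -> 'I_(Num.truncn V).+1} | [forall i, smooth V R (f i)])
       expe (x * (\sum_i f i ^ k)%:R)) ^+ 2.
  rewrite mulnC exprM -normcX weyl_sum_pow; congr (normc _ ^+ 2).
  by apply: eq_bigr => f _; rewrite big1 ?mul1r.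
under eq_integral do rewrite E.
rewrite parseval; congr EFin.
transitivity (\sum_(h < H) (power_sum_reps k w V R h)%:R *
    \sum_(h' < H) (power_sum_reps k w V R h')%:R * (h == h')%N%:R : F).
  apply: eq_bigr => h _; rewrite (bigD1 h) //= eqxx mulr1 big1 ?addr0 ?expr2 // => h' h'h.
  by rewrite eq_sym (negbTE h'h) mulr0.
rewrite -(sum_power_sum R (fun h => \sum_(h' < H) (power_sum_reps k w V R h')%:R * (h == h')%N%:R) hH) /=.
by apply: eq_bigr => f _; rewrite (sum_power_sum R (fun h => (\sum_i f i ^ k == h)%N%:R) hH).
Qed.

(* Only the diagonal solutions of the underlying Diophantine equation are kept. *)
Lemma smooth_count_le_mean (k w : nat) (V R : F) :
  (((\sum_(1 <= n < (Num.truncn V).+1 | smooth V R n) 1) ^+ w)%:E <=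
   \int[mu]_(x in `[0%R, 1%R]) (normc (weyl_sum k V R (fun=> 1) x) ^+ (2 * w))%:E)%E.
Proof.
have hH : (w * (Num.truncn V) ^ k < (w * (Num.truncn V) ^ k).+1)%N by [].
rewrite -(sum_power_sum_reps_sq _ hH) lee_fin.
(* At the argument 0 the expanded power counts all tuples of smooth numbers, which is the sum of the
   representation numbers; each of these is at most its square. *)
have : weyl_sum k V R (fun=> 1) 0 ^+ w =
    \sum_(f : {ffun 'I_w -> 'I_(Num.truncn V).+1} | [forall i, smooth V R (f i)]) 1.
  by rewrite weyl_sum_pow; apply: eq_bigr => f _; rewrite big1 // mul1r mul0r expe0.
have -> : weyl_sum k V R (fun=> 1) 0 = (\sum_(1 <= n < (Num.truncn V).+1 | smooth V R n) 1)%:C%C.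
  rewrite raddf_sum; apply: eq_bigr => n _; rewrite mul0r expe0 mulr1.
  by [].
have -> : \sum_(f : {ffun 'I_w -> 'I_(Num.truncn V).+1} | [forall i, smooth V R (f i)]) (1 : F[i]) =
  (\sum_(h < (w * (Num.truncn V) ^ k).+1) (power_sum_reps k w V R h)%:R)%:C%C.
  have := sum_power_sum R (fun=> 1) hH; under [X in _ = X -> _]eq_bigr do rewrite mulr1.
  by move=> <-; rewrite raddf_sum; apply: eq_bigr.
rewrite -rmorphXn => /complexI ->.
apply: ler_sum => h _; rewrite -natrX ler_nat; by case: (power_sum_reps _ _ _ _ _) => // n; rewrite expnS leq_pmulr.
Qed.

End Parseval.

(** * The bilinear estimate *)

Section Bilinear.
Context {F : realType}.
Local Notation normc := (@Normc.normc F).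
Local Notation mu := (@lebesgue_measure F).

Lemma weight_norm_one_le (P : F) : weight_norm P (fun=> 1) <= 1.
Proof. by apply: weight_norm_le => // n _ _; rewrite Normc.normc1. Qed.

Lemma sum_power_sum_reps_sq_le k w (D eps : F) : 0 < eps -> (0 < w)%N ->
  weight_uniform_admissible k (2 * w%:R) D ->
  exists2 eta : F, 0 < eta & exists2 C : F, 0 < C &
  forall V R : F, 2 <= R -> R <= V -> R <= V `^ eta ->
  (\int[mu]_(x in `[0%R, 1%R]) (normc (weyl_sum k V R (fun=> 1) x) ^+ (2 * w))%:E
   <= (C * V `^ (2 * w%:R - k%:R + D + eps))%:E)%E.
Proof.
move=> e0 w0 adm; have [eta eta0 [C C0 h]] := adm _ e0.
exists eta => //; exists C => // V R R2 RV Re.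
under eq_integral do rewrite -powR_mulrn ?normc_ge0 // natrM.
apply: le_trans (h V R R2 RV Re (fun=> 1)) _.
rewrite lee_fin ler_wpM2r ?powR_ge0 // -[leRHS]mulr1 ler_wpM2l ?(ltW C0) //.
apply: (@le_trans _ _ (1 `^ (2 * w%:R))); last by rewrite powR1.
rewrite ge0_ler_powR ?nnegrE ?weight_norm_ge0 ?mulr_ge0 //.
exact: weight_norm_one_le.
Qed.

Lemma smooth_sum_le (V R : F) (Y : pred nat) (G : nat -> F) (B : F) :
  0 <= V -> 0 <= B -> (forall y, 0 <= G y <= B) ->
  \sum_(1 <= y < (Num.truncn V).+1 | smooth V R y && Y y) G y <= V * B.
Proof.
move=> V0 B0 h; apply: (@le_trans _ _ (\sum_(1 <= y < (Num.truncn V).+1) B)).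
  by rewrite big_mkcond; apply: ler_sum => y _; have /andP[] := h y; case: ifP.
rewrite sumr_const_nat subn1 /= -mulr_natl ler_wpM2r //.
by rewrite truncn_le.
Qed.

(** After opening the [w]-th power the sum over [y] is taken innermost. The rotations that removed
    the moduli become its weights [b], set to 0 off [Y], and its argument is [a] times a sum of [w]
    k-th powers. *)
Lemma sum_weyl_pow_le k w (V R : F) (c : nat -> F[i]) (Y : pred nat) (a : F) (H : nat) :
  (w * (Num.truncn V) ^ k < H)%N -> (forall n, normc (c n) <= 1) ->
  exists2 b : nat -> F[i], (forall n, normc (b n) <= 1) &
  \sum_(1 <= y < (Num.truncn V).+1 | smooth V R y && Y y)
     normc (weyl_sum k V R c (a * y%:R ^+ k)) ^+ w
  <= \sum_(h < H) (power_sum_reps k w V R h)%:R * normc (weyl_sum k V R b (a * h%:R)).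
Proof.
move=> hH c1.
have rot y : exists u : F[i], normc u = 1 /\
    u * weyl_sum k V R c (a * y%:R ^+ k) ^+ w = (normc (weyl_sum k V R c (a * y%:R ^+ k)) ^+ w)%:C%C.
  by have [u u1 hu] := normc_rot (weyl_sum k V R c (a * y%:R ^+ k) ^+ w);
    exists u; rewrite hu normcX.
pose u y := sval (cid (rot y)).
have u1 y : normc (u y) = 1 by rewrite /u; case: cid => ? [].
have hu y : u y * weyl_sum k V R c (a * y%:R ^+ k) ^+ w =
   (normc (weyl_sum k V R c (a * y%:R ^+ k)) ^+ w)%:C%C by rewrite /u; case: cid => ? [].
pose b y : F[i] := if Y y then u y else 0.
exists b; first by move=> n; rewrite /b; case: ifP; rewrite ?u1 ?Normc.normc0.
set S := (X in X <= _).
have -> : S = normc S%:C%C.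
  rewrite normc_real ger0_norm // /S; apply: sumr_ge0 => y _.
  by rewrite exprn_ge0 ?normc_ge0.
have -> : S%:C%C = \sum_(f : {ffun 'I_w -> 'I_(Num.truncn V).+1} | [forall i, smooth V R (f i)])
     (\prod_i c (f i)) * weyl_sum k V R b (a * (\sum_i f i ^ k)%N%:R).
  rewrite /S raddf_sum /=.
  under eq_bigr => y _ do rewrite -hu weyl_sum_pow mulr_sumr.
  rewrite exchange_big /=; apply: eq_bigr => f _.
  rewrite /weyl_sum mulr_sumr big_mkcondr /=; apply: eq_bigr => y _.
  rewrite /b; case: ifP => _; last by rewrite mul0r mulr0.
  rewrite mulrCA; congr (_ * (_ * expe _)); ring.
apply: le_trans (normc_sum _ _ _) _.
rewrite -(sum_power_sum R (fun h => normc (weyl_sum k V R b (a * h%:R))) hH).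
apply: ler_sum => f _; rewrite Normc.normcM -[leRHS]mul1r ler_wpM2r ?normc_ge0 //.
elim/big_ind: _ => [|x y x1 y1|i _]; rewrite ?Normc.normc1 //.
by rewrite Normc.normcM mulr_ile1 ?normc_ge0.
Qed.

Lemma sum_reps_le k w (V R : F) (H : nat) : 0 <= V -> (w * (Num.truncn V) ^ k < H)%N ->
  \sum_(h < H) (power_sum_reps k w V R h)%:R <= V ^+ w.
Proof.
move=> V0 hH; have := sum_power_sum R (fun=> (1 : F)) hH.
under [X in _ = X -> _]eq_bigr do rewrite mulr1.
move=> <-.
have : \prod_(i < w) \sum_(n < (Num.truncn V).+1 | smooth V R n) (1 : F) <= V ^+ w.
  rewrite prodr_const card_ord lerXn2r ?nnegrE ?sumr_ge0 //.
  have := @smooth_sum_le V R xpredT (fun=> 1) 1 V0 ler01.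
  rewrite mulr1 => /(_ (fun=> introT andP (conj ler01 (lexx _)))); apply: le_trans.
  rewrite -(big_mkord (smooth V R) (fun=> 1)) big_ltn_cond //=.
  by under [leRHS]eq_bigl do rewrite andbT.
rewrite bigA_distr_big /=; apply: le_trans.
rewrite le_eqVlt; apply/orP; left; apply/eqP.
apply: eq_big => [f|f _]; last by rewrite big1.
by apply/forallP/ffun_onP.
Qed.

(* Hoelder's inequality turns the sum over [y] into a sum over [h] of [weyl_sum k V R c (a * h)], where [h]
   is weighted by its number of representations as a sum of [w.+1] k-th powers. A second use of it
   separates the weights, whose square mean is again an admissible mean value, from the large sieve. *)
Lemma bilinear_estimate k w (D eps : F) : 0 < eps ->
  weight_uniform_admissible k (2 * w.+1%:R) D ->
  exists2 eta : F, 0 < eta & exists2 C : F, 0 < C &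
  forall V R : F, 2 <= R -> R <= V -> R <= V `^ eta ->
  forall (c : nat -> F[i]) (Y : pred nat) (a d m : F) (H : nat),
  (forall n, normc (c n) <= 1) -> (w.+1 * (Num.truncn V) ^ k < H)%N ->
  0 < d -> 8 * d * V ^+ k <= 1 -> 4 * d <= 1 -> 0 <= m ->
  (forall i, i \in iota 0 H ->
    (count (fun j => `|(a * j%:R - (Num.floor (a * j%:R))%:~R)
        - (a * i%:R - (Num.floor (a * i%:R))%:~R)| <= 4 * d) (iota 0 H))%:R <= m) ->
  (\sum_(1 <= y < (Num.truncn V).+1 | smooth V R y && Y y)
     normc (weyl_sum k V R c (a * y%:R ^+ k))) ^+ (2 * w.+1 * w.+1)
  <= C * (m / d) * V `^ (4 * w.+1%:R ^+ 2 - 2 * k%:R + 2 * D + 2 * eps).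
Proof.
move=> e0 adm.
have t1 : 1 <= 2 * w.+1%:R :> F by rewrite -natrM ler1n.
have [eta1 eta10 [C1 C10 h1]] := sum_power_sum_reps_sq_le e0 (ltn0Sn w) adm.
have [eta2 eta20 [C2 C20 h2]] := mean_value_at_points t1 e0 adm.
exists (Num.min eta1 eta2); first by rewrite lt_min eta10.
exists (2 ^+ (w.+1 * (2 * w.+1)) * (2 ^+ (w.+1 * 2) * (C1 * C2))).
  rewrite mulr_gt0 ?exprn_gt0 // mulr_gt0 ?exprn_gt0 // mulr_gt0 //.
move=> V R R2 RV Re c Y a d m H c1 hH d0 dV d1 m0 cnt.
have V1 : 1 <= V by lra.
have V0 : 0 <= V by lra.
have Re1 : R <= V `^ eta1 by apply: le_trans Re _; rewrite ler_powR // ge_min lexx.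
have Re2 : R <= V `^ eta2 by apply: le_trans Re _; rewrite ler_powR // ge_min lexx orbT.
have [b b1 hb] := sum_weyl_pow_le R Y a hH c1.
set E := 2 * w.+1%:R - k%:R + D + eps in h1 h2.
set S := (X in X ^+ _ <= _).
set U := \sum_(h < H) _ in hb.
pose Z := \sum_(h < H) (power_sum_reps k w.+1 V R h)%:R * normc (weyl_sum k V R b (a * h%:R)) ^+ w.+1.
have J : \sum_(h < H) (power_sum_reps k w.+1 V R h)%:R ^+ 2 <= C1 * V `^ E.
  by rewrite -lee_fin (sum_power_sum_reps_sq R hH); exact: h1.
have K : \sum_(h < H) normc (weyl_sum k V R b (a * h%:R)) ^+ (2 * w.+1) <= C2 * (m / d) * V `^ E.
  have := h2 V R R2 RV Re2 b b1 _ (iota 0 H) (fun h => a * h%:R) d m d0 dV d1 m0 cnt.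
  have -> : iota 0 H = index_iota 0 H by rewrite /index_iota subn0.
  rewrite big_mkord; apply: le_trans.
  by apply: ler_sum => h _; rewrite -natrM powR_mulrn ?normc_ge0.
have S0 : 0 <= S by apply: sumr_ge0 => y _; exact: normc_ge0.
have U0 : 0 <= U by apply: sumr_ge0 => y _; rewrite mulr_ge0 ?normc_ge0.
have Z0 : 0 <= Z by apply: sumr_ge0 => y _; rewrite mulr_ge0 ?exprn_ge0 ?normc_ge0.
have s1 : S ^+ w.+1 <= 2 ^+ w.+1 * V ^+ w * U.
  have := @holder_sum F _ (index_iota 1 (Num.truncn V).+1) (fun y => smooth V R y && Y y)
    (fun=> 1) (fun y => normc (weyl_sum k V R c (a * y%:R ^+ k))) w (fun=> ler01)
    (fun=> normc_ge0 _).
  under [X in X ^+ _ <= _]eq_bigr do rewrite mul1r.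
  under [X in _ <= _ * X]eq_bigr do rewrite mul1r.
  move=> /le_trans; apply.
  apply: ler_pM => //.
  - by rewrite mulr_ge0 ?exprn_ge0 ?sumr_ge0.
  - by apply: sumr_ge0 => y _; rewrite exprn_ge0 ?normc_ge0.
  - rewrite ler_wpM2l ?exprn_ge0 // lerXn2r ?nnegrE ?sumr_ge0 //.
    have := @smooth_sum_le V R Y (fun=> 1) 1 V0 ler01.
    by rewrite mulr1; apply => _; rewrite ler01 lexx.
have s2 : U ^+ w.+1 <= 2 ^+ w.+1 * (V ^+ w.+1) ^+ w * Z.
  have := @holder_sum F _ (index_enum 'I_H) xpredT
    (fun h => (power_sum_reps k w.+1 V R h)%:R) (fun h => normc (weyl_sum k V R b (a * (h : nat)%:R)))
    w (fun=> ler0n _ _) (fun=> normc_ge0 _).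
  move=> /le_trans; apply; rewrite ler_wpM2r // ler_wpM2l ?exprn_ge0 //.
  by rewrite lerXn2r ?nnegrE ?exprn_ge0 ?sumr_ge0 // sum_reps_le.
have s3 : Z ^+ 2 <= (C1 * V `^ E) * (C2 * (m / d) * V `^ E).
  apply: le_trans (@cauchy_schwarz_sum F _ (index_enum 'I_H) _ _) _.
  apply: ler_pM => //; try by apply: sumr_ge0 => y _; rewrite exprn_ge0 ?exprn_ge0 ?normc_ge0.
  by under eq_bigr do rewrite -exprM mulnC.
rewrite -mulnA mulnC -mulnA exprM.
have q1 : (S ^+ w.+1) ^+ (w.+1 * 2) <= (2 ^+ w.+1 * V ^+ w) ^+ (2 * w.+1) * (U ^+ w.+1) ^+ 2.
  apply: (@le_trans _ _ ((2 ^+ w.+1 * V ^+ w * U) ^+ (w.+1 * 2))).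
    by rewrite lerXn2r ?nnegrE ?mulr_ge0 ?exprn_ge0.
  by rewrite exprMn mulnC -exprM [(w.+1 * 2)%N]mulnC.
have q2 : (U ^+ w.+1) ^+ 2 <= (2 ^+ w.+1 * (V ^+ w.+1) ^+ w) ^+ 2 * Z ^+ 2.
  by rewrite -exprMn lerXn2r ?nnegrE ?mulr_ge0 ?exprn_ge0.
apply: le_trans q1 _.
apply: le_trans (ler_wpM2l _ q2) _; first by rewrite !exprn_ge0 ?mulr_ge0 ?exprn_ge0.
apply: le_trans (ler_wpM2l _ (ler_wpM2l _ s3)) _.
- by rewrite !exprn_ge0 ?mulr_ge0 ?exprn_ge0.
- by rewrite !exprn_ge0 ?mulr_ge0 ?exprn_ge0.
rewrite le_eqVlt; apply/orP; left; apply/eqP.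
(* With [n = w.+1], the two uses of Hoelder's inequality contribute [2 n (n - 1)] each and the two
   mean values [2 E], in all [4 n ^ 2 - 2 k + 2 D + 2 eps]. *)
have -> : V `^ (4 * w.+1%:R ^+ 2 - 2 * k%:R + 2 * D + 2 * eps) =
   V ^+ (w * (2 * w.+1)) * V ^+ (w.+1 * w * 2) * (V `^ E * V `^ E).
  rewrite -!(@powR_mulrn F V) // -!powRD; try by apply/implyP => _; rewrite gt_eqF //; lra.
  congr (_ `^ _); rewrite /E !natrM -[w.+1%:R]natr1; ring.
rewrite !exprMn -!exprM; ring.
Qed.

End Bilinear.

(** * Unique factorisations of the summation variable *)

Section Factorizations.

(** Common to the two factorisations used below: cutting the sequence of primes at a threshold, and
    separating the primes of [q] from the rest. *)
Lemma sum_over_factorizations (V : nmodType) (K : nat) (phi : nat -> V) (S : pred nat) (good : rel nat) :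
  (forall n, (n < K)%N -> S n -> (0 < n)%N) ->
  (forall n, (n < K)%N -> S n -> exists a b, good a b /\ (a * b = n)%N) ->
  (forall a b a' b', good a b -> good a' b' -> (a * b = a' * b')%N -> a = a' /\ b = b') ->
  (forall n, (K <= n)%N || ~~ S n -> phi n = 0) ->
  \sum_(0 <= n < K) phi n =
  \sum_(0 <= a < K) \sum_(0 <= b < K | good a b) phi (a * b)%N.
Proof.
move=> Sgt0 ex uni supp.
pose s2 := [seq p <- [seq (a, b) | a <- index_iota 0 K, b <- index_iota 0 K] |
   [&& good p.1 p.2, (p.1 * p.2 < K)%N & S (p.1 * p.2)%N]].
have pm : perm_eq [seq n <- index_iota 0 K | S n] [seq (p.1 * p.2)%N | p <- s2].
  apply: uniq_perm; first by rewrite filter_uniq ?iota_uniq.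
    rewrite map_inj_in_uniq.
      by rewrite filter_uniq // allpairs_uniq ?iota_uniq // => -[a b] [a' b'].
    move=> [a b] [a' b']; rewrite !mem_filter /= => /andP[/andP[g _] _] /andP[/andP[g' _] _] e.
    by have [-> ->] := uni _ _ _ _ g g' e.
  move=> n; rewrite mem_filter mem_index_iota /=; apply/idP/mapP.
    move=> /andP[Sn nK]; have [a [b [g e]]] := ex n nK Sn.
    exists (a, b) => //; rewrite mem_filter /= e g nK Sn /=.
    have n0 := Sgt0 _ nK Sn; rewrite -e muln_gt0 in n0; move: n0 => /andP[a0 b0].
    by apply/allpairsP; exists (a, b); rewrite !mem_index_iota; split => //=;
      apply: leq_ltn_trans nK; rewrite -e ?leq_pmulr ?leq_pmull.
  by move=> [[a b]]; rewrite mem_filter /= => /andP[/and3P[_ h1 h2] _] ->; rewrite h1 h2.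
transitivity (\sum_(0 <= n < K | S n) phi n).
  rewrite [RHS]big_mkcond; apply: eq_bigr => n _; case: ifPn => // h.
  by rewrite supp // h orbT.
rewrite -big_filter (perm_big _ pm) big_map big_filter big_mkcond.
rewrite big_allpairs; apply: eq_bigr => a _.
rewrite [RHS]big_mkcond; apply: eq_bigr => b _ /=.
case: (good a b) => //=; case: ifPn => // h; rewrite supp //.
by rewrite leqNgt -negb_and h.
Qed.

(* [u] is the shortest product of the largest primes of [u * v] that reaches [M]. *)
Definition splits_at (F : realType) (M : F) (u v : nat) :=
  [&& M <= u%:R, u%:R < (pdiv u)%:R * M, (0 < v)%N & all (leq^~ (pdiv u)) (primes v)].

Section SplitsAt.
Context {F : realType}.
Implicit Types M : F.

Lemma pdiv_min_mul u v : (1 < u)%N -> (1 < v)%N -> all (leq^~ (pdiv u)) (primes v) ->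
  pdiv (u * v) = pdiv v.
Proof.
move=> u1 v1 /allP h; apply/eqP; rewrite eqn_leq; apply/andP; split.
  by apply: pdiv_min_dvd; [exact: prime_gt1 (pdiv_prime v1)|rewrite dvdn_mull ?pdiv_dvd].
have uv1 : (1 < u * v)%N by rewrite (leq_trans u1) // leq_pmulr // ltnW.
have := pdiv_prime uv1; set p := pdiv (u * v) => pp.
have : (p %| u * v)%N by exact: pdiv_dvd.
rewrite Euclid_dvdM // => /orP[pu|pv]; last by apply: pdiv_min_dvd => //; exact: prime_gt1.
apply: (@leq_trans (pdiv u)); last by apply: pdiv_min_dvd => //; exact: prime_gt1.
by apply: h; rewrite mem_primes pdiv_prime // pdiv_dvd ltnW.
Qed.

Lemma splits_at_gt1 M u v : 1 < M -> splits_at M u v -> (1 < u)%N.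
Proof. by move=> M1 /and4P[h _ _ _]; rewrite -(ltr1n F); exact: lt_le_trans h. Qed.

(** While the cofactor of the smallest prime of [n] still reaches [M], that prime belongs to [v];
    once it does not, [u = n] is itself minimal. *)
Lemma splits_at_exists M n : 1 < M -> M <= n%:R ->
  exists u v, splits_at M u v /\ (u * v = n)%N.
Proof.
move=> M1; elim/ltn_ind: n => n IH Mn.
have n1 : (1 < n)%N by rewrite -(ltr1n F); exact: lt_le_trans Mn.
have pn := pdiv_prime n1; have dn := pdiv_dvd n.
have en : (n %/ pdiv n * pdiv n = n)%N by rewrite divnK.
have [h|h] := leP M (n %/ pdiv n)%:R.
  have [||u [v [g e]]] := IH (n %/ pdiv n)%N; [by rewrite ltn_Pdiv ?prime_gt1 // ltnW|by []|].
  have u1 := splits_at_gt1 M1 g; move: g => /and4P[g1 g2 g3 g4].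
  exists u, (v * pdiv n)%N; split; last by rewrite mulnA e.
  apply/and4P; split => //; first by rewrite muln_gt0 g3 prime_gt0.
  apply/allP => r; rewrite primesM ?(prime_gt0 pn) // => /orP[/(allP g4)//|].
  rewrite primes_prime // inE => /eqP ->; apply: pdiv_min_dvd.
    exact: prime_gt1 (pdiv_prime u1).
  by rewrite -en -e -mulnA dvdn_mulr ?pdiv_dvd.
exists n, 1%N; rewrite muln1; split => //; apply/and4P; split => //.
by rewrite -[in ltLHS]en natrM mulrC ltr_pM2l // ltr0n prime_gt0.
Qed.

(** When [v] and [v'] both exceed 1, the smallest prime of the common product divides each of them
    and is removed from both. By [one] they cannot differ by just one of them being 1: otherwise
    [a * (b %/ pdiv b)] would lie below [M <= a]. *)
Lemma splits_at_uniq M u v u' v' : 1 < M -> splits_at M u v -> splits_at M u' v' ->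
  (u * v = u' * v')%N -> u = u' /\ v = v'.
Proof.
move=> M1.
have one a b : splits_at M (a * b) 1 -> splits_at M a b -> (b = 1)%N.
  move=> h1 h2; have := splits_at_gt1 M1 h2; move: h1 h2.
  move=> /and4P[_ h _ _] /and4P[g1 g2 g3 g4] a1.
  apply/eqP; rewrite eqn_leq g3 andbT leqNgt; apply/negP => b1.
  move: h; rewrite pdiv_min_mul // => h.
  have eab : (a * b = pdiv b * (a * (b %/ pdiv b)))%N.
    by rewrite mulnCA [(pdiv b * _)%N]mulnC divnK ?pdiv_dvd.
  move: h; rewrite eab natrM ltr_pM2l ?ltr0n ?prime_gt0 ?pdiv_prime // => h.
  have : (a%:R : F) <= (a * (b %/ pdiv b))%:R.
    by rewrite ler_nat leq_pmulr // divn_gt0 ?prime_gt0 ?pdiv_prime // dvdn_leq ?pdiv_dvd.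
  by move=> h'; have := lt_le_trans h (le_trans g1 h'); rewrite ltxx.
elim/ltn_ind: v v' => v IH v' g g' e.
have v0 : (0 < v)%N by case/and4P: g.
have v'0 : (0 < v')%N by case/and4P: g'.
have [v1|v1] := leqP v 1.
  have {}v1 : v = 1%N by apply/eqP; rewrite eqn_leq v1.
  rewrite v1 muln1 in e g; rewrite e in g.
  by rewrite v1 e (one _ _ g g') muln1.
have [v'1|v'1] := leqP v' 1.
  have {}v'1 : v' = 1%N by apply/eqP; rewrite eqn_leq v'1.
  rewrite v'1 muln1 in e g'; rewrite -e in g'.
  by move: v1; rewrite (one _ _ g' g).
have u1 := splits_at_gt1 M1 g; have u'1 := splits_at_gt1 M1 g'.
have ep : pdiv v = pdiv v'.
  rewrite -(pdiv_min_mul u1 v1) ?e ?pdiv_min_mul //; first by case/and4P: g'.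
  by case/and4P: g.
have pv := pdiv_prime v1.
have ev := divnK (pdiv_dvd v); have ev' := divnK (pdiv_dvd v').
have sub a b : (1 < b)%N -> splits_at M a b -> splits_at M a (b %/ pdiv b).
  move=> b1 /and4P[h1 h2 h3 /allP h4]; apply/and4P; split => //.
    by rewrite divn_gt0 ?prime_gt0 ?pdiv_prime // dvdn_leq ?pdiv_dvd.
  apply/allP => r; rewrite mem_primes => /and3P[pr _ rd]; apply: h4.
  by rewrite mem_primes pr h3 (dvdn_trans rd) // dvdn_div // pdiv_dvd.
have [] := IH (v %/ pdiv v)%N _ (v' %/ pdiv v')%N (sub _ _ v1 g) (sub _ _ v'1 g').
- by rewrite ltn_Pdiv ?prime_gt1.
- apply/eqP; rewrite -(eqn_pmul2r (prime_gt0 pv)) -mulnA ev [in X in _ == X]ep -mulnA ev'.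
  exact/eqP.
- by move=> -> h; split => //; rewrite -ev -ev' h ep.
Qed.

(** The condition on [v] sees [u] only through [p = pdiv u]. With [p] outermost, the weights in the
    sum over [v] can be fixed before [u] varies. *)
Lemma sum_splits_at (V : nmodType) M (K r : nat) (phi : nat -> V) : 1 < M ->
  (forall n, [|| (K <= n)%N, n%:R < M | ~~ all (leq^~ r) (primes n)] -> phi n = 0) ->
  \sum_(0 <= n < K) phi n =
  \sum_(0 <= p < r.+1) \sum_(0 <= u < K | pdiv u == p)
     \sum_(0 <= v < K | splits_at M u v) phi (u * v)%N.
Proof.
move=> M1 supp.
have M0 : 0 < M by exact: lt_trans M1.
rewrite (@sum_over_factorizations _ K phi (fun n => M <= n%:R) (splits_at M)).
- pose G u := \sum_(0 <= v < K | splits_at M u v) phi (u * v)%N.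
  rewrite -/(\sum_(0 <= u < K) G u).
  under [RHS]eq_bigr do rewrite big_mkcond.
  rewrite exchange_big_nat /=; apply: eq_bigr => u _.
  rewrite -big_mkcond /=.
  under [RHS]eq_bigl do rewrite eq_sym.
  rewrite big_nat1_eq ltnS leq0n /=; case: leqP => // ru.
  rewrite /G big1 // => v g; apply: supp.
  apply/or3P/Or33/negP => /allP /(_ (pdiv u)).
  rewrite mem_primes pdiv_prime ?(splits_at_gt1 M1 g) //= dvdn_mulr ?pdiv_dvd // andbT.
  rewrite muln_gt0 (ltnW (splits_at_gt1 M1 g)); have /and4P[_ _ -> _] := g.
  by move=> /(_ isT); rewrite leqNgt ru.
- by move=> n _ h; rewrite -(ltr0n F); exact: lt_le_trans h.
- by move=> n _ h; exact: splits_at_exists.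
- by move=> a b a' b'; exact: splits_at_uniq.
- by move=> n h; apply: supp; rewrite ltNge; case/orP: h => -> //; rewrite orbT.
Qed.

End SplitsAt.
End Factorizations.

Section CoprimePart.

Lemma coprime_pi_nat m q : (0 < q)%N -> (0 < m)%N -> coprime m q = (\pi(q)^')%N.-nat m.
Proof.
by move=> q0 m0; rewrite coprime_sym coprime_pi'.
Qed.

Lemma sum_coprime_split (V : nmodType) (q K : nat) (phi : nat -> V) : (0 < q)%N ->
  phi 0%N = 0 -> (forall n, (K <= n)%N -> phi n = 0) ->
  \sum_(0 <= n < K) phi n =
  \sum_(0 <= d < K | \pi(q).-nat d)
     \sum_(0 <= m < K | (0 < m)%N && coprime m q) phi (d * m)%N.
Proof.
move=> q0 p0 pK.
rewrite (@sum_over_factorizations _ K phi (fun n => 0 < n)%N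
  (fun d m => [&& \pi(q).-nat d, (0 < m)%N & coprime m q])) //.
- rewrite [RHS]big_mkcond; apply: eq_bigr => d _.
  by case: ifP => h //=; rewrite big_pred0_eq.
- move=> n _ n0; exists (n`_\pi(q))%N, (n`_(\pi(q)^'))%N; rewrite partnC //.
  by rewrite part_pnat part_gt0 coprime_pi_nat ?part_gt0 ?part_pnat.
- move=> a b a' b' /and3P[h1 h2 h3] /and3P[h1' h2' h3'] e.
  rewrite coprime_pi_nat // in h3; rewrite coprime_pi_nat // in h3'.
  have a0 : (0 < a)%N by case/andP: h1.
  have a'0 : (0 < a')%N by case/andP: h1'.
  have ea : a = a'.
    have := congr1 (partn^~ \pi(q)) e.
    rewrite !partnM // (part_pnat_id h1) (part_pnat_id h1') !part_p'nat //.
    by rewrite !muln1.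
  by split => //; apply/eqP; rewrite -(eqn_pmul2l a0) e ea.
- by move=> n; rewrite -eqn0Ngt => /orP[/pK//|/eqP ->].
Qed.
End CoprimePart.

(** * Sharp cutoffs replaced by fixed weights *)

Section PrefixSums.
Context {F : realType}.
Local Notation normc := (@Normc.normc F).

(* Cutoffs [n < N] are traded for [l + 1] averages of sums with fixed weights independent of [N]:
   recursively, the half of [0, 2 ^ l) that contains the cutoff is isolated by a sign change. *)
Lemma prefix_sum_weights (l : nat) : exists W : seq (F * (nat -> F)),
  [/\ all (fun x => 0 <= x.1) W, \sum_(x <- W) x.1 = l.+1%:R,
      (forall x n, x \in map snd W -> `|x n| <= 1) &
      forall (a : nat -> F[i]) (N : nat), (N <= 2 ^ l)%N ->
        normc (\sum_(0 <= n < N) a n) <=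
        \sum_(x <- W) x.1 * normc (\sum_(0 <= n < 2 ^ l) a n * (x.2 n)%:C%C)].
Proof.
elim: l => [|l [W [W0 W1 Wn Wa]]].
  exists [:: (1, fun=> 1)]; split; rewrite /= ?ler01 ?big_seq1 //.
    by move=> x n; rewrite inE => /eqP ->; rewrite normr1.
  move=> a N N1; rewrite big_seq1 /= mul1r expn0 big_nat1 mulr1.
  case: N N1 => [|[|//]] _; last by rewrite big_nat1.
  by rewrite big_geq // Normc.normc0 normc_ge0.
set L := (2 ^ l)%N in Wa *.
have L0 : (0 < L)%N by rewrite expn_gt0.
pose sg n : F := if (n < L)%N then 1 else -1.
have sg1 n : `|sg n| = 1 by rewrite /sg; case: ifP; rewrite ?normrN normr1.
(* The periodic and the sign-changed extensions give [A1 + A2] and [A1 - A2], from which either half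
   is recovered. The last two entries, of total mass 1, recover the whole lower half when the cutoff
   lies in the upper one. *)
pose W' := [seq (x.1 / 2, fun n => x.2 (n %% L)%N) | x <- W] ++
   ([seq (x.1 / 2, fun n => x.2 (n %% L)%N * sg n) | x <- W] ++
    [:: (1 / 2, fun=> 1); (1 / 2, sg)]).
exists W'; split.
- rewrite /W' !all_cat !all_map; apply/and3P; split; last by rewrite /= !divr_ge0.
    by apply: sub_all W0 => x /= x0; rewrite divr_ge0.
  by apply: sub_all W0 => x /= x0; rewrite divr_ge0.
- rewrite /W' !big_cat !big_map !big_cons big_nil /= -!mulr_suml W1 -[RHS]natr1; lra.
- move=> x n; rewrite /W' !map_cat !mem_cat => /orP[|/orP[]].
  + by move=> /mapP[_ /mapP[y yW ->] ->] /=; apply: Wn; apply: map_f.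
  + move=> /mapP[_ /mapP[y yW ->] ->] /=; rewrite normrM sg1 mulr1.
    by apply: Wn; apply: map_f.
  + by rewrite /= !inE => /orP[] /eqP ->; rewrite ?normr1 ?sg1.
- move=> a N NL.
  have NL2 : (N <= L + L)%N by rewrite addnn -mul2n -expnS.
  have EL : (2 ^ l.+1 = L + L)%N by rewrite expnS mul2n addnn.
  have split2 (c : nat -> F[i]) : \sum_(0 <= n < 2 ^ l.+1) c n =
      \sum_(0 <= n < L) c n + \sum_(0 <= n < L) c (n + L)%N.
    rewrite EL (big_cat_nat _ (n := L)) ?leq_addr //=; congr (_ + _).
    by rewrite -{1}[L]add0n big_addn addnK.
  pose A1 (f : nat -> F) : F[i] := \sum_(0 <= n < L) a n * (f n)%:C%C.
  pose A2 (f : nat -> F) : F[i] := \sum_(0 <= n < L) a (n + L)%N * (f n)%:C%C.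
  have tp f : \sum_(0 <= n < 2 ^ l.+1) a n * (f (n %% L)%N)%:C%C = A1 f + A2 f.
    rewrite split2; congr (_ + _); apply: eq_big_nat => n /andP[_ nL].
      by rewrite modn_small.
    by rewrite modnDr modn_small.
  have tm f : \sum_(0 <= n < 2 ^ l.+1) a n * (f (n %% L)%N * sg n)%:C%C = A1 f - A2 f.
    rewrite split2 -sumrN; congr (_ + _); apply: eq_big_nat => n /andP[_ nL].
      by rewrite modn_small // /sg nL mulr1.
    by rewrite modnDr modn_small // /sg ltnNge leq_addl /= mulrN1 rmorphN mulrN.
  have b1 f : normc (A1 f) <= normc (A1 f + A2 f) / 2 + normc (A1 f - A2 f) / 2.
    have h := le_normcD (A1 f + A2 f) (A1 f - A2 f).
    have e : A1 f + A2 f + (A1 f - A2 f) = A1 f *+ 2 by rewrite mulr2n; ring.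
    by move: h; rewrite e normcMn -mulr_natr; lra.
  have b2 f : normc (A2 f) <= normc (A1 f + A2 f) / 2 + normc (A1 f - A2 f) / 2.
    have h := le_normcD (A1 f + A2 f) (- (A1 f - A2 f)).
    have e : A1 f + A2 f + - (A1 f - A2 f) = A2 f *+ 2 by rewrite mulr2n; ring.
    by move: h; rewrite e normcN normcMn -mulr_natr; lra.
  rewrite /W' !big_cat !big_map !big_cons big_nil /= addr0.
  under [X in _ <= X + _]eq_bigr do rewrite tp.
  under [X in _ <= _ + (X + _)]eq_bigr do rewrite tm.
  have -> : \sum_(0 <= n < 2 ^ l.+1) a n * 1%:C%C = A1 (fun=> 1) + A2 (fun=> 1).
    by rewrite -(tp (fun=> 1)).
  have -> : \sum_(0 <= n < 2 ^ l.+1) a n * (sg n)%:C%C = A1 (fun=> 1) - A2 (fun=> 1).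
    by rewrite -(tm (fun=> 1)); apply: eq_bigr => n _; rewrite mul1r.
  rewrite addrA -big_split /=.
  set T := 1 / 2 * _ + _.
  have T1 : normc (A1 (fun=> 1)) <= T by rewrite /T; have := b1 (fun=> 1); lra.
  have comb f : (f = A1 \/ f = A2) ->
     \sum_(x <- W) x.1 * normc (f x.2) <=
     \sum_(x <- W) (x.1 / 2 * normc (A1 x.2 + A2 x.2) + x.1 / 2 * normc (A1 x.2 - A2 x.2)).
    move=> hf; rewrite big_seq [leRHS]big_seq; apply: ler_sum => x xW.
    have x0 := allP W0 _ xW.
    have : normc (f x.2) <= normc (A1 x.2 + A2 x.2) / 2 + normc (A1 x.2 - A2 x.2) / 2.
      by case: hf => ->.
    by move=> /(ler_wpM2l x0); lra.
  have [NleL|LN] := leqP N L.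
    apply: le_trans (Wa a N NleL) _; rewrite -[leLHS]addr0; apply: lerD.
      exact: (comb A1 (or_introl erefl)).
    by apply: le_trans T1; exact: normc_ge0.
  rewrite (big_cat_nat _ (n := L)) ?(ltnW LN) //= addrC.
  apply: le_trans (le_normcD _ _) _; apply: lerD.
    have -> : \sum_(L <= n < N) a n = \sum_(0 <= n < N - L) a (n + L)%N.
      by rewrite -{1}[L]add0n big_addn.
    have NL' : (N - L <= L)%N by rewrite leq_subLR.
    apply: le_trans (Wa (fun n => a (n + L)%N) _ NL') _.
    exact: (comb A2 (or_intror erefl)).
  apply: le_trans T1; rewrite le_eqVlt; apply/orP; left; apply/eqP.
  by congr normc; apply: eq_bigr => n _; exact: esym (mulr1 _).
Qed.

End PrefixSums.

(** * The number of k-th roots modulo [q] *)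

Section RootsModulo.

(** [r ^ k - s ^ k] is [r - s] times a factor [T] congruent to [k * r ^ k.-1] modulo
    [p ^ (logn p k).+1]. Hence [T] contains [p] at most [logn p k] times, also for [p = 2]. *)
Lemma dvdn_sub_of_dvdn_sub_pow p e k r s : prime p -> (0 < k)%N -> ~~ (p %| r)%N -> (s <= r)%N ->
  (p ^ (logn p k).+1 %| r - s)%N -> (p ^ e %| r ^ k - s ^ k)%N ->
  (p ^ (e - logn p k) %| r - s)%N.
Proof.
move=> pp k0 pr sr d1 d2; set a := logn p k in d1 *.
have [rs|rs] := posnP (r - s)%N; first by rewrite rs dvdn0.
rewrite subn_exp in d2; set T := (\sum_(i < k) _)%N in d2.
have Tk : (T = k * r ^ k.-1 %[mod p ^ a.+1])%N.
  have -> : (k * r ^ k.-1 = \sum_(i < k) r ^ k.-1)%N by rewrite sum_nat_const card_ord.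
  rewrite /T; elim/big_ind2: _ => // [x1 x2 y1 y2 h1 h2|i _].
    by rewrite -modnDm h1 h2 modnDm.
  have sm : (s = r %[mod p ^ a.+1])%N by apply/eqP; rewrite eq_sym eqn_mod_dvd.
  rewrite -modnMm -(modnXm _ _ s) sm modnXm modnMm -expnD; congr (_ ^ _ %% _)%N.
  by rewrite subnK // -ltnS prednK.
have r0 : (0 < r)%N by apply: leq_trans rs _; exact: leq_subr.
have kr : logn p (k * r ^ k.-1) = a.
  by rewrite lognM ?expn_gt0 ?r0 // lognX (@logn_coprime p r) ?prime_coprime // muln0 addn0.
have nT : ~~ (p ^ a.+1 %| T)%N.
  rewrite /dvdn Tk -/(dvdn _ _) pfactor_dvdn ?muln_gt0 ?k0 ?expn_gt0 ?r0 // kr.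
  by rewrite ltnn.
have T0 : (0 < T)%N by rewrite lt0n; apply: contra nT => /eqP ->; rewrite dvdn0.
rewrite pfactor_dvdn // in d2; last by rewrite muln_gt0 rs.
rewrite lognM // in d2; rewrite pfactor_dvdn // -ltnNge ltnS in nT.
rewrite pfactor_dvdn // leq_subLR; apply: leq_trans d2 _.
by rewrite addnC leq_add2r.
Qed.

Lemma roots_mod_prime_le p k c : prime p -> (0 < k)%N ->
  (size [seq r <- iota 0 p | r ^ k == c %[mod p]] <= k)%N.
Proof.
move=> pp k0; set s := [seq _ <- _ | _].
pose q : {poly 'F_p} := 'X^k - (c%:R)%:P.
have szq : size q = k.+1 by rewrite size_XnsubC.
have q0 : q != 0 by rewrite -size_poly_eq0 szq.
have := @max_poly_roots _ q [seq (r%:R : 'F_p) | r <- s] q0.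
rewrite szq size_map ltnS; apply.
  apply/allP => _ /mapP[r rs ->]; move: rs; rewrite mem_filter => /andP[/eqP h _].
  rewrite /root /q !hornerE -natrX subr_eq0; apply/eqP/val_inj.
  by rewrite /= !val_Fp_nat.
rewrite map_inj_in_uniq ?filter_uniq ?iota_uniq // => r r'.
rewrite !mem_filter !mem_iota /= add0n => /andP[_ rp] /andP[_ rp'] /(congr1 val).
by rewrite /= !val_Fp_nat // !modn_small.
Qed.

Lemma size_le_of_inj (T1 T2 : eqType) (s : seq T1) (s' : seq T2) (f : T1 -> T2) : uniq s ->
  {in s &, injective f} -> (forall x, x \in s -> f x \in s') -> (size s <= size s')%N.
Proof.
move=> us fi fs; rewrite -(size_map f); apply: uniq_leq_size; first by rewrite map_inj_in_uniq.
by move=> _ /mapP[x xs ->]; exact: fs.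
Qed.

(** With [a = logn p k], a root is determined by its residue modulo [p ^ a.+1] and its quotient by
    [p ^ (e - a)]. If [p] divides [k], there are at most [k * k] residues, as [p ^ a.+1 <= k * k],
    and at most [p ^ a <= k] quotients. Otherwise [a = 0], and the roots inject into those modulo
    [p]. *)
Lemma roots_mod_pfactor_le p e k c : prime p -> (0 < k)%N -> (0 < e)%N -> ~~ (p %| c)%N ->
  (size [seq r <- iota 0 (p ^ e) | r ^ k == c %[mod p ^ e]] <= k ^ 3)%N.
Proof.
move=> pp k0 e0 pc; set s := [seq _ <- _ | _]; set a := logn p k.
have us : uniq s by rewrite filter_uniq ?iota_uniq.
have pe : (p %| p ^ e)%N by rewrite dvdn_exp.
have sP r : r \in s -> [/\ (r < p ^ e)%N, ~~ (p %| r)%N & r ^ k = c %[mod p ^ e]].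
  rewrite mem_filter mem_iota /= add0n => /andP[/eqP h ->]; split => //.
  apply: contra pc => pr; rewrite /dvdn -(modn_dvdm c pe) -h modn_dvdm //.
  by apply: dvdn_exp.
have inj (r r' : nat) : r \in s -> r' \in s ->
    (r %% p ^ a.+1 = r' %% p ^ a.+1)%N -> (r %/ p ^ (e - a) = r' %/ p ^ (e - a))%N -> r = r'.
  wlog rr' : r r' / (r' <= r)%N.
    by case: (leqP r' r) => [|/ltnW] h h' *; [exact: h'|apply/esym; exact: h'].
  move=> /sP[r1 r2 r3] /sP[r1' r2' r3'] /eqP h1 h2.
  have : (p ^ (e - a) %| r - r')%N.
    apply: dvdn_sub_of_dvdn_sub_pow => //; first by rewrite -eqn_mod_dvd.
    by rewrite -eqn_mod_dvd ?r3 ?r3' // leq_exp2r.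
  rewrite -eqn_mod_dvd // => /eqP h3.
  by rewrite (divn_eq r (p ^ (e - a))) h2 h3 -divn_eq.
have pa : (p ^ a <= k)%N by rewrite dvdn_leq // pfactor_dvdnn.
have [pk|pk] := boolP (p %| k)%N.
  have -> : (k ^ 3 = size [seq (x, y) | x <- iota 0 (k * k), y <- iota 0 k])%N.
    by rewrite size_allpairs !size_iota !expnS expn0 muln1 mulnA.
  apply: (size_le_of_inj (f := fun r => (r %% p ^ a.+1, r %/ p ^ (e - a))%N)) => //.
    by move=> r r' rs rs' [h1 h2]; exact: inj.
  move=> r /sP[r1 _ _]; apply/allpairsP; exists (r %% p ^ a.+1, r %/ p ^ (e - a))%N.
  rewrite !mem_iota /= !add0n; split => //.
    apply: (@leq_trans (p ^ a.+1)); first by rewrite ltn_pmod ?expn_gt0 ?prime_gt0.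
    by rewrite expnS leq_mul // dvdn_leq.
  rewrite ltn_divLR ?expn_gt0 ?prime_gt0 //; apply: leq_trans r1 _.
  apply: (@leq_trans (p ^ a * p ^ (e - a))); last by rewrite leq_mul.
  by rewrite -expnD leq_pexp2l ?prime_gt0 // -leq_subLR.
have a0 : a = 0%N by rewrite /a logn_coprime // prime_coprime.
apply: (@leq_trans k); last by rewrite -[leqLHS]expn1 leq_pexp2l.
apply: leq_trans (roots_mod_prime_le c pp k0).
apply: (size_le_of_inj (f := fun r => r %% p)%N) => //.
  move=> r r' rs rs' h; apply: inj => //; rewrite a0 ?expn1 ?subn0 //.
  by have [h1 _ _] := sP _ rs; have [h2 _ _] := sP _ rs'; rewrite !divn_small.
move=> r /sP[_ _ h]; rewrite mem_filter mem_iota /= add0n ltn_pmod ?prime_gt0 // andbT.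
by rewrite modnXm -(modn_dvdm (r ^ k) pe) h modn_dvdm.
Qed.

(** The induction step shared by the following arguments on [q]: one prime is stripped with its full
    power. *)
Lemma primes_part q p : p \in primes q ->
  [/\ q = (q`_p * q`_(p^'))%N, (0 < q`_p^')%N, q`_p^' < q, coprime q`_p q`_p^' &
      size (primes q) = (size (primes q`_p^')).+1]%N.
Proof.
rewrite mem_primes => /and3P[pp q0 pq].
have e : (q`_p * q`_(p^') = q)%N by rewrite partnC.
have l0 : (0 < logn p q)%N by rewrite logn_gt0 mem_primes pp q0.
split; rewrite ?part_gt0 //.
- rewrite -[in X in (_ < X)%N]e ltn_Pmull ?part_gt0 //.
  by rewrite p_part -{1}(expn0 p) ltn_exp2l ?prime_gt1.
- exact: coprime_partC.
- have : perm_eq (primes q) (p :: primes (q`_p^')%N).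
    apply: uniq_perm; rewrite ?primes_uniq //= ?primes_uniq ?andbT.
      rewrite mem_primes negb_and; apply/orP; right; rewrite negb_and; apply/orP; right.
      rewrite -prime_coprime // -(@coprime_pexpl (logn p q)) ?logn_gt0 ?mem_primes ?pp ?q0 //.
      by rewrite -p_part coprime_partC.
    move=> r; rewrite inE -[in LHS]e primesM ?part_gt0 // p_part primesX // (primes_prime pp) inE; reflexivity.
  by move=> /perm_size.
Qed.

Lemma roots_mod_le k c q : (0 < k)%N -> (0 < q)%N -> coprime c q ->
  (size [seq r <- iota 0 q | r ^ k == c %[mod q]] <= (k ^ 3) ^ size (primes q))%N.
Proof.
move=> k0; elim/ltn_ind: q => q IH q0 cq.
have [q1|q1] := leqP q 1.
  have -> : q = 1%N by apply/eqP; rewrite eqn_leq q1.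
  by rewrite /= expn0; case: ifP.
set p := pdiv q; have pq : p \in primes q.
  by rewrite mem_primes pdiv_prime // q0 pdiv_dvd.
have pp : prime p by exact: pdiv_prime.
have [e m0 mq co ->] := primes_part pq.
set m := (q`_p^')%N in e m0 mq co *; set P := (q`_p)%N in e co *.
rewrite expnS.
have eP : P = (p ^ logn p q)%N by rewrite /P p_part.
have l0 : (0 < logn p q)%N by rewrite logn_gt0.
have cm : coprime c m by apply: coprime_dvdr cq; rewrite e dvdn_mull.
have h1 := IH m mq m0 cm.
have pc : ~~ (p %| c)%N.
  rewrite -prime_coprime // coprime_sym; apply: coprime_dvdr cq; exact: pdiv_dvd.
have h2 := roots_mod_pfactor_le pp k0 l0 pc; rewrite -eP in h2.
apply: leq_trans (leq_mul h2 h1); rewrite -(size_allpairs pair).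
have P0 : (0 < P)%N by rewrite eP expn_gt0 prime_gt0.
apply: (size_le_of_inj (f := fun r => (r %% P, r %% m)%N)).
- by rewrite filter_uniq ?iota_uniq.
- move=> r r'; rewrite !mem_filter !mem_iota /= !add0n => /andP[_ rq] /andP[_ rq'] [h3 h4].
  have /eqP : r == r' %[mod P * m] by rewrite chinese_remainder // h3 h4 !eqxx.
  by rewrite -e !modn_small.
- move=> r; rewrite mem_filter => /andP[/eqP h _].
  apply: (allpairs_f pair); rewrite mem_filter mem_iota /= add0n ltn_pmod // andbT modnXm.
    have d : (P %| q)%N by rewrite e dvdn_mulr.
    by rewrite -(modn_dvdm (r ^ k) d) h modn_dvdm.
  have d : (m %| q)%N by rewrite e dvdn_mull.
  by rewrite -(modn_dvdm (r ^ k) d) h modn_dvdm.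
Qed.

End RootsModulo.

(** * Bounds in terms of the number of primes of [q] *)

Section OmegaBounds.
Context {F : realType}.

(** All primes of [q] lie between 1 and the largest one, which is therefore at least their number;
    stripping it gives the induction. *)
Lemma fact_size_primes_le q : (0 < q)%N -> ((size (primes q))`! <= q)%N.
Proof.
elim/ltn_ind: q => q IH q0.
have [q1|q1] := leqP q 1.
  by have -> : q = 1%N by apply/eqP; rewrite eqn_leq q1.
set p := max_pdiv q; have pq : p \in primes q.
  by rewrite mem_primes max_pdiv_prime // q0 max_pdiv_dvd.
have [e m0 mq _ sz] := primes_part pq.
rewrite sz factS [in X in (_ <= X)%N]e leq_mul ?IH //.
rewrite -sz; apply: (@leq_trans p).
  have -> : p = size (iota 1 p) by rewrite size_iota.
  apply: uniq_leq_size; first exact: primes_uniq.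
  move=> r rq; rewrite mem_iota add1n ltnS.
  have [rp _ rd] : [/\ prime r, (0 < q)%N & (r %| q)%N].
    by apply/and3P; rewrite -mem_primes.
  by rewrite prime_gt0 //= max_pdiv_max //; rewrite mem_primes rp q0 rd.
have pp : prime p by move: pq; rewrite mem_primes => /andP[].
rewrite p_part; apply: (@leq_trans (p ^ 1)%N); first by rewrite expn1.
by rewrite leq_pexp2l ?logn_gt0 ?prime_gt0.
Qed.

Lemma expn_le_fact N n : (N ^ n <= N ^ N * n`!)%N.
Proof.
have [N0|N0] := posnP N; first by rewrite N0 mul1n; case: n => // n; rewrite exp0n.
elim: n => [|n IH]; first by rewrite expn0 muln_gt0 expn_gt0 N0.
have [h|h] := leqP n.+1 N.
  apply: (@leq_trans (N ^ N)%N); first by rewrite leq_pexp2l.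
  by rewrite leq_pmulr ?fact_gt0.
by rewrite factS mulnCA expnS leq_mul // ltnW.
Qed.

(** With [B = K ^ (1 / eps)] the left side is [(B ^ n) ^ eps], and
    [B ^ n <= N ^ N * n! <= N ^ N * q]. *)
Lemma exp_size_primes_le (K : nat) (eps : F) : 0 < eps ->
  exists2 C : F, 0 < C &
  forall q, (0 < q)%N -> K%:R ^+ size (primes q) <= C * q%:R `^ eps.
Proof.
move=> e0; pose B := K%:R `^ (eps^-1) : F.
pose N := (Num.truncn B).+1.
exists ((N ^ N)%:R `^ eps); first by rewrite powR_gt0 // ltr0n expn_gt0.
move=> q q0; set n := size _.
have BN : B <= N%:R by rewrite ltW // truncnS_gt.
have -> : K%:R ^+ n = (B ^+ n) `^ eps.
  rewrite /B -!powR_mulrn ?powR_ge0 ?ler0n // -!powRrM.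
  by congr (_ `^ _); field; rewrite gt_eqF.
rewrite -powRM ?ler0n // ge0_ler_powR ?nnegrE ?(ltW e0) ?exprn_ge0 ?powR_ge0 ?mulr_ge0 //.
apply: (@le_trans _ _ (N%:R ^+ n)); first by rewrite lerXn2r ?nnegrE ?powR_ge0.
rewrite -natrX -natrM ler_nat; apply: leq_trans (expn_le_fact _ _) _.
by rewrite leq_mul // fact_size_primes_le.
Qed.

Lemma geometric_le (x : F) n : 0 <= x < 1 -> \sum_(0 <= i < n) x ^+ i <= (1 - x)^-1.
Proof.
move=> /andP[x0 x1]; rewrite -[leRHS]mul1r ler_pdivlMr ?subr_gt0 //.
have := subrX1 x n; rewrite -(big_mkord xpredT (fun i => x ^+ i)) => h.
have -> : (\sum_(0 <= i < n) x ^+ i) * (1 - x) = 1 - x ^+ n.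
  by rewrite -[1 - x]opprB mulrN mulrC -h opprB.
by rewrite gerBl exprn_ge0.
Qed.

(** A truncated Euler product over the primes of [q], each factor being a geometric series bounded
    by the one for the prime 2. *)
Lemma sum_pi_nat_powR_le (eps : F) : 0 < eps -> exists2 B : nat, (0 < B)%N &
  forall q Z, (0 < q)%N ->
  \sum_(0 <= d < Z | \pi(q).-nat d) d%:R `^ (- eps) <= B%:R ^+ size (primes q).
Proof.
move=> e0; pose x := 2 `^ (- eps) : F.
have x0 : 0 < x by rewrite powR_gt0.
have two1 (r : F) : 0 < r -> 1 < 2 `^ r.
  move=> r0; have h : 1 `^ r < 2 `^ r by apply: gt0_ltr_powR; rewrite ?nnegrE ?ltr1n.
  by rewrite powR1 in h.
have x1 : x < 1 by rewrite /x powRN invf_lt1 ?powR_gt0 ?two1.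
pose B := (Num.truncn (1 - x)^-1).+1.
have B1 : (1 - x)^-1 <= B%:R by rewrite ltW // truncnS_gt.
exists B => // q Z.
elim/ltn_ind: q => q IH q0.
have [q1|q1] := leqP q 1.
  have -> : q = 1%N by apply/eqP; rewrite eqn_leq q1.
  rewrite /= expr0; apply: (@le_trans _ _ (\sum_(0 <= d < Z | d == 1%N) 1)).
    rewrite big_mkcond [leRHS]big_mkcond; apply: ler_sum => d _.
    have [->|d1] := eqVneq d 1%N.
      by rewrite powR1; case: (pnat _ _); rewrite ?lexx ?ler01.
    case h: (pnat _ d); last by rewrite lexx.
    move/eqP: d1; case; apply: (pnat_1 h).
    by rewrite -coprime_pi' ?coprime1n //; case/andP: h.
  by rewrite big_nat1_eq; case: ifP.
set p := pdiv q; have pq : p \in primes q.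
  by rewrite mem_primes pdiv_prime // q0 pdiv_dvd.
have pp : prime p by exact: pdiv_prime.
have [e m0 mq co ->] := primes_part pq.
set m := (q`_p^')%N in e m0 mq co *.
pose f n : F := n%:R `^ (- eps).
have f0 n : 0 <= f n by exact: powR_ge0.
have l0 : (0 < logn p q)%N by rewrite logn_gt0.
(* Only the pair of the exponent of [p] in [d] and the part of [d] prime to [p] is needed; the
   remaining terms are nonnegative and allow the sums to be exchanged freely. *)
have dec d : (d < Z)%N -> \pi(q).-nat d -> f d <= \sum_(0 <= i < Z) \sum_(0 <= b < Z | \pi(m).-nat b)
    (if (p ^ i * b == d)%N then f (p ^ i)%N * f b else 0).
  move=> dZ dq; have d0 : (0 < d)%N by case/andP: dq.
  have ed : (p ^ logn p d * d`_(p^') = d)%N by rewrite -p_part partnC.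
  have iZ : (logn p d < Z)%N.
    by apply: leq_trans dZ; rewrite ltnW // ltnS; apply: ltn_logl.
  have bZ : (d`_(p^') < Z)%N.
    by apply: leq_ltn_trans dZ; rewrite dvdn_leq ?dvdn_part.
  have bm : \pi(m).-nat (d`_(p^'))%N.
    apply/pnatP => [|r rp rd]; first by rewrite part_gt0.
    have rd' : (r %| d)%N by apply: dvdn_trans rd _; exact: dvdn_part.
    have rq : (r %| q)%N.
      have /pnatP/(_ r rp rd') := dq; rewrite d0 => /(_ isT).
      by rewrite mem_primes => /and3P[].
    have rp' : r != p.
      have /pnatP/(_ r rp rd) := part_pnat (p^')%N d; rewrite part_gt0 => /(_ isT).
      by rewrite inE.
    rewrite inE /= mem_primes rp m0 /=; move: rq; rewrite [in X in (_ %| X)%N]e.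
    rewrite Euclid_dvdM // => /orP[|//]; rewrite p_part Euclid_dvdX // => /andP[].
    by rewrite dvdn_prime2 // (negbTE rp').
  rewrite (bigD1_seq (logn p d)) ?mem_index_iota ?iota_uniq //=.
  rewrite [X in _ <= X + _]big_mkcond /=.
  rewrite (bigD1_seq (d`_(p^'))%N) ?mem_index_iota ?iota_uniq //= bm /= ed eqxx.
  rewrite -addrA ler_wpDr //.
    apply: addr_ge0.
      apply: sumr_ge0 => b _; case: (pnat _ b) => //.
      by case: ifP => // _; rewrite mulr_ge0.
    apply: sumr_ge0 => a _; apply: sumr_ge0 => b _; case: ifP => // _; by rewrite mulr_ge0.
  by rewrite -powRM ?ler0n // -natrM ed.
apply: (@le_trans _ _ (\sum_(0 <= d < Z) \sum_(0 <= i < Z) \sum_(0 <= b < Z | \pi(m).-nat b)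
    (if (p ^ i * b == d)%N then f (p ^ i)%N * f b else 0))).
  rewrite big_mkcond big_nat [leRHS]big_nat; apply: ler_sum => d /andP[_ dZ].
  case: ifP => h; first exact: dec.
  by apply: sumr_ge0 => a _; apply: sumr_ge0 => b _; case: ifP => // _; rewrite mulr_ge0.
rewrite exchange_big /=; under eq_bigr do rewrite exchange_big /=.
apply: (@le_trans _ _ (\sum_(0 <= i < Z) \sum_(0 <= b < Z | \pi(m).-nat b) f (p ^ i)%N * f b)).
  apply: ler_sum => i _; apply: ler_sum => b _.
  rewrite -big_mkcond /=; under eq_bigl do rewrite eq_sym.
  by rewrite big_nat1_eq; case: ifP => // _; rewrite mulr_ge0.
under eq_bigr do rewrite -mulr_sumr.
rewrite -mulr_suml exprS ler_pM ?sumr_ge0 //; last exact: IH.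
apply: le_trans B1; apply: le_trans (geometric_le Z _); last by rewrite ltW.
apply: ler_sum => i _; rewrite /f natrX -powR_mulrn ?ler0n // -powRrM mulrC powRrM powR_mulrn ?powR_ge0 //.
rewrite lerXn2r ?nnegrE ?powR_ge0 // /x !powRN lef_pV2 ?posrE ?powR_gt0 ?ltr0n ?prime_gt0 //.
by rewrite ge0_ler_powR ?nnegrE ?(ltW e0) ?ler0n // ler_nat prime_gt1.
Qed.

(** Rankin's trick: each term is at most [(Z / d) ^ eps]. *)
Lemma count_pi_nat_le (eps : F) : 0 < eps -> exists2 C : F, 0 < C &
  forall q Z, (0 < q)%N ->
  \sum_(0 <= d < Z | \pi(q).-nat d) 1 <= C * q%:R `^ eps * Z%:R `^ eps.
Proof.
move=> e0; have [B B0 hB] := sum_pi_nat_powR_le e0.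
have [C C0 hC] := exp_size_primes_le B e0.
exists C => // q Z q0.
apply: (@le_trans _ _ (\sum_(0 <= d < Z | \pi(q).-nat d) d%:R `^ (- eps) * Z%:R `^ eps)).
  rewrite big_nat_cond [leRHS]big_nat_cond; apply: ler_sum => d /andP[/andP[_ dZ] /andP[d0 _]].
  rewrite powRN mulrC ler_pdivlMr ?powR_gt0 ?ltr0n // mul1r.
  by rewrite ge0_ler_powR ?nnegrE ?(ltW e0) ?ler0n // ler_nat ltnW.
by rewrite -mulr_suml ler_wpM2r ?powR_ge0 // (le_trans (hB _ _ q0)) // hC.
Qed.

End OmegaBounds.

(** * Rational approximation and counting in residue classes *)

Section Approximation.
Context {F : realType}.

Lemma floor_bounds (x : F) : 0 <= x - (Num.floor x)%:~R < 1.
Proof.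
by rewrite subr_ge0 floor_le /= ltrBlDl -[1]/(1%:~R) -intrD floorD1_gt.
Qed.

Lemma dirichlet_approx (alpha : F) (N : nat) : 0 <= alpha < 1 -> (0 < N)%N ->
  exists q a : nat, [/\ (0 < q <= N)%N, (a <= q)%N, coprime q a &
    `|q%:R * alpha - a%:R| <= N%:R^-1].
Proof.
move=> /andP[al0 al1] N0.
have NF0 : 0 < N%:R :> F by rewrite ltr0n.
pose fr (i : nat) : F := i%:R * alpha - (Num.floor (i%:R * alpha))%:~R.
have fr01 i : 0 <= fr i < 1 by exact: floor_bounds.
have box i : (Num.truncn (N%:R * fr i) < N)%N.
  have /andP[f0 f1] := fr01 i.
  by rewrite truncn_lt_nat ?mulr_ge0 // -[ltRHS]mulr1 ltr_pM2l.
pose f (i : 'I_N.+1) : 'I_N := Ordinal (box i).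
have /injectivePn[i [j ij fij]] : ~~ injectiveb f.
  apply/injectiveP => /leq_card; by rewrite !card_ord ltnn.
have {ij fij} [i' [j' [ij jN close]]] : exists i j : nat, [/\ (i < j)%N, (j <= N)%N & `|fr j - fr i| <= N%:R^-1].
  have cl : `|fr j - fr i| <= N%:R^-1.
    have e : Num.truncn (N%:R * fr i) = Num.truncn (N%:R * fr j) by case: fij.
    have /andP[i0 i1] := fr01 i; have /andP[j0 j1] := fr01 j.
    have /andP[a1 a2] := truncn_itv (mulr_ge0 (ltW NF0) i0).
    have /andP[b1 b2] := truncn_itv (mulr_ge0 (ltW NF0) j0).
    rewrite e in a1 a2; rewrite -natr1 in a2 b2.
    rewrite -(ler_pM2l NF0) divff ?gt_eqF // -[X in X * _](gtr0_norm NF0) -normrM mulrBr ler_norml.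
    by apply/andP; split; lra.
  have [h|h|h] := ltngtP i j.
  - by exists i, j; split => //; rewrite -ltnS.
  - by exists j, i; split => //; [rewrite -ltnS|rewrite distrC].
  - by move/eqP: ij; case; apply: val_inj.
pose q0 := (j' - i')%N.
pose z : int := Num.floor (j'%:R * alpha) - Num.floor (i'%:R * alpha).
have q00 : (0 < q0)%N by rewrite subn_gt0.
have ez : `|q0%:R * alpha - z%:~R| <= N%:R^-1.
  have -> : q0%:R * alpha - z%:~R = fr j' - fr i'.
    by rewrite /fr /z /q0 natrB ?(ltnW ij) // intrB; ring.
  exact: close.
have z0 : 0 <= z.
  rewrite /z subr_ge0; apply: le_floor.
  by rewrite ler_wpM2r // ler_nat ltnW.
have Ninv : N%:R^-1 <= 1 :> F by rewrite invf_le1 // ler1n.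
have [a0 za] : exists a0 : nat, z = a0%:Z by case: z z0 {ez} => // a0; exists a0.
rewrite za -[a0%:~R]/(a0%:R) in ez.
have q0F : 0 < q0%:R :> F by rewrite ltr0n.
have aq : (a0 <= q0)%N.
  rewrite -ltnS -(ltr_nat F) -natr1.
  have h1 : q0%:R * alpha < q0%:R by rewrite -[ltRHS]mulr1 ltr_pM2l.
  by move: ez; rewrite ler_norml => /andP[]; lra.
pose g := gcdn q0 a0.
have g0 : (0 < g)%N by rewrite gcdn_gt0 q00.
have gF : 0 < g%:R :> F by rewrite ltr0n.
have eq0 : (q0 = q0 %/ g * g)%N by rewrite divnK // dvdn_gcdl.
have ea0 : (a0 = a0 %/ g * g)%N by rewrite divnK // dvdn_gcdr.
exists (q0 %/ g)%N, (a0 %/ g)%N; split.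
- rewrite divn_gt0 // dvdn_leq ?dvdn_gcdl //=.
  by rewrite (leq_trans (leq_div _ _)) // (leq_trans (leq_subr _ _)).
- exact: leq_div2r.
- by rewrite /coprime -(eqn_pmul2r g0) muln_gcdl -eq0 -ea0 mul1n.
- apply: le_trans ez; rewrite [in leRHS]eq0 [in leRHS]ea0 !natrM.
  rewrite mulrAC -mulrBl normrM (gtr0_norm gF) ler_peMr //.
  by rewrite ler1n.
Qed.

(** [a h - z q] is an integer of absolute value below 1, hence 0. So closeness of [alpha h] to an
    integer splits into a congruence modulo [q] and a bound for [beta h]. *)
Lemma near_integer (alpha beta e : F) (q a : nat) (h z : int) :
  (0 < q)%N -> coprime q a -> alpha = a%:R / q%:R + beta ->
  `|alpha * h%:~R - z%:~R| <= e -> `|beta * h%:~R| + e < q%:R^-1 ->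
  (q %| `|h|)%N /\ `|beta * h%:~R| <= e.
Proof.
move=> q0 cqa -> h1 h2.
have qF : 0 < q%:R :> F by rewrite ltr0n.
have e1 : (a%:Z * h)%R = (z * q%:Z)%R.
  apply/eqP; rewrite -subr_eq0 -normr_eq0.
  suff : `|(a%:Z * h - z * q%:Z)%:~R : F| < 1.
    by rewrite -intr_norm -[1]/(1%:~R) ltr_int; lia.
  have -> : (a%:Z * h - z * q%:Z)%:~R =
      q%:R * (((a%:R / q%:R + beta) * h%:~R - z%:~R) - beta * h%:~R) :> F.
    by rewrite intrB !intrM -!pmulrn; field; rewrite gt_eqF.
  rewrite normrM (gtr0_norm qF) mulrC -ltr_pdivlMr // mul1r.
  by apply: le_lt_trans (ler_normB _ _) _; lra.
split.
  have : (q %| absz (a%:Z * h)%R)%N by rewrite e1 abszM dvdn_mull.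
  by rewrite abszM Gauss_dvdr.
have -> : beta * h%:~R = (a%:R / q%:R + beta) * h%:~R - z%:~R; last exact: h1.
have : a%:R * h%:~R = z%:~R * q%:R :> F.
  by have /(congr1 (fun x : int => x%:~R : F)) := e1; rewrite !intrM -!pmulrn.
move=> e2; rewrite mulrDl mulrAC e2 mulfK ?gt_eqF //; ring.
Qed.

(** An element is determined by its residue and its quotient by [m]; the quotients fill an interval
    with fewer than [2 D / m + 2] integers. *)
Lemma count_residues_le (s T : seq nat) (m u0 : nat) (D : F) :
  uniq s -> (0 < m)%N -> 0 <= D -> (forall u, u \in s -> (u %% m)%N \in T) ->
  (forall u, u \in s -> `|u%:R - u0%:R| <= D) ->
  (size s)%:R <= (size T)%:R * (2 * D / m%:R + 2).
Proof.
move=> us m0 D0 hT hD; pose t := Num.truncn D.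
have mF : 0 < m%:R :> F by rewrite ltr0n.
have tD : t%:R <= D by rewrite truncn_le.
pose lo := ((u0 - t) %/ m)%N; pose hi := ((u0 + t) %/ m)%N.
have bnd u : u \in s -> (lo <= u %/ m <= hi)%N.
  move=> /hD; rewrite ler_norml => /andP[h1 h2]; apply/andP; split; apply: leq_div2r.
    rewrite leq_subLR -ltnS -(ltr_nat F) -addnS natrD -natr1.
    have := truncnS_gt D; rewrite -/t -natr1; lra.
  rewrite -ltnS -(ltr_nat F) -addnS natrD.
  have := truncnS_gt D; rewrite -/t; lra.
have h : (size s <= size [seq (x, y) | x <- T, y <- iota lo (hi - lo).+1])%N.
  apply: (size_le_of_inj (f := fun u => (u %% m, u %/ m)%N)) => //.
    by move=> u u' _ _ [e1 e2]; rewrite (divn_eq u m) e1 e2 -divn_eq.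
  move=> u us'; apply: (allpairs_f pair); first exact: hT.
  by have /andP[a b] := bnd u us'; rewrite mem_iota a addnS ltnS subnKC // (leq_trans a).
rewrite size_allpairs size_iota in h.
apply: (@le_trans _ _ (size T * (hi - lo).+1)%:R); first by rewrite ler_nat.
rewrite natrM ler_wpM2l //.
have r0 : 0 <= 2 * D / m%:R by rewrite divr_ge0 ?mulr_ge0 // ltW.
have [hl|lh] := leqP hi lo.
  have -> : (hi - lo = 0)%N by apply/eqP; rewrite subn_eq0.
  by rewrite -[1%:R]/(1 : F); lra.
rewrite -natr1 natrB ?(ltnW lh) //.
have c1 : hi%:R * m%:R <= u0%:R + D.
  by rewrite -natrM (le_trans _ (lerD (lexx _) tD)) // -natrD ler_nat leq_divM.
have c2 : u0%:R - D < (lo%:R + 1) * m%:R.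
  rewrite natr1 -natrM; apply: (@le_lt_trans _ _ (u0 - t)%:R).
    rewrite lerBlDr; apply: (@le_trans _ _ ((u0 - t) + t)%:R).
      by rewrite ler_nat addnC -leq_subLR.
    by rewrite natrD lerD2l.
  by rewrite ltr_nat ltn_ceil.
have : (hi%:R - lo%:R - 1) * m%:R < 2 * D by lra.
by rewrite -ltr_pdivlMr //; lra.
Qed.

End Approximation.

(** * Dyadic blocks, and the case of small [q] and [beta] *)

Section Blocks.
Context {F : realType}.
Local Notation normc := (@Normc.normc F).

Definition rsmooth (R : F) (n : nat) := all (fun p : nat => p%:R <= R) (primes n).

Lemma smoothE (P R : F) n : smooth P R n = [&& (0 < n)%N, n%:R <= P & rsmooth R n].
Proof. by []. Qed.

Lemma rsmooth_le (R : F) n : 0 <= R -> rsmooth R n = all (leq^~ (Num.truncn R)) (primes n).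
Proof. by move=> R0; apply: eq_all => p /=; rewrite truncn_ge_nat. Qed.

Lemma rsmoothM (R : F) m n : (0 < m)%N -> (0 < n)%N ->
  rsmooth R (m * n) = rsmooth R m && rsmooth R n.
Proof.
move=> m0 n0; apply/allP/andP => [h|[/allP h1 /allP h2] p].
  by split; apply/allP => p pm; apply: h; rewrite primesM // pm ?orbT.
by rewrite primesM // => /orP[/h1|/h2].
Qed.

(** Zero off the block, so that sums may run over any range [0, K) with [K] beyond [N]. *)
Definition block (k q : nat) (R th N : F) (n : nat) : F[i] :=
  if [&& (0 < n)%N, N / 2 < n%:R, n%:R <= N, rsmooth R n & coprime n q]
  then expe (th * n%:R ^+ k) else 0.

Lemma weyl_sum_ord_wide k (V R : F) c th (K : nat) : (Num.truncn V < K)%N ->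
  \sum_(0 <= v < K) (if smooth V R v then c v * expe (th * v%:R ^+ k) else 0) =
  weyl_sum k V R c th.
Proof.
move=> VK; rewrite /weyl_sum [RHS]big_mkcond /=.
rewrite (big_cat_nat _ (n := (Num.truncn V).+1)) //= [X in _ + X]big_nat_cond [X in _ + X]big1.
  by rewrite addr0 big_ltn //= add0r.
move=> i /andP[/andP[h _] _]; case: ifP => // /and3P[i0 iV _].
have V0 : 0 <= V by apply: le_trans iV; exact: ler0n.
by move: h; rewrite truncn_lt_nat // ltNge iV.
Qed.

(** An interval is a difference of two initial segments, whence the factor 2 in the mass. The
    weights depend on [l] alone, so one family serves for all end points [lo] and [hi], which will
    vary with the outer variable. *)
Lemma interval_sum_le (l : nat) : exists W : seq (F * (nat -> F)),
  [/\ all (fun x => 0 <= x.1) W, \sum_(x <- W) x.1 = 2 * l.+1%:R,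
      (forall x n, x \in map snd W -> `|x n| <= 1) &
      forall k (V R : F) c th (lo hi : F) (K : nat), 0 <= lo -> V < (2 ^ l)%:R -> hi <= V -> (2 ^ l <= K)%N ->
        normc (\sum_(0 <= v < K | (lo < v%:R) && (v%:R <= hi))
           (if smooth V R v then c v * expe (th * v%:R ^+ k) else 0)) <=
        \sum_(x <- W) x.1 * normc (weyl_sum k V R (fun v => c v * (x.2 v)%:C%C) th)].
Proof.
have [W [W0 W1 Wn Wa]] := prefix_sum_weights (F := F) l.
exists [seq (2 * x.1, x.2) | x <- W]; split.
- by rewrite all_map; apply: sub_all W0 => x /= x0; rewrite mulr_ge0.
- by rewrite big_map /= -mulr_sumr W1.
- move=> x n; rewrite -map_comp => /mapP[y yW ->] /=; apply: Wn; exact: map_f.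
move=> k V R c th lo hi K lo0 VK hiV lK.
set b := fun v : nat => if smooth V R v then c v * expe (th * v%:R ^+ k) else 0.
rewrite big_map /=.
pose T := \sum_(x <- W) x.1 * normc (weyl_sum k V R (fun v => c v * (x.2 v)%:C%C) th).
have -> : \sum_(j <- W) 2 * j.1 * normc (weyl_sum k V R (fun v => c v * (j.2 v)%:C%C) th) = 2 * T.
  by rewrite /T mulr_sumr; apply: eq_bigr => x _; rewrite mulrA.
have T0 : 0 <= T.
  rewrite /T big_seq; apply: sumr_ge0 => x xW; rewrite mulr_ge0 ?normc_ge0 //.
  exact: (allP W0 _ xW).
have pre N : (N <= 2 ^ l)%N -> normc (\sum_(0 <= v < N) b v) <= T.
  move=> NL; apply: le_trans (Wa b N NL) _; rewrite le_eqVlt; apply/orP; left; apply/eqP.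
  apply: eq_bigr => x _; congr (_ * normc _).
  rewrite -(@weyl_sum_ord_wide k V R _ th (2 ^ l)%N).
    by apply: eq_bigr => v _; rewrite /b; case: ifP => _; rewrite ?mul0r // mulrAC.
  by rewrite -(prednK (_ : 0 < 2 ^ l)%N) ?expn_gt0 // ltnS truncn_le_nat prednK ?expn_gt0.
rewrite mulr_natl mulr2n.
have [hi0|hi0] := leP 0 hi; last first.
  rewrite big_pred0 ?Normc.normc0 ?addr_ge0 // => v; apply/negbTE/nandP; right.
  by rewrite -ltNge (lt_le_trans hi0).
have B2 : ((Num.truncn hi).+1 <= 2 ^ l)%N.
  by rewrite truncn_lt_nat // (le_lt_trans hiV).
rewrite (eq_bigl (fun v => (Num.truncn lo < v <= Num.truncn hi)%N)); last first.
  by move=> v; rewrite truncn_lt_nat // truncn_ge_nat.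
have [hl|lh] := ltnP (Num.truncn hi) (Num.truncn lo).
  rewrite big_pred0 ?Normc.normc0 ?addr_ge0 // => v; apply/negbTE; rewrite negb_and -leqNgt -ltnNge.
  by case: (leqP v (Num.truncn lo)) => // h; rewrite (ltn_trans hl h).
have -> : \sum_(0 <= v < K | (Num.truncn lo < v <= Num.truncn hi)%N) b v =
    \sum_(0 <= v < (Num.truncn hi).+1) b v - \sum_(0 <= v < (Num.truncn lo).+1) b v.
  rewrite [X in _ = X - _](big_cat_nat _ (n := (Num.truncn lo).+1)) //= addrAC subrr add0r.
  by rewrite [RHS](big_nat_widenl _ 0) // [RHS](big_nat_widen _ _ K) ?(leq_trans B2).
apply: le_trans (le_normcD _ _) _; rewrite normcN; apply: lerD; apply: pre => //.
by apply: leq_trans B2.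
Qed.

End Blocks.

Section MajorBlocks.
Context {F : realType}.
Local Notation normc := (@Normc.normc F).

Definition frac (x : F) : F := x - (Num.floor x)%:~R.

Lemma subr_powers_ge (U : F) (k : nat) (x y : F) : (0 < k)%N -> 0 <= U -> U <= x -> U <= y ->
  `|x - y| * U ^+ k.-1 <= `|x ^+ k - y ^+ k|.
Proof.
move=> k0 U0 Ux Uy; rewrite subrXX normrM ler_wpM2l //.
have x0 := le_trans U0 Ux; have y0 := le_trans U0 Uy.
case: k k0 => // k _; rewrite big_ord_recl /= subn0 expr0 mulr1.
rewrite ger0_norm; last first.
  by rewrite addr_ge0 ?exprn_ge0 // sumr_ge0 // => i _; rewrite mulr_ge0 ?exprn_ge0.
rewrite -[leLHS]addr0 lerD //; first by rewrite lerXn2r ?nnegrE.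
by rewrite sumr_ge0 // => i _; rewrite mulr_ge0 ?exprn_ge0.
Qed.

(** [near_integer] for [h = d ^ k (u ^ k - u0 ^ k)]. Cancelling [d ^ k] leaves the modulus [q'],
    smaller than [q] by a factor of at most [d ^ k]; this is where powers of [W] enter. *)
Lemma near_points (alpha beta e B : F) (k q a d u u0 : nat) :
  (0 < q)%N -> (0 < d)%N -> coprime q a -> alpha = a%:R / q%:R + beta ->
  u%:R <= B -> u0%:R <= B -> `|beta| * (d%:R ^+ k * B ^+ k) + e < q%:R^-1 ->
  `|frac (alpha * d%:R ^+ k * u%:R ^+ k) - frac (alpha * d%:R ^+ k * u0%:R ^+ k)| <= e ->
  let q' := (q %/ gcdn q (d ^ k))%N in
  [/\ (u ^ k = u0 ^ k %[mod q'])%N & `|beta| * (d%:R ^+ k * `|u%:R ^+ k - u0%:R ^+ k|) <= e].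
Proof.
move=> q0 d0 cqa al uB u0B hB close q'.
have B0 : 0 <= B by apply: le_trans uB.
pose h : int := (d ^ k)%:Z * ((u ^ k)%:Z - (u0 ^ k)%:Z).
pose z : int := Num.floor (alpha * d%:R ^+ k * u%:R ^+ k) - Num.floor (alpha * d%:R ^+ k * u0%:R ^+ k).
have hE : h%:~R = d%:R ^+ k * (u%:R ^+ k - u0%:R ^+ k) :> F.
  by rewrite /h intrM intrB -!pmulrn !natrX.
have h1 : `|alpha * h%:~R - z%:~R| <= e.
  apply: le_trans close; rewrite le_eqVlt; apply/orP; left; apply/eqP; congr `|_|.
  by rewrite hE /z /frac intrB; ring.
have nh : `|beta * h%:~R| = `|beta| * (d%:R ^+ k * `|u%:R ^+ k - u0%:R ^+ k|).
  by rewrite normrM hE normrM [`|d%:R ^+ k|]ger0_norm ?exprn_ge0.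
have h2 : `|beta * h%:~R| + e < q%:R^-1.
  apply: le_lt_trans hB; rewrite lerD2r nh ler_wpM2l // ler_wpM2l ?exprn_ge0 //.
  have pw (v : nat) : v%:R <= B -> (0 <= v%:R ^+ k :> F) /\ v%:R ^+ k <= B ^+ k.
    by move=> vB; split; [exact: exprn_ge0|rewrite lerXn2r ?nnegrE].
  have [a1 a2] := pw _ uB; have [a3 a4] := pw _ u0B.
  by rewrite ler_norml; apply/andP; split; lra.
have [dv le] := near_integer q0 cqa al h1 h2.
split; last by rewrite -nh.
set g := gcdn q (d ^ k) in q' *.
have g0 : (0 < g)%N by rewrite gcdn_gt0 q0.
have eq1 : (q = q' * g)%N by rewrite divnK // dvdn_gcdl.
have ed : (d ^ k = d ^ k %/ g * g)%N by rewrite divnK // dvdn_gcdr.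
have cop : coprime q' (d ^ k %/ g).
  by rewrite /coprime -(eqn_pmul2r g0) muln_gcdl -eq1 -ed mul1n.
have : (q' %| `|(u ^ k)%:Z - (u0 ^ k)%:Z|)%N.
  rewrite -(Gauss_dvdr _ cop) -(dvdn_pmul2r g0) -eq1.
  by rewrite mulnAC -ed; move: dv; rewrite /h abszM.
have [le1|le1] := leqP (u0 ^ k) (u ^ k).
  by rewrite subzn // absz_nat -eqn_mod_dvd // => /eqP.
rewrite distnC subzn ?(ltnW le1) // absz_nat -eqn_mod_dvd ?(ltnW le1) // => /eqP ->.
by [].
Qed.

(** The [u] counted lie in at most [kappa] classes modulo [q'] and in an interval of length
    [O(W ^ k.-1 * q')]. The interval comes from avoiding the major arcs: if [q > M R], the whole
    range of [u] is that short; if [beta] is large, the bound on [beta d ^ k (u ^ k - u0 ^ k)]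
    confines [u]. *)
Lemma major_multiplicity (alpha beta M P R W X U : F) (k q a d kappa : nat) (s : seq nat) :
  (1 < k)%N -> (0 < q)%N -> (0 < d)%N -> coprime q a -> alpha = a%:R / q%:R + beta ->
  0 < M -> 1 <= W -> d%:R <= W -> 1 <= R -> 1 <= X -> P = M * X -> U = M / W ->
  q%:R <= X ^+ k -> `|q%:R * beta| * (M * R) ^+ k <= 1 / 2 ->
  (M * R < q%:R \/ M * R < `|q%:R * beta| * P ^+ k) ->
  uniq s -> (forall u, u \in s -> [/\ coprime u q, U <= u%:R & u%:R <= U * R]) ->
  (forall c, coprime c (q %/ gcdn q (d ^ k)) ->
     (size [seq r <- iota 0 (q %/ gcdn q (d ^ k)) | r ^ k == c %[mod q %/ gcdn q (d ^ k)]] <= kappa)%N) ->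
  forall u0, u0 \in s ->
  (count (fun u => `|frac (alpha * d%:R ^+ k * u%:R ^+ k) - frac (alpha * d%:R ^+ k * u0%:R ^+ k)|
       <= 4 * (16 * X ^+ k)^-1) s)%:R <= kappa%:R * (4 * W ^+ k.-1).
Proof.
move=> k1 q0 d0 cqa al M0 W1 dW R1 X1 PE UE qX qb minor us hs hk u0 u0s.
have k0 : (0 < k)%N by exact: ltnW.
have qF : 0 < q%:R :> F by rewrite ltr0n.
have W0 : 0 < W by exact: lt_le_trans W1.
have X0 : 0 < X by exact: lt_le_trans X1.
have U0 : 0 < U by rewrite UE divr_gt0.
have Xk : 0 < X ^+ k by rewrite exprn_gt0.
(* The 16 makes [e] at most [1 / (4 q)]; together with the share [1 / (2 q)] of [beta] it stays
   strictly below [1 / q]. The 4 is the radius in [mean_value_at_points]. *)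
set e := 4 * (16 * X ^+ k)^-1.
have eE : e = (4 * X ^+ k)^-1 by rewrite /e; field; rewrite gt_eqF.
have e0 : 0 <= e by rewrite eE invr_ge0 mulr_ge0 // ltW.
have MR0 : 0 < M * R by rewrite mulr_gt0 // (lt_le_trans _ R1).
have UR : U * R = M * R / W by rewrite UE; ring.
have dk : d%:R ^+ k <= W ^+ k by rewrite lerXn2r ?nnegrE ?ler0n ?(ltW W0).
have WWk : W ^+ k = W * W ^+ k.-1 by rewrite -exprS prednK.
have Wk1 : 1 <= W ^+ k.-1 by rewrite exprn_ege1.
have hB : `|beta| * (d%:R ^+ k * (U * R) ^+ k) + e < q%:R^-1.
  have h1 : `|beta| * (d%:R ^+ k * (U * R) ^+ k) <= q%:R^-1 / 2.
    apply: (@le_trans _ _ (`|beta| * (M * R) ^+ k)).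
      rewrite ler_wpM2l // UR [(M * R / W) ^+ k]exprMn exprVn mulrC -mulrA.
      by rewrite ler_piMr ?exprn_ge0 ?(ltW MR0) // mulrC ler_pdivrMr ?exprn_gt0 // mul1r.
    rewrite -(ler_pM2l qF) mulrA; apply: le_trans (_ : 1 / 2 <= _); last first.
      by rewrite mulrA divff ?gt_eqF.
    by move: qb; rewrite normrM (gtr0_norm qF).
  have h2 : e <= q%:R^-1 / 4.
    rewrite eE invfM mulrC ler_wpM2r // lef_pV2 ?posrE //.
  have : 0 < q%:R^-1 :> F by rewrite invr_gt0.
  lra.
set q' := (q %/ gcdn q (d ^ k))%N in hk *.
have g0 : (0 < gcdn q (d ^ k))%N by rewrite gcdn_gt0 q0.
have q'0 : (0 < q')%N by rewrite divn_gt0 // dvdn_leq // dvdn_gcdl.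
have q'F : 0 < q'%:R :> F by rewrite ltr0n.
have eq1 : (q = q' * gcdn q (d ^ k))%N by rewrite divnK // dvdn_gcdl.
have qq' : q%:R <= q'%:R * d%:R ^+ k :> F.
  rewrite [in leLHS]eq1 -natrX -natrM ler_nat leq_mul2l dvdn_leq ?orbT ?expn_gt0 ?d0 //.
  exact: dvdn_gcdr.
set near := (fun u : nat => _).
rewrite -size_filter; set s' := [seq _ <- _ | _].
have s'P u : u \in s' -> [/\ coprime u q, U <= u%:R, u%:R <= U * R,
     (u ^ k = u0 ^ k %[mod q'])%N & `|beta| * (d%:R ^+ k * `|u%:R ^+ k - u0%:R ^+ k|) <= e].
  rewrite mem_filter => /andP[nu us0]; have [h1 h2 h3] := hs _ us0.
  have [_ _ h4] := hs _ u0s.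
  by have [h5 h6] := near_points q0 d0 cqa al h3 h4 hB nu.
pose T := [seq r <- iota 0 q' | r ^ k == u0 ^ k %[mod q']].
have ST : (size T <= kappa)%N.
  apply: hk; rewrite coprimeXl //; have [h _ _] := hs _ u0s.
  by apply: coprime_dvdr h; rewrite [in X in (_ %| X)%N]eq1 dvdn_mulr.
have inT u : u \in s' -> (u %% q')%N \in T.
  by move=> /s'P[_ _ _ h _]; rewrite mem_filter mem_iota /= add0n ltn_pmod // modnXm h eqxx.
have fin (D : F) : 0 <= D -> 2 * D / q'%:R <= 2 * W ^+ k.-1 ->
    (forall u, u \in s' -> `|u%:R - u0%:R| <= D) -> (size s')%:R <= kappa%:R * (4 * W ^+ k.-1).
  move=> D0 hD hu.
  apply: le_trans (count_residues_le (filter_uniq _ us) q'0 D0 inT hu) _.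
  have rD : 0 <= 2 * D / q'%:R by rewrite divr_ge0 ?mulr_ge0 ?(ltW q'F).
  by apply: ler_pM; rewrite ?ler_nat //; move: hD rD Wk1; clear; lra.
case: minor => minor.
  apply: (fin (U * R)).
  - by rewrite UR divr_ge0 ?ltW.
  - have : U * R <= W ^+ k.-1 * q'%:R.
      rewrite UR ler_pdivrMr // mulrAC [_ * W]mulrC -WWk [leRHS]mulrC.
      by apply: le_trans (ltW minor) _; apply: le_trans qq' _; rewrite ler_pM2l.
    by rewrite ler_pdivrMr //; clear; lra.
  - move=> u /s'P[_ h1 h2 _ _]; have [_ h3 h4] := hs _ u0s.
    by rewrite ler_norml; apply/andP; split; lra.
have b0 : 0 < `|beta|.
  rewrite normr_gt0; apply: contraTneq minor => ->.
  by rewrite mulr0 normr0 mul0r -leNgt ltW.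
have dF : 0 < d%:R ^+ k :> F by rewrite exprn_gt0 ?ltr0n.
pose c := `|beta| * d%:R ^+ k * U ^+ k.-1.
have c0 : 0 < c by rewrite /c mulr_gt0 ?exprn_gt0 // mulr_gt0.
apply: (fin (e / c)).
- by rewrite divr_ge0 // ltW.
- have key : M * R <= `|beta| * d%:R ^+ k * q'%:R * P ^+ k.
    apply: le_trans (ltW minor) _; rewrite normrM (gtr0_norm qF) ler_wpM2r ?exprn_ge0 //.
      by rewrite PE mulr_ge0 // ltW.
    by rewrite mulrC -mulrA ler_wpM2l // mulrC.
  suff h : e <= W ^+ k.-1 * (c * q'%:R).
    have -> : 2 * (e / c) / q'%:R = 2 * (e / (c * q'%:R)) by field; rewrite !gt_eqF.
    by rewrite ler_pM2l // ler_pdivrMr //; exact: mulr_gt0 c0 q'F.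
  have cE : c * q'%:R * W ^+ k.-1 = `|beta| * d%:R ^+ k * q'%:R * M ^+ k.-1.
    by rewrite /c UE expr_div_n; field; rewrite expf_neq0 // gt_eqF.
  have -> : W ^+ k.-1 * (c * q'%:R) = c * q'%:R * W ^+ k.-1 by ring.
  rewrite cE eE -(ler_pM2r (exprn_gt0 k M0)) -(ler_pM2r Xk).
  have -> : `|beta| * d%:R ^+ k * q'%:R * M ^+ k.-1 * M ^+ k * X ^+ k =
      (`|beta| * d%:R ^+ k * q'%:R * P ^+ k) * M ^+ k.-1 by rewrite PE exprMn; ring.
  apply: (@le_trans _ _ (M * R * M ^+ k.-1)); last by rewrite ler_wpM2r ?exprn_ge0 ?(ltW M0).
  have -> : (4 * X ^+ k)^-1 * M ^+ k * X ^+ k = M ^+ k / 4 by field; rewrite gt_eqF.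
  have -> : M * R * M ^+ k.-1 = M ^+ k * R by rewrite mulrAC -exprS prednK.
  by rewrite ler_wpM2l ?exprn_ge0 ?(ltW M0) //; lra.
- move=> u /s'P[_ h1 _ _ h2]; have [_ h3 _] := hs _ u0s.
  rewrite ler_pdivlMr //; apply: le_trans h2.
  have := subr_powers_ge k0 (ltW U0) h1 h3.
  rewrite /c => h4; have bd : 0 <= `|beta| * d%:R ^+ k by rewrite mulr_ge0 // ltW.
  have -> : `|u%:R - u0%:R| * (`|beta| * d%:R ^+ k * U ^+ k.-1) =
    `|beta| * d%:R ^+ k * (`|u%:R - u0%:R| * U ^+ k.-1) :> F by ring.
  by rewrite [leRHS]mulrA; apply: ler_wpM2l.
Qed.

End MajorBlocks.

Section MajorBlockEstimate.
Context {F : realType}.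
Local Notation normc := (@Normc.normc F).

Definition split_weight (q p : nat) (v : nat) : F[i] :=
  if all (leq^~ p) (primes v) && coprime v q then 1 else 0.

Lemma split_weight_le q p (x : nat -> F) n : `|x n| <= 1 ->
  normc (split_weight q p n * (x n)%:C%C) <= 1.
Proof.
move=> h; rewrite Normc.normcM normc_real /split_weight.
by case: ifP => _; rewrite ?Normc.normc1 ?Normc.normc0 ?mul1r ?mul0r.
Qed.

Definition head_ok (q : nat) (R U : F) (u : nat) :=
  [&& U <= u%:R, u%:R < (pdiv u)%:R * U, rsmooth R u & coprime u q].

(** The conditions on [u * v] separate into one on [u], one on [v] that sees only [pdiv u], and the
    interval for [v], the last link between them, which [interval_sum_le] removes. *)
Lemma block_splits (k q : nat) (R th N U : F) (u K : nat) : 1 < U -> 0 <= R -> (0 < u)%N -> U <= u%:R ->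
  \sum_(0 <= v < K | splits_at U u v) block k q R th N (u * v) =
  if head_ok q R U u then
    \sum_(0 <= v < K | (N / 2 / u%:R < v%:R) && (v%:R <= N / u%:R))
      (if smooth (N / U) R v then split_weight q (pdiv u) v * expe (th * u%:R ^+ k * v%:R ^+ k) else 0)
  else 0.
Proof.
move=> U1 R0 u0 Uu; have uF : 0 < u%:R :> F by rewrite ltr0n.
have UF : 0 < U by exact: lt_trans U1.
rewrite big_mkcond /=; case: ifPn => [/and4P[_ h2 h3 h4]|hn]; last first.
  rewrite big1 // => v _; case: ifP => // /and4P[_ g2 g3 g4].
  rewrite /block; case: ifP => // /and5P[_ _ _ g5 g6]; case/negP: hn.
  rewrite rsmoothM // in g5; move: g5 g6 => /andP[g5 _]; rewrite coprimeMl => /andP[g6 _].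
  by apply/and4P.
rewrite [RHS]big_mkcond /=; apply: eq_bigr => v _.
rewrite /splits_at Uu h2 /= /block /split_weight smoothE.
have -> : (N / 2 / u%:R < v%:R) = (N / 2 < (u * v)%:R).
  by rewrite natrM [_ * v%:R]mulrC -ltr_pdivrMr.
have -> : (v%:R <= N / u%:R) = ((u * v)%:R <= N).
  by rewrite natrM [_ * v%:R]mulrC -ler_pdivlMr.
have [v0|v0] := posnP v; first by rewrite v0 muln0 /=; case: ifP.
rewrite muln_gt0 u0 v0 /=.
case c1: (N / 2 < _) => /=; last by case: ifP.
case c2: (_ <= N) => /=; last by case: ifP.
rewrite rsmoothM // h3 coprimeMl h4 /=.
have -> : v%:R <= N / U.
  rewrite ler_pdivlMr //; apply: le_trans c2; rewrite natrM mulrC ler_wpM2r //.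
rewrite /=; case: (all _ _) => /=; last by case: ifP => //; rewrite mul0r.
case: (rsmooth R v) => //=; case: (coprime v q) => /=; last by rewrite ?mul0r.
by rewrite mul1r natrM exprMn; congr expe; ring.
Qed.

Lemma size_head_le (s : seq nat) (B : F) : uniq s -> 0 <= B ->
  (forall u, u \in s -> (0 < u)%N /\ u%:R <= B) -> (size s)%:R <= B.
Proof.
move=> us B0 h; apply: le_trans (_ : (Num.truncn B)%:R <= _); last by rewrite truncn_le.
rewrite ler_nat -(size_iota 1 (Num.truncn B)); apply: uniq_leq_size => // u /h[u0 uB].
by rewrite mem_iota u0 add1n ltnS truncn_ge_nat.
Qed.

Lemma pdiv_le_of_rsmooth (R : F) u : (1 < u)%N -> rsmooth R u -> (pdiv u)%:R <= R.
Proof. by move=> u1 /allP; apply; rewrite mem_primes pdiv_prime // pdiv_dvd ltnW. Qed.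

(* Write [n = u v] with [M / W <= u <= M R / W] and [v <= X]. As [alpha] is not in the major arcs, the points
   [alpha d^k u^k] are spaced by about [X ^- k], apart from a multiplicity of size [W^(k-1) q^eps]. *)
Lemma major_block_estimate (k : nat) (t D eps : F) : (1 < k)%N -> 1 <= t -> 0 < eps ->
  weight_uniform_admissible k t D ->
  exists2 eta : F, 0 < eta & exists2 C : F, 0 < C &
  forall (alpha beta M P R W X A : F) (q a d l K : nat),
  (0 < q)%N -> (0 < d)%N -> coprime q a -> alpha = a%:R / q%:R + beta ->
  0 < M -> 1 <= W -> d%:R <= W -> 2 <= R -> R <= X -> R <= X `^ eta ->
  P = M * X -> 1 < M / W ->
  q%:R <= X ^+ k -> `|q%:R * beta| * (M * R) ^+ k <= 1 / 2 ->
  (M * R < q%:R \/ M * R < `|q%:R * beta| * P ^+ k) ->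
  X < (2 ^ l)%:R -> (2 ^ l <= K)%N -> P / W < K%:R -> 0 < A ->
  normc (\sum_(0 <= n < K) block k q R (alpha * d%:R ^+ k) (P / W) n) <=
  C * (R * l.+1%:R) * (M / W * R * A
     + A `^ (1 - t) * (q%:R `^ eps * W ^+ k.-1 * X `^ (t + D + eps))).
Proof.
move=> k1 t1 e0 adm; have k0 : (0 < k)%N by exact: ltnW.
have [eta eta0 [C1 C10 h1]] := mean_value_at_points t1 e0 adm.
have [C2 C20 h2] := exp_size_primes_le (k ^ 3) e0.
(* The 4 comes from the multiplicity and the 16 from the width of the sieve; the final 1 gives
   [C3 >= 1], so that one constant can multiply both terms. *)
pose C3 := C1 * (C2 + 1) * 4 * 16 + 1.
have C30 : 1 <= C3 by rewrite /C3 lerDr !mulr_ge0 ?addr_ge0 // ltW.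
exists eta => //; exists (4 * C3); first by rewrite mulr_gt0 // (lt_le_trans _ C30).
move=> alpha beta M P R W X A q a d l K q0 d0 cqa al M0 W1 dW R2 RX Re PE U1 qX qb minor Xl lK NK A0.
set U := M / W in U1 *.
have W0 : 0 < W by exact: lt_le_trans W1.
have U0 : 0 < U by exact: lt_trans U1.
have X2 : 2 <= X by exact: le_trans RX.
have X0 : 0 < X by exact: lt_le_trans X2.
have R0 : 0 <= R by exact: le_trans R2.
have NU : P / W / U = X by rewrite PE /U; field; rewrite !gt_eqF.
have NE : P / W = U * X by rewrite PE /U; ring.
set N := P / W in NU NE NK *; set th := alpha * d%:R ^+ k.
set r := Num.truncn R.
have [Wt [Wt0 Wt1 Wtn Wta]] := interval_sum_le (F := F) l.
pose S p := [seq u <- iota 0 K | (pdiv u == p) && head_ok q R U u].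
pose E := A `^ (1 - t) * (C3 * (q%:R `^ eps * W ^+ k.-1 * X `^ (t + D + eps))).
have E0 : 0 <= E.
  rewrite /E mulr_ge0 ?powR_ge0 // mulr_ge0 ?(le_trans ler01 C30) //.
  by rewrite !mulr_ge0 ?powR_ge0 // exprn_ge0 // ltW.
have us p : uniq (S p) by rewrite filter_uniq ?iota_uniq.
have SP p u : u \in S p -> [/\ (1 < u)%N, coprime u q, U <= u%:R & u%:R <= U * R].
  rewrite mem_filter => /andP[/andP[_ /and4P[g1 g2 g3 g4]] _].
  have u1 : (1 < u)%N by rewrite -(ltr1n F) (lt_le_trans U1).
  split => //; apply: le_trans (ltW g2) _; rewrite mulrC ler_pM2l //.
  exact: pdiv_le_of_rsmooth.
have inner p x : x \in map snd Wt ->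
    \sum_(u <- S p) normc (weyl_sum k X R (fun v => split_weight q p v * (x v)%:C%C) (th * u%:R ^+ k))
    <= U * R * A + E.
  move=> xW; set c := (fun v => split_weight q p v * _).
  have c1 n : normc (c n) <= 1 by apply: split_weight_le; apply: Wtn.
  have Xk : 0 < X ^+ k by rewrite exprn_gt0.
  have Xk4 : 4 <= X ^+ k.
    apply: (@le_trans _ _ (2 ^+ k)); last by rewrite lerXn2r ?nnegrE // ltW.
    have -> : 4 = 2 ^+ 2 :> F by ring.
    by rewrite ler_eXn2l // ltr1n.
  set q' := (q %/ gcdn q (d ^ k))%N.
  have q'0 : (0 < q')%N by rewrite divn_gt0 ?gcdn_gt0 ?q0 // dvdn_leq // dvdn_gcdl.
  pose kappa := ((k ^ 3) ^ size (primes q'))%N.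
  have kapE : kappa%:R <= C2 * q%:R `^ eps.
    rewrite /kappa natrX; apply: le_trans (h2 _ q'0) _.
    rewrite ler_wpM2l ?(ltW C20) // ge0_ler_powR ?nnegrE ?(ltW e0) // ler_nat.
    exact: leq_div.
  have W10 : 0 <= W ^+ k.-1 by rewrite exprn_ge0 // ltW.
  have R1 : 1 <= R by apply: le_trans R2; rewrite ler1n.
  have X1 : 1 <= X by apply: le_trans X2; rewrite ler1n.
  have SP' u : u \in S p -> [/\ coprime u q, U <= u%:R & u%:R <= U * R].
    by move=> /SP[].
  have mul := @major_multiplicity F alpha beta M P R W X U k q a d kappa (S p)
     k1 q0 d0 cqa al M0 W1 dW R1 X1 PE erefl qX qb minor (us p) SP'
     (fun c cc => roots_mod_le k0 q'0 cc).
  have m0 : 0 <= kappa%:R * (4 * W ^+ k.-1) by rewrite !mulr_ge0.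
  have d1 : 8 * (16 * X ^+ k)^-1 * X ^+ k <= 1.
    have -> : 8 * (16 * X ^+ k)^-1 * X ^+ k = 1 / 2.
      by field; rewrite ?expf_neq0 ?(gt_eqF X0).
    by clear; lra.
  have d2 : 4 * (16 * X ^+ k)^-1 <= 1.
    by rewrite ler_pdivrMr ?mulr_gt0 //; lra.
  have d3 : 0 < (16 * X ^+ k)^-1 by rewrite invr_gt0 mulr_gt0.
  have LS := h1 X R R2 RX Re c c1 _ (S p) (fun u => th * u%:R ^+ k) (16 * X ^+ k)^-1
    (kappa%:R * (4 * W ^+ k.-1)) d3 d1 d2 m0 mul.
  (* The level [A] stays free here; [major_case] balances the two resulting terms. *)
  apply: (@le_trans _ _ (\sum_(u <- S p) (A + A `^ (1 - t) * normc (weyl_sum k X R c (th * u%:R ^+ k)) `^ t))).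
    by apply: ler_sum => u _; apply: powR_split => //; exact: normc_ge0.
  rewrite big_split /= -mulr_sumr big_const_seq count_predT iter_addr_0 -mulr_natl.
  apply: lerD.
    rewrite ler_wpM2r ?(ltW A0) //; apply: size_head_le => //.
      by rewrite mulr_ge0 // ltW.
    by move=> u /SP[h _ _ ?]; split => //; exact: ltnW.
  rewrite /E ler_wpM2l ?powR_ge0 //; apply: le_trans LS _.
  have -> : X `^ (t - k%:R + D + eps) = X `^ (t + D + eps) / X ^+ k.
    rewrite -powR_mulrn ?(ltW X0) // -powRN -powRD; last by rewrite (gt_eqF X0) implybT.
    by congr (_ `^ _); ring.
  have -> : C1 * (kappa%:R * (4 * W ^+ k.-1) / (16 * X ^+ k)^-1) * (X `^ (t + D + eps) / X ^+ k) =
     C1 * 4 * 16 * (W ^+ k.-1 * X `^ (t + D + eps)) * kappa%:R.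
    by field; rewrite ?expf_neq0 ?(gt_eqF X0).
  have Y0 : 0 <= W ^+ k.-1 * X `^ (t + D + eps) by rewrite mulr_ge0 ?powR_ge0.
  have C0 : 0 <= C1 * 4 * 16 * (W ^+ k.-1 * X `^ (t + D + eps)).
    by rewrite mulr_ge0 // mulr_ge0 // mulr_ge0 // ltW.
  apply: le_trans (ler_wpM2l C0 kapE) _.
  have -> : C1 * 4 * 16 * (W ^+ k.-1 * X `^ (t + D + eps)) * (C2 * q%:R `^ eps) =
    C1 * C2 * 4 * 16 * (q%:R `^ eps * W ^+ k.-1 * X `^ (t + D + eps)) by ring.
  rewrite ler_wpM2r ?mulr_ge0 ?powR_ge0 // /C3 -[leLHS]addr0 lerD //.
  by rewrite !ler_wpM2r // ler_wpM2l ?(ltW C10) // lerDl.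
rewrite (@sum_splits_at F _ U K r) //; last first.
  move=> n /or3P[h|h|h]; rewrite /block; case: ifP => // /and5P[n0 n1 n2 n3 _]; exfalso.
  - have : n%:R < K%:R :> F by exact: le_lt_trans NK.
    by rewrite ltr_nat ltnNge h.
  - move: n1; apply/negP; rewrite -leNgt; apply: le_trans (ltW h) _.
    by rewrite NE; have := ler_wpM2l (ltW U0) X2; lra.
  - by move: h; rewrite -rsmooth_le // n3.
apply: (@le_trans _ _ (\sum_(0 <= p < r.+1) \sum_(x <- Wt) x.1 * (U * R * A + E))).
  apply: le_trans (normc_sum _ _ _) _; apply: ler_sum => p _.
  apply: (@le_trans _ _ (\sum_(x <- Wt) x.1 * \sum_(u <- S p)
     normc (weyl_sum k X R (fun v => split_weight q p v * (x.2 v)%:C%C) (th * u%:R ^+ k)))); last first.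
    rewrite big_seq [leRHS]big_seq; apply: ler_sum => x xW.
    by apply: ler_wpM2l; [exact: (allP Wt0 _ xW)|apply: inner; exact: map_f].
  apply: le_trans (normc_sum _ _ _) _.
  under [leRHS]eq_bigr do rewrite mulr_sumr.
  rewrite exchange_big /= /S big_filter -[X in iota 0 X]subn0 -/(index_iota 0 K).
  rewrite big_mkcond [leRHS]big_mkcond; apply: ler_sum => u _ /=.
  case: eqP => [pu|_] //=.
  have [Uu|uU] := leP U u%:R; last first.
    have -> : head_ok q R U u = false by rewrite /head_ok leNgt uU.
    rewrite big_pred0 ?Normc.normc0 // => v.
    by rewrite /splits_at leNgt uU.
  have u0 : (0 < u)%N by rewrite -(ltr0n F) (lt_le_trans U0).
  rewrite block_splits //; case: ifP => hu; last by rewrite Normc.normc0.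
  have uF : 0 < u%:R :> F by rewrite ltr0n.
  rewrite -pu NU; apply: Wta => //.
    by rewrite divr_ge0 // divr_ge0 // NE mulr_ge0 // ltW.
  by rewrite ler_pdivrMr // NE [U * X]mulrC ler_wpM2l // ltW.
under eq_bigr do rewrite -mulr_suml Wt1.
rewrite sumr_const_nat subn0 -[leLHS]mulr_natl.
have rR : r.+1%:R <= 2 * R.
  by rewrite -natr1 mulr_natl mulr2n; apply: lerD; [rewrite /r truncn_le|apply: le_trans R2; rewrite ler1n].
have Y0 : 0 <= U * R * A := mulr_ge0 (mulr_ge0 (ltW U0) R0) (ltW A0).
apply: (@le_trans _ _ (2 * R * (2 * l.+1%:R * (U * R * A + E)))).
  by rewrite ler_wpM2r // mulr_ge0 ?addr_ge0 // mulr_ge0.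
have -> : 2 * R * (2 * l.+1%:R * (U * R * A + E)) = 4 * (R * l.+1%:R) * (U * R * A + E) by ring.
have -> : forall Z, 4 * C3 * (R * l.+1%:R) * Z = 4 * (R * l.+1%:R) * (C3 * Z) by move=> Z; ring.
rewrite ler_wpM2l ?mulr_ge0 // mulrDr lerD //; first by rewrite ler_peMl.
by rewrite /E mulrCA.
Qed.

End MajorBlockEstimate.

(** * The case of large [q] or [beta] *)

Section MinorSpacing.
Context {F : realType}.

(** Were the distance at most [e], [near_integer] would make [q] divide [d ^ k h], as [z] is coprime
    to [q], so [q <= d ^ k h]. This contradicts [L d ^ k < q]; in the other alternative it forces
    [beta (d z) ^ k h] to be at least [1 / La > e] in absolute value. *)
Lemma minor_spacing (alpha beta La L e : F) (k q a d z h : nat) (m : int) :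
  (0 < q)%N -> (0 < d)%N -> (0 < z)%N -> (0 < h)%N -> coprime q a -> coprime z q ->
  alpha = a%:R / q%:R + beta -> h%:R <= L ->
  L * ((d * z)%:R ^+ k * `|q%:R * beta|) <= 1 / 2 -> q%:R <= La -> e < (2 * La)^-1 ->
  (L * d%:R ^+ k < q%:R \/ 1 <= La * (z%:R ^+ k * `|q%:R * beta|)) ->
  e < `|alpha * ((d * z)%:R ^+ k * h%:R) - m%:~R|.
Proof.
move=> q0 d0 z0 h0 cqa czq al hL hq qLa eLa alt; rewrite ltNge; apply/negP => le_e.
have qF : 0 < q%:R :> F by rewrite ltr0n.
have La0 : 0 < La by apply: lt_le_trans qLa.
have dz0 : 0 <= (d * z)%:R ^+ k :> F by rewrite exprn_ge0.
pose H : int := ((d * z) ^ k * h)%N.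
have HE : H%:~R = (d * z)%:R ^+ k * h%:R :> F by rewrite /H -[LHS]/(((d * z) ^ k * h)%N%:R) [LHS]natrM [((d * z) ^ k)%:R]natrX.
have nb : `|beta * H%:~R| = `|beta| * ((d * z)%:R ^+ k * h%:R).
  by rewrite HE normrM [`|_ * h%:R|]ger0_norm // mulr_ge0.
have bb : q%:R * `|beta| = `|q%:R * beta| by rewrite normrM gtr0_norm.
have h1 : `|beta * H%:~R| <= q%:R^-1 / 2.
  rewrite nb -(ler_pM2l qF).
  have -> : q%:R * (q%:R^-1 / 2) = 1 / 2 :> F by field; rewrite gt_eqF.
  have -> : q%:R * (`|beta| * ((d * z)%:R ^+ k * h%:R)) =
      h%:R * ((d * z)%:R ^+ k * `|q%:R * beta|) by rewrite -bb; ring.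
  by apply: le_trans hq; rewrite ler_wpM2r // mulr_ge0.
have h2 : e < q%:R^-1 / 2.
  apply: lt_le_trans eLa _; rewrite invfM mulrC ler_wpM2r // lef_pV2 ?posrE //.
have h3 : `|beta * H%:~R| + e < q%:R^-1 by lra.
have le_e' : `|alpha * H%:~R - m%:~R| <= e by rewrite HE.
have [dv le1] := near_integer q0 cqa al le_e' h3.
have dh : (q <= d ^ k * h)%N.
  apply: dvdn_leq; first by rewrite muln_gt0 expn_gt0 d0.
  rewrite absz_nat expnMn mulnAC in dv.
  by rewrite Gauss_dvdl // coprime_sym coprimeXl in dv.
have dhF : q%:R <= d%:R ^+ k * h%:R :> F by rewrite -natrX -natrM ler_nat.
case: alt => [lt|ge].
  have : q%:R <= L * d%:R ^+ k.
    by apply: le_trans dhF _; rewrite mulrC ler_wpM2r ?exprn_ge0.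
  by rewrite leNgt lt.
have : La^-1 <= `|beta * H%:~R|.
  rewrite -(ler_pM2l La0) divff ?gt_eqF //; apply: le_trans ge _.
  rewrite ler_wpM2l ?(ltW La0) // nb -bb natrM exprMn.
  have -> : z%:R ^+ k * (q%:R * `|beta|) = `|beta| * z%:R ^+ k * q%:R by ring.
  have -> : `|beta| * (d%:R ^+ k * z%:R ^+ k * h%:R) = `|beta| * z%:R ^+ k * (d%:R ^+ k * h%:R) by ring.
  by rewrite ler_wpM2l // mulr_ge0 // exprn_ge0.
have : (2 * La)^-1 <= La^-1 by rewrite lef_pV2 ?posrE ?mulr_gt0 //; lra.
lra.
Qed.

(** Two of the indices counted have points within [2 * e] of each other, so they differ by more than
    [L] and lie in different blocks of length [b]. *)
Lemma minor_multiplicity (g : F) (La L e : F) (H : nat) : 0 < L ->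
  (forall (h : nat) (m : int), (0 < h)%N -> h%:R <= L -> 2 * e < `|g * h%:R - m%:~R|) ->
  forall i, i \in iota 0 H ->
  (count (fun j => `|frac (g * j%:R) - frac (g * i%:R)| <= e) (iota 0 H))%:R <= H%:R / L + 1.
Proof.
move=> L0 sp i _; set near := (fun j : nat => _).
pose b := (Num.truncn L).+1.
have bL : L <= b%:R by rewrite ltW // truncnS_gt.
have b0 : (0 < b)%N by [].
rewrite -size_filter; set s := [seq _ <- _ | _].
have us : uniq s by rewrite filter_uniq ?iota_uniq.
have inj : {in s &, injective (fun j => j %/ b)%N}.
  have lt_inj (j j' : nat) : j \in s -> j' \in s -> (j < j')%N -> (j %/ b = j' %/ b)%N -> False.
    rewrite !mem_filter => /andP[n1 _] /andP[n2 _] jj' e1.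
    pose m : int := Num.floor (g * j'%:R) - Num.floor (g * j%:R).
    have d0 : (0 < j' - j)%N by rewrite subn_gt0.
    have dL : (j' - j)%:R <= L.
      apply: (@le_trans _ _ (Num.truncn L)%:R); last by rewrite truncn_le ltW.
      rewrite ler_nat -ltnS -/b ltn_subLR ?(ltnW jj') //.
      rewrite (divn_eq j' b) (divn_eq j b) e1 -addnA ltn_add2l.
      by rewrite (leq_trans (ltn_pmod _ b0)) // leq_addl.
    have := sp _ m d0 dL; rewrite ltNge => /negP; apply.
    have -> : g * (j' - j)%:R - m%:~R = (frac (g * j'%:R) - frac (g * i%:R)) - (frac (g * j%:R) - frac (g * i%:R)).
      by rewrite natrB ?(ltnW jj') // /m intrB /frac; ring.
    by apply: le_trans (ler_normB _ _) _; move: n1 n2; rewrite /near; lra.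
  move=> j j' js j's e1; have [h|h|//] := ltngtP j j'; first by case: (lt_inj j j').
  by case: (lt_inj j' j).
have : (size s <= size (iota 0 (H %/ b).+1))%N.
  apply: (size_le_of_inj us inj) => j; rewrite mem_filter !mem_iota !add0n /= => /andP[_ jH].
  by rewrite ltnS leq_div2r // ltnW.
rewrite size_iota -(ler_nat F) -natr1 => /le_trans; apply; rewrite lerD2r.
rewrite ler_pdivlMr //; apply: (@le_trans _ _ ((H %/ b)%:R * b%:R)).
  by rewrite ler_wpM2l.
by rewrite -natrM ler_nat leq_divM.
Qed.

End MinorSpacing.

Section MinorBlocks.
Context {F : realType}.
Local Notation normc := (@Normc.normc F).

Definition head_weight (q p : nat) (U : F) (u : nat) : F[i] :=
  if [&& pdiv u == p, U <= u%:R, u%:R < p%:R * U & coprime u q] then 1 else 0.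

Lemma head_weight_le q p U (x : nat -> F) n : `|x n| <= 1 ->
  normc (head_weight q p U n * (x n)%:C%C) <= 1.
Proof.
move=> h; rewrite Normc.normcM normc_real /head_weight.
by case: ifP => _; rewrite ?Normc.normc1 ?Normc.normc0 ?mul1r ?mul0r.
Qed.

(** The counterpart of [block_splits] with the roles exchanged: [v] is fixed, and the head [u]
    becomes the variable of the Weyl sum. *)
Lemma block_heads (k q p : nat) (R th N U : F) (v K : nat) : 1 < U -> 0 <= R -> (0 < v)%N ->
  \sum_(0 <= u < K | pdiv u == p)
     (if splits_at U u v then block k q R th N (u * v) else 0) =
  if [&& all (leq^~ p) (primes v), rsmooth R v & coprime v q] then
    \sum_(0 <= u < K | (N / 2 / v%:R < u%:R) && (u%:R <= Num.min (N / v%:R) (U * R)))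
      (if smooth (U * R) R u then head_weight q p U u * expe (th * v%:R ^+ k * u%:R ^+ k) else 0)
  else 0.
Proof.
move=> U1 R0 v0; have vF : 0 < v%:R :> F by rewrite ltr0n.
have UF : 0 < U by exact: lt_trans U1.
have gt0 u : U <= u%:R -> (0 < u)%N.
  by move=> h; rewrite -(ltr0n F) (lt_le_trans UF).
case: ifPn => [/and3P[h1 h2 h3]|hn]; last first.
  rewrite big1 // => u /eqP pu; case: ifP => // /and4P[g1 g2 g3 g4].
  rewrite /block; case: ifP => // /and5P[g0 _ _ g5 g6]; case/negP: hn.
  move: g5; rewrite (rsmoothM _ (gt0 _ g1) v0) => /andP[_ g5].
  move: g6; rewrite coprimeMl => /andP[_ g6].
  by rewrite -pu; apply/and3P.
rewrite big_mkcond [RHS]big_mkcond /=; apply: eq_bigr => u _.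
have -> : (N / 2 / v%:R < u%:R) = (N / 2 < (u * v)%:R).
  by rewrite natrM -ltr_pdivrMr.
rewrite le_min.
have -> : (u%:R <= N / v%:R) = ((u * v)%:R <= N).
  by rewrite natrM -ler_pdivlMr.
rewrite /splits_at /block /head_weight smoothE v0 /=.
case: eqP => [pu|] /=; last by rewrite !mul0r; case: ifP => // _; case: ifP.
rewrite pu h1 /= andbT.
have [Uu|uU] := leP U u%:R; last by rewrite /= mul0r; case: ifP => // _; case: ifP.
have u0 := gt0 _ Uu; rewrite /= muln_gt0 u0 v0 /=.
have [up|pu'] := ltP u%:R (p%:R * U); last by rewrite /= mul0r; case: ifP => // _; case: ifP.
case c1: (N / 2 < _) => //=.
case c2: (_ <= N) => //=.
rewrite rsmoothM // h2 andbT coprimeMl h3 andbT.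
case c3: (rsmooth R u) => /=; last by case: ifP => //; rewrite andbF.
have u1 : (1 < u)%N by rewrite -(ltr1n F) (lt_le_trans U1).
have -> : u%:R <= U * R.
  apply: le_trans (ltW up) _; rewrite mulrC ler_pM2l // -pu; exact: pdiv_le_of_rsmooth.
rewrite /=; case: (coprime u q); last by rewrite mul0r.
by rewrite mul1r natrM exprMn; congr expe; ring.
Qed.

(** The tail is split again at the same [U], both primes being taken outermost. The last hypothesis
    ensures that the tail reaches [U] wherever the term is nonzero. *)
Lemma sum_splits_at_twice (T : nmodType) (U : F) (K r : nat) (phi : nat -> T) : 1 < U ->
  (forall n, [|| (K <= n)%N, n%:R < U | ~~ all (leq^~ r) (primes n)] -> phi n = 0) ->
  (forall u v, splits_at U u v -> v%:R < U -> phi (u * v)%N = 0) ->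
  \sum_(0 <= n < K) phi n =
   \sum_(0 <= p1 < r.+1) \sum_(0 <= p2 < r.+1) \sum_(0 <= z < K)
     \sum_(0 <= y < K | (pdiv y == p2) && splits_at U y z)
       \sum_(0 <= u < K | pdiv u == p1) if splits_at U u (y * z) then phi (u * (y * z))%N else 0.
Proof.
move=> U1 h h2; rewrite (@sum_splits_at F _ U K r) //; apply: eq_bigr => p1 _.
transitivity (\sum_(0 <= u < K | pdiv u == p1) \sum_(0 <= p2 < r.+1) \sum_(0 <= y < K | pdiv y == p2)
     \sum_(0 <= z < K | splits_at U y z) if splits_at U u (y * z) then phi (u * (y * z))%N else 0).
  apply: eq_bigr => u _; rewrite big_mkcond /=.
  apply: (@sum_splits_at F _ U K r) => // v hv; case: ifP => // sp.
  have u0 : (0 < u)%N by rewrite ltnW // (splits_at_gt1 U1 sp).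
  have v0 : (0 < v)%N by case/and4P: sp.
  case/or3P: hv => hv; [|exact: h2|].
    by apply: h; rewrite (leq_trans hv) // leq_pmull.
  apply: h; apply/or3P; apply: Or33; apply: contra hv => /allP hv.
  by apply/allP => p pv; apply: hv; rewrite primesM // pv orbT.
rewrite exchange_big /=; apply: eq_bigr => p2 _.
rewrite exchange_big /=; under eq_bigr do rewrite exchange_big /=.
by rewrite (exchange_big_dep xpredT).
Qed.

(* Write [n = x y z] with [x] and [y] in [[U, U R]], and apply the bilinear estimate for each fixed [z]. The
   scale [U] is as large as the spacing of the points [alpha (d z)^k h], with [h <= (U R)^k], permits. *)
Lemma minor_block_estimate (k w : nat) (D eps : F) : (1 < k)%N -> 0 < eps ->
  weight_uniform_admissible k (2 * w.+1%:R) D ->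
  exists2 eta : F, 0 < eta & exists2 C : F, 0 < C &
  forall (alpha beta La G P R W U B : F) (q a d l K : nat),
  (0 < q)%N -> (0 < d)%N -> coprime q a -> alpha = a%:R / q%:R + beta ->
  1 <= W -> d%:R <= W -> 2 <= R -> 1 < U -> R <= (U * R) `^ eta -> 0 < P ->
  La = U ^+ k * G -> G ^+ 2 = W ^+ k * R ^+ (6 * k) -> 0 < G ->
  U ^+ 2 * R ^+ 5 <= P / W ->
  q%:R <= La -> P ^+ k * `|q%:R * beta| <= La ->
  (La = q%:R \/ La = P ^+ k * `|q%:R * beta|) ->
  U * R < (2 ^ l)%:R -> (2 ^ l <= K)%N -> P / W < K%:R -> 0 <= B ->
  C * (G * R ^+ k * La * (U * R) `^ (4 * w.+1%:R ^+ 2 - 2 * k%:R + 2 * D + 2 * eps))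
    <= B ^+ (2 * w.+1 * w.+1) ->
  normc (\sum_(0 <= n < K) block k q R (alpha * d%:R ^+ k) (P / W) n) <=
  8 * R ^+ 2 * l.+1%:R * (P / W / U ^+ 2) * B.
Proof.
move=> k1 e0 adm; have k0 : (0 < k)%N by exact: ltnW.
have [eta eta0 [C1 C10 h1]] := bilinear_estimate e0 adm.
exists eta => //; exists (C1 * ((2 * w.+1%:R + 5) * 32)).
  by rewrite !mulr_gt0 ?addr_gt0 ?mulr_gt0.
move=> alpha beta La G P R W U B q a d l K q0 d0 cqa al W1 dW R2 U1 Re P0 LaE GE G0 UN qLa bLa alt Xl lK NK B0 hB.
have W0 : 0 < W by exact: lt_le_trans W1.
have U0 : 0 < U by exact: lt_trans U1.
have R0 : 0 < R by apply: lt_le_trans R2.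
have R1 : 1 <= R by apply: le_trans R2; rewrite ler1n.
have qF : 0 < q%:R :> F by rewrite ltr0n.
have La0 : 0 < La by exact: lt_le_trans qLa.
set N := P / W in UN NK *; set th := alpha * d%:R ^+ k.
have N0 : 0 < N by rewrite divr_gt0.
set V := U * R in Re Xl hB *.
have V0 : 0 < V by rewrite mulr_gt0.
have RV : R <= V by rewrite /V ler_peMl ?ltW.
pose H := (w.+1 * (Num.truncn V) ^ k).+1.
(* Chosen so that [L (d z) ^ k |q beta| <= 1 / 2], given [d z U ^ 2 <= P] and
   [P ^ k |q beta| <= La = U ^ k G]. *)
pose L := U ^+ k / (2 * G).
have Uk0 : 0 < U ^+ k by rewrite exprn_gt0.
have Uk1 : 1 <= U ^+ k by rewrite exprn_ege1 // ltW.
have Rk1 : 1 <= R ^+ k by rewrite exprn_ege1.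
have L0 : 0 < L by rewrite divr_gt0 ?mulr_gt0.
have Rk0 : 0 < R ^+ k by rewrite exprn_gt0.
have Wk0 : 0 < W ^+ k by rewrite exprn_gt0.
have R6 : R ^+ (6 * k) = R ^+ k * R ^+ k * R ^+ k * R ^+ k * R ^+ k * R ^+ k.
  by rewrite mulnC exprM; ring.
have Wk1 : 1 <= W ^+ k by rewrite exprn_ege1.
have powle (x y : F) : 0 <= x -> x <= y -> x ^+ k <= y ^+ k.
  by move=> x0 xy; rewrite lerXn2r ?nnegrE ?(le_trans x0 xy).
have U2k : (U ^+ 2) ^+ k = (U ^+ k) ^+ 2 by rewrite -!exprM mulnC.
have RkG : R ^+ k <= G.
  have h : (R ^+ k) ^+ 2 <= G ^+ 2.
    rewrite GE R6; set x := R ^+ k in Rk1 Rk0 *.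
    have x2 : 1 <= x * x by move: Rk1; clear; nra.
    have x4 : 1 <= x * x * (x * x) by move: x2; clear; nra.
    have : 1 <= W ^+ k * (x * x * (x * x)) by move: Wk1 x4; clear; nra.
    move=> h; have -> : W ^+ k * (x * x * x * x * x * x) = W ^+ k * (x * x * (x * x)) * x ^+ 2 by ring.
    by rewrite ler_peMl // exprn_ge0 // ltW.
  by rewrite -(@ler_pXn2r _ 2) // nnegrE ltW.
have G1 : 1 <= G by exact: le_trans RkG.
have La1 : 1 <= La by apply: le_trans qLa; rewrite ler1n.
have VkLa : V ^+ k <= La by rewrite /V exprMn LaE ler_pM2l.
(* [2 * (4 * dl)] is [1 / (4 La)], below the [1 / (2 La)] of [minor_spacing]; the 4 comes from the
   sieve and the 2 from [minor_multiplicity]. *)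
pose dl := (32 * La)^-1.
have dl0 : 0 < dl by rewrite invr_gt0 mulr_gt0.
have dlV : 8 * dl * V ^+ k <= 1.
  have -> : 8 * dl * V ^+ k = V ^+ k / La / 4 by rewrite /dl; field; rewrite gt_eqF.
  have : V ^+ k / La <= 1 by rewrite ler_pdivrMr // mul1r.
  by clear; lra.
have dl1 : 4 * dl <= 1.
  by rewrite /dl ler_pdivrMr ?mulr_gt0 //; move: La1; clear; lra.
(* The range left for [z] when both heads lie in [U, U R] and the product in (N / 2, N]. *)
pose Zok (z : nat) := [&& (0 < z)%N, coprime z q, N / 2 < U ^+ 2 * R ^+ 2 * z%:R & U ^+ 2 * z%:R <= N].
have spacing z : Zok z -> forall (h : nat) (m : int), (0 < h)%N -> h%:R <= L ->
    2 * (4 * dl) < `|th * z%:R ^+ k * h%:R - m%:~R|.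
  move=> /and4P[z0 cz z1 z2] h m h0 hL.
  have -> : th * z%:R ^+ k * h%:R = alpha * ((d * z)%:R ^+ k * h%:R).
    by rewrite /th natrM exprMn; ring.
  have zF : 0 < z%:R :> F by rewrite ltr0n.
  apply: (@minor_spacing F alpha beta La L _ k q a d z h m) => //.
  - have dz : ((d * z)%:R * U ^+ 2) ^+ k <= P ^+ k.
      have h2 : (d * z)%:R * U ^+ 2 <= P.
        have -> : P = W * N by rewrite /N; field; rewrite gt_eqF.
        rewrite natrM -mulrA; apply: ler_pM => //; first by rewrite mulr_ge0 ?exprn_ge0 // ltW.
        by rewrite mulrC.
      by rewrite lerXn2r ?nnegrE ?mulr_ge0 ?exprn_ge0 ?(ltW U0) ?(ltW P0).
    have -> : L * ((d * z)%:R ^+ k * `|q%:R * beta|) =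
        (((d * z)%:R * U ^+ 2) ^+ k * `|q%:R * beta|) / (2 * La).
      by rewrite /L LaE exprMn U2k; field; rewrite ?expf_neq0 ?(gt_eqF U0) ?(gt_eqF G0).
    rewrite ler_pdivrMr ?mulr_gt0 //.
    have -> : 1 / 2 * (2 * La) = La by field.
    by apply: le_trans bLa; rewrite ler_wpM2r.
  - rewrite /dl; have -> : 2 * (4 * (32 * La)^-1) = (4 * La)^-1 by field; rewrite gt_eqF.
    by rewrite ltf_pV2 ?posrE ?mulr_gt0 // ltr_pM2r // ltr_nat.
  (* Both alternatives explain [G ^ 2 = W ^ k R ^ (6 k)]. The first needs [2 G ^ 2 > W ^ k]. In the
     second, [z] exceeds [N / (2 U ^ 2 R ^ 2)], and [R ^ 6 >= 2 R ^ 2] makes up for the deficit. *)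
  - case: alt => alt; [left|right].
      rewrite -alt LaE /L mulrAC ltr_pdivrMr ?mulr_gt0 //.
      have -> : U ^+ k * G * (2 * G) = U ^+ k * (2 * G ^+ 2) by ring.
      rewrite ltr_pM2l // GE.
      have d1 : d%:R ^+ k <= W ^+ k by rewrite lerXn2r ?nnegrE ?ler0n ?(ltW W0).
      apply: (le_lt_trans d1); rewrite mulrCA ltr_pMr //.
      have : 1 <= R ^+ (6 * k) by rewrite exprn_ege1.
      by clear; lra.
    have Pk0 : 0 < P ^+ k by rewrite exprn_gt0.
    have e1 : `|q%:R * beta| = La / P ^+ k by rewrite alt mulrAC divff ?mul1r // gt_eqF.
    have -> : La * (z%:R ^+ k * `|q%:R * beta|) = (z%:R * U ^+ 2 * R ^+ 6 * W) ^+ k / P ^+ k.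
      rewrite e1; have -> : La * (z%:R ^+ k * (La / P ^+ k)) = z%:R ^+ k * (U ^+ k) ^+ 2 * G ^+ 2 / P ^+ k.
        by rewrite LaE; ring.
      by rewrite GE 3!exprMn U2k exprM; congr (_ / _); ring.
    rewrite ler_pdivlMr // mul1r.
    have -> : P = W * N by rewrite /N; field; rewrite gt_eqF.
    apply: powle; first by rewrite mulr_ge0 ?(ltW W0) ?(ltW N0).
    rewrite mulrC ler_pM2r //.
    have R26 : 2 * R ^+ 2 <= R ^+ 6.
      have -> : R ^+ 6 = R ^+ 4 * R ^+ 2 by ring.
      rewrite ler_pM2r ?exprn_gt0 //; apply: le_trans R2 _.
      by rewrite ler_eXnr.
    apply: (@le_trans _ _ (z%:R * U ^+ 2 * (2 * R ^+ 2))).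
      by move: z1; clear; lra.
    by rewrite ler_wpM2l // mulr_ge0 ?exprn_ge0 // ltW.
pose m := H%:R / L + 1.
have m0 : 0 <= m by rewrite /m addr_ge0 // divr_ge0 // ltW.
have mle : m <= (2 * w.+1%:R + 5) * (G * R ^+ k).
  have HV : H%:R <= w.+1%:R * (U ^+ k * R ^+ k) + 1.
    rewrite /H -natr1 lerD2r natrM ler_wpM2l // natrX -exprMn lerXn2r ?nnegrE ?(ltW V0) //.
    by rewrite truncn_le ltW.
  have GRk : 1 <= G * R ^+ k by move: G1 Rk1; clear; nra.
  have h2 : H%:R / L <= 2 * w.+1%:R * (G * R ^+ k) + 2 * G.
    have -> : H%:R / L = H%:R * (2 * G) / U ^+ k by rewrite /L; field; rewrite ?expf_neq0 ?(gt_eqF U0) ?(gt_eqF G0).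
    rewrite ler_pdivrMr //.
    have G20 : 0 <= 2 * G by rewrite mulr_ge0 // ltW.
    apply: le_trans (ler_wpM2r G20 HV) _.
    have : 2 * G <= 2 * G * U ^+ k by rewrite ler_peMr.
    by clear; lra.
  have GG : G <= G * R ^+ k by rewrite ler_peMr // ltW.
  have w1 : 0 <= w.+1%:R * (G * R ^+ k) by rewrite !mulr_ge0 // ltW.
  by rewrite /m; move: h2 GG w1 GRk; clear; lra.
have smooth_wide (g : nat -> F) : (forall y, 0 <= g y) ->
    \sum_(0 <= y < K | smooth V R y) g y <=
    \sum_(1 <= y < (Num.truncn V).+1 | smooth V R y && xpredT y) g y.
  move=> g0; have VK : (Num.truncn V < K)%N.
    apply: leq_trans lK; rewrite truncn_lt_nat //; exact: ltW.
  rewrite [leRHS](eq_bigl (smooth V R)); last by move=> y; rewrite andbT.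
  rewrite (big_cat_nat _ (n := (Num.truncn V).+1)) //= [X in _ + X]big_nat_cond [X in _ + X]big1.
    by rewrite addr0 big_ltn_cond.
  move=> i /andP[/andP[h _] /and3P[_ iV _]].
  by move: h; rewrite truncn_lt_nat ?(ltW V0) // ltNge iV.
have [Wt [Wt0 Wt1 Wtn Wta]] := interval_sum_le (F := F) l.
pose hw (p : nat) (x : nat -> F) (v : nat) := head_weight q p U v * (x v)%:C%C.
pose E := 4 * w.+1%:R ^+ 2 - 2 * k%:R + 2 * D + 2 * eps.
have bil p x z : x \in map snd Wt -> Zok z ->
    \sum_(1 <= y < (Num.truncn V).+1 | smooth V R y && xpredT y)
       normc (weyl_sum k V R (hw p x) (th * z%:R ^+ k * y%:R ^+ k)) <= B.
  move=> xW zok.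
  have c1 n : normc (hw p x n) <= 1 by apply: head_weight_le; exact: Wtn.
  have sp := @minor_multiplicity F (th * z%:R ^+ k) La L (4 * dl) H L0 (spacing z zok).
  have hH : (w.+1 * (Num.truncn V) ^ k < H)%N by [].
  have := h1 V R R2 RV Re (hw p x) xpredT (th * z%:R ^+ k) dl m H c1 hH dl0 dlV dl1 m0 sp.
  set S := (X in X ^+ _ <= _) => hS.
  have S0 : 0 <= S by apply: sumr_ge0 => y _; exact: normc_ge0.
  rewrite -(@ler_pXn2r _ (2 * w.+1 * w.+1)) ?nnegrE //.
  apply: le_trans hS _; apply: le_trans hB; rewrite -/E.
  have -> : C1 * (m / dl) * V `^ E = C1 * 32 * La * V `^ E * m.
    by rewrite /dl; field; rewrite gt_eqF.
  have c0 : 0 <= C1 * 32 * La * V `^ E by rewrite !mulr_ge0 ?powR_ge0 // ltW.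
  apply: le_trans (ler_wpM2l c0 mle) _.
  by rewrite le_eqVlt; apply/orP; left; apply/eqP; ring.
set r := Num.truncn R.
pose I p v := \sum_(0 <= u < K | pdiv u == p)
     (if splits_at U u v then block k q R th N (u * v) else 0).
pose T p1 z := \sum_(x <- Wt) x.1 *
  \sum_(1 <= y < (Num.truncn V).+1 | smooth V R y && xpredT y)
       normc (weyl_sum k V R (hw p1 x.2) (th * z%:R ^+ k * y%:R ^+ k)).
have T0 p z : 0 <= T p z.
  rewrite /T big_seq; apply: sumr_ge0 => x xW; rewrite mulr_ge0 //; first exact: (allP Wt0 _ xW).
  by apply: sumr_ge0 => y _; exact: normc_ge0.
have gtU u : U <= u%:R -> (0 < u)%N by move=> h; rewrite -(ltr0n F) (lt_le_trans U0).
have gtU1 u : U <= u%:R -> (1 < u)%N by move=> h; rewrite -(ltr1n F) (lt_le_trans U1).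
have head_lt u : U <= u%:R -> u%:R < (pdiv u)%:R * U -> rsmooth R u -> u%:R <= V.
  move=> h h2 h3; apply: le_trans (ltW h2) _; rewrite /V mulrC ler_pM2l //.
  by apply: pdiv_le_of_rsmooth => //; exact: gtU1.
have step p1 p2 z : \sum_(0 <= y < K | (pdiv y == p2) && splits_at U y z) normc (I p1 (y * z)%N)
    <= if Zok z then T p1 z else 0.
  case: ifPn => [zok|nz].
    rewrite /T; under [leRHS]eq_bigr do rewrite mulr_sumr.
    rewrite exchange_big /=.
    apply: le_trans (smooth_wide (fun y => \sum_(x <- Wt) x.1 *
       normc (weyl_sum k V R (hw p1 x.2) (th * z%:R ^+ k * y%:R ^+ k))) _); last first.
      move=> y; rewrite big_seq; apply: sumr_ge0 => x xW; rewrite mulr_ge0 ?normc_ge0 //.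
      exact: (allP Wt0 _ xW).
    rewrite big_mkcond [leRHS]big_mkcond; apply: ler_sum => y _ /=.
    have nn : 0 <= \sum_(x <- Wt) x.1 * normc (weyl_sum k V R (hw p1 x.2) (th * z%:R ^+ k * y%:R ^+ k)).
      rewrite big_seq; apply: sumr_ge0 => x xW; rewrite mulr_ge0 ?normc_ge0 //.
      exact: (allP Wt0 _ xW).
    case: ifP => [/andP[_ sy]|_]; last by case: ifP.
    have /and4P[Uy yU z0 _] := sy.
    have y0 := gtU _ Uy.
    have yz0 : (0 < y * z)%N by rewrite muln_gt0 y0.
    rewrite /I block_heads ?(ltW R0) //; case: ifPn => [/and3P[_ sm _]|_]; last first.
      by rewrite Normc.normc0; case: ifP.
    have smy : rsmooth R y by move: sm; rewrite rsmoothM // => /andP[].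
    have -> : smooth V R y by rewrite smoothE y0 smy andbT /= head_lt.
    have -> : th * z%:R ^+ k * y%:R ^+ k = th * (y * z)%:R ^+ k by rewrite natrM exprMn; ring.
    apply: Wta => //; last by rewrite ge_min lexx orbT.
    by rewrite divr_ge0 // divr_ge0 // ltW.
  rewrite big1 // => y /andP[_ /and4P[Uy yU z0 _]].
  rewrite /I big1 ?Normc.normc0 // => u _; case: ifP => // /and4P[Uu uU _ _].
  rewrite /block; case: ifP => // /and5P[_ n1 n2 sm cop]; exfalso.
  have y0 := gtU _ Uy; have u0 := gtU _ Uu.
  move: sm; rewrite !rsmoothM ?muln_gt0 ?y0 // => /and3P[su sy _].
  move: cop; rewrite !coprimeMl => /and3P[_ _ cz].
  have uV := head_lt _ Uu uU su; have yV := head_lt _ Uy yU sy.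
  have zF : 0 < z%:R :> F by rewrite ltr0n.
  case/negP: nz; rewrite /Zok z0 cz /=; move: n1 n2; rewrite !natrM => n1 n2.
  have UU : U * U <= u%:R * y%:R by apply: ler_pM => //; exact: ltW.
  have VV : u%:R * y%:R <= V * V by apply: ler_pM.
  apply/andP; split.
    apply: lt_le_trans n1 _; rewrite mulrA ler_pM2r //.
    by have -> : U ^+ 2 * R ^+ 2 = V * V by rewrite /V; ring.
  by apply: le_trans n2; rewrite mulrA ler_pM2r.
(* A tail below [U] would give a product of at most [U * V], outside the block; excluding this is
   the purpose of [U ^ 2 * R ^ 5 <= N]. *)
have UNs : U * V < N / 2.
  have R5 : 4 <= R ^+ 3.
    apply: (@le_trans _ _ (2 ^+ 3)); first by rewrite -!natrX ler_nat.
    by apply: lerXn2r => //; rewrite nnegrE ltW.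
  have UV0 : 0 < U * V by rewrite mulr_gt0.
  have h2 : U * V * (R * R ^+ 3) <= N.
    by apply: le_trans UN; rewrite /V le_eqVlt; apply/orP; left; apply/eqP; ring.
  rewrite ltr_pdivlMr //; apply: lt_le_trans h2; rewrite ltr_pM2l //.
  apply: (@lt_le_trans _ _ (2 * R ^+ 3)); last by rewrite ler_wpM2r // exprn_ge0 // ltW.
  by rewrite ltr_pMr // (lt_le_trans _ R5) // ltr1n.
have decomp : \sum_(0 <= n < K) block k q R th N n =
   \sum_(0 <= p1 < r.+1) \sum_(0 <= p2 < r.+1) \sum_(0 <= z < K)
     \sum_(0 <= y < K | (pdiv y == p2) && splits_at U y z) I p1 (y * z)%N.
  apply: sum_splits_at_twice => //.
    move=> n /or3P[h|h|h]; rewrite /block; case: ifP => // /and5P[n0 n1 n2 n3 _]; exfalso.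
    - have : n%:R < K%:R :> F by exact: le_lt_trans NK.
      by rewrite ltr_nat ltnNge h.
    - move: n1; apply/negP; rewrite -leNgt; apply: le_trans (ltW h) _.
      by apply: le_trans (ltW UNs); rewrite ler_peMr ?(ltW U0) // (le_trans R1 RV).
    - by move: h; rewrite -rsmooth_le ?n3 // ltW.
  move=> u v /and4P[Uu uU v0 _] vU.
  rewrite /block; case: ifP => // /and5P[_ n1 _ sm _]; exfalso.
  have u0 := gtU _ Uu; move: sm; rewrite rsmoothM // => /andP[su _].
  move: n1; apply/negP; rewrite -leNgt; apply: le_trans (ltW UNs).
  rewrite natrM mulrC; apply: ler_pM => //; first exact: ltW.
  exact: head_lt.
rewrite decomp.
(* The constant 8: two primes with at most [2 R] values each, and the mass [2 * l.+1] of the cutoff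
   weights. *)
apply: (@le_trans _ _ (\sum_(0 <= p1 < r.+1) \sum_(0 <= p2 < r.+1) (N / U ^+ 2 * (2 * l.+1%:R * B)))).
  apply: le_trans (normc_sum _ _ _) _; apply: ler_sum => p1 _.
  apply: le_trans (normc_sum _ _ _) _; apply: ler_sum => p2 _.
  apply: le_trans (normc_sum _ _ _) _.
  apply: (@le_trans _ _ (\sum_(0 <= z < K) if Zok z then 2 * l.+1%:R * B else 0)).
    apply: ler_sum => z _; apply: le_trans (normc_sum _ _ _) _; apply: le_trans (step p1 p2 z) _.
    case: ifP => // zok; rewrite /T -Wt1 mulr_suml big_seq [leRHS]big_seq.
    apply: ler_sum => x xW; apply: ler_wpM2l; first exact: (allP Wt0 _ xW).
    by apply: bil => //; exact: map_f.
  rewrite -big_mkcond /= -big_filter big_const_seq count_predT iter_addr_0 -[leLHS]mulr_natl.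
  rewrite ler_wpM2r ?mulr_ge0 //; apply: size_head_le.
  - by rewrite filter_uniq ?iota_uniq.
  - by rewrite divr_ge0 ?exprn_ge0 // ltW.
  - move=> z; rewrite mem_filter => /andP[/and4P[z0 _ _ h] _]; split => //.
    by rewrite ler_pdivlMr ?exprn_gt0 // mulrC.
have sc (y : F) : \sum_(0 <= p < r.+1) y = r.+1%:R * y.
  by rewrite sumr_const_nat subn0 mulr_natl.
rewrite !sc.
have rR : r.+1%:R <= 2 * R.
  rewrite -natr1 mulr_natl mulr2n; apply: lerD => //.
  by rewrite /r truncn_le ltW.
set Y := N / U ^+ 2 * _.
have Y0 : 0 <= Y by rewrite /Y !mulr_ge0 // ?invr_ge0 ?exprn_ge0 // ltW.
apply: (@le_trans _ _ (2 * R * (2 * R * Y))).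
  apply: ler_pM => //; first by rewrite mulr_ge0.
  by rewrite ler_wpM2r.
rewrite le_eqVlt; apply/orP; left; apply/eqP; rewrite /Y.
by ring.
Qed.

End MinorBlocks.

(** * Reduction of the Weyl sum to blocks *)

Section DyadicReduction.
Context {F : realType}.
Local Notation normc := (@Normc.normc F).

Lemma dyadic_telescope (N x : F) (c : F[i]) (J : nat) : 0 < x -> N < (2 ^ J)%:R * x ->
  (if x <= N then c else 0) =
  \sum_(0 <= j < J) (if (N / (2 ^ j)%:R / 2 < x) && (x <= N / (2 ^ j)%:R) then c else 0).
Proof.
move=> x0; elim: J => [|J IH] h.
  by rewrite big_nil ifF //; apply/negbTE; rewrite -ltNge; move: h; rewrite expn0 mul1r.
have p0 : 0 < (2 ^ J)%:R :> F by rewrite ltr0n expn_gt0.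
have e1 : N / (2 ^ J)%:R / 2 < x.
  by rewrite !ltr_pdivrMr // -mulrA [2 * _]mulrC -natrM -expnSr mulrC.
rewrite big_nat_recr //= e1 /=.
have [xN|Nx] := leP x (N / (2 ^ J)%:R).
  have N0 : 0 < N by rewrite -(pmulr_lgt0 _ (_ : 0 < (2 ^ J)%:R^-1)) ?invr_gt0 // (lt_le_trans x0).
  rewrite big_nat big1 ?add0r; last first.
    move=> i /andP[_ iJ]; case: ifP => // /andP[h2 _]; exfalso.
    move: h2; apply/negP; rewrite -leNgt; apply: le_trans xN _.
    rewrite -mulrA ler_pM2l // -invfM lef_pV2 ?posrE ?mulr_gt0 ?ltr0n ?expn_gt0 //.
    by rewrite -natrM -expnSr ler_nat leq_exp2l.
  rewrite ifT //; apply: le_trans xN _; rewrite ler_pdivrMr //.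
  by rewrite ler_peMr ?(ltW N0) // ler1n expn_gt0.
by rewrite addr0; apply: IH; move: Nx; rewrite ltr_pdivrMr // mulrC.
Qed.

Lemma norm_block_sum_le k q (R th N : F) K : 0 <= N ->
  normc (\sum_(0 <= n < K) block k q R th N n) <= N.
Proof.
move=> N0; apply: le_trans (normc_sum _ _ _) _.
pose p n := (0 < n)%N && (n%:R <= N).
apply: (@le_trans _ _ (\sum_(0 <= n < K | p n) 1)).
  rewrite [leRHS]big_mkcond; apply: ler_sum => n _; rewrite /block /p.
  case: ifP => [/and5P[-> _ -> _ _]|_]; first by rewrite normc_expe.
  by rewrite Normc.normc0; case: ifP.
rewrite -big_filter big_const_seq count_predT iter_addr_0; apply: size_head_le => //.
  by rewrite filter_uniq ?iota_uniq.
by move=> u; rewrite mem_filter => /andP[/andP[]].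
Qed.

Lemma smooth_weyl_sum_le_blocks k (alpha P R B : F) (q K J : nat) : (0 < q)%N -> 0 <= P -> P < K%:R ->
  P < (2 ^ J)%:R -> 0 <= B ->
  (forall d j, (0 < d)%N ->
    normc (\sum_(0 <= n < K) block k q R (alpha * d%:R ^+ k) (P / (d%:R * (2 ^ j)%:R)) n) <= B) ->
  normc (smooth_weyl_sum k alpha P R) <=
    (\sum_(0 <= d < K | (\pi(q)).-nat d) 1) * (J%:R * B).
Proof.
move=> q0 P0 PK PJ B0 hB.
pose phi n := if smooth P R n then 1 * expe (alpha * n%:R ^+ k) else 0 : F[i].
rewrite /smooth_weyl_sum -(@weyl_sum_ord_wide F k P R (fun=> 1) alpha K); last first.
  by rewrite truncn_lt_nat.
rewrite -/(phi _) (@sum_coprime_split _ q K phi) //; last first.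
  move=> n Kn; rewrite /phi /smooth; case: ifP => // /and3P[_ h _]; exfalso.
  by move: h; apply/negP; rewrite -ltNge (lt_le_trans PK) // ler_nat.
rewrite mulr_suml; apply: le_trans (normc_sum _ _ _) _; apply: ler_sum => d dq.
have d0 : (0 < d)%N by case/andP: dq.
rewrite mul1r.
have dF : 0 < d%:R :> F by rewrite ltr0n.
have d1 : 1 <= d%:R :> F by rewrite ler1n.
have [sd|nsd] := boolP (rsmooth R d); last first.
  rewrite big1 ?Normc.normc0 ?mulr_ge0 // => m /andP[m0 _].
  by rewrite /phi smoothE rsmoothM // (negbTE nsd) /= !andbF.
rewrite (_ : \sum_(0 <= m < K | (0 < m)%N && coprime m q) phi (d * m)%N = \sum_(0 <= j < J)
   \sum_(0 <= m < K) block k q R (alpha * d%:R ^+ k) (P / (d%:R * (2 ^ j)%:R)) m).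
  apply: le_trans (normc_sum _ _ _) _.
  apply: (@le_trans _ _ (\sum_(0 <= j < J) B)); first by apply: ler_sum => j _; exact: hB.
  by rewrite sumr_const_nat subn0 mulr_natl.
rewrite exchange_big /= big_mkcond; apply: eq_bigr => m _; rewrite /block.
case: (posnP m) => [->|m0]; first by rewrite /= big1.
have mF : 0 < m%:R :> F by rewrite ltr0n.
have m1 : 1 <= m%:R :> F by rewrite ler1n.
case: (boolP (coprime m q)) => /= cm; last first.
  by rewrite big1 // => j _; rewrite !andbF.
rewrite /phi smoothE muln_gt0 d0 m0 rsmoothM // sd /=.
case sm: (rsmooth R m); last by rewrite andbF big1 // => j _; rewrite !andbF.
rewrite andbT mul1r.
have -> : ((d * m)%:R <= P) = (m%:R <= P / d%:R) by rewrite natrM mulrC ler_pdivlMr.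
rewrite (@dyadic_telescope _ _ _ J) //; last first.
  apply: (@le_lt_trans _ _ P); first by rewrite ler_pdivrMr // ler_peMr.
  by apply: lt_le_trans PJ _; rewrite ler_peMr.
apply: eq_bigr => j _; rewrite invfM mulrA natrM exprMn mulrA /=.
by rewrite !andbT.
Qed.

End DyadicReduction.

(** * Choice of parameters in the two cases *)

Section MajorCase.
Context {F : realType}.
Local Notation normc := (@Normc.normc F).

Lemma powR_add (P : F) (x y : F) : 0 < P -> P `^ (x + y) = P `^ x * P `^ y.
Proof. by move=> P0; apply: powRD; apply/implyP => _; rewrite gt_eqF. Qed.

Lemma major_case (k : nat) (t D s lam eps : F) : (1 < k)%N -> k%:R + 1 < t -> 0 < eps ->
  weight_uniform_admissible k t D -> s < lam -> lam < 1 -> 0 <= lam ->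
  s * t + (1 - lam) * (1 + D) <= 1 + eps ->
  exists2 eta : F, 0 < eta & exists2 C : F, 0 < C &
  forall (alpha beta P R W : F) (q a d l K : nat),
  (0 < q)%N -> (0 < d)%N -> coprime q a -> alpha = a%:R / q%:R + beta ->
  2 <= P -> 1 <= W -> d%:R <= W -> W <= P `^ s -> 2 <= R -> R <= P `^ eta ->
  q%:R <= (P `^ (1 - lam)) ^+ k -> `|q%:R * beta| * (P `^ lam * R) ^+ k <= 1 / 2 ->
  (P `^ lam * R < q%:R \/ P `^ lam * R < `|q%:R * beta| * P ^+ k) ->
  P < (2 ^ l)%:R -> (2 ^ l <= K)%N -> P / W < K%:R ->
  normc (\sum_(0 <= n < K) block k q R (alpha * d%:R ^+ k) (P / W) n) <=
  C * (R ^+ 2 * l.+1%:R) * P `^ (1 - s + (k%:R + 2) * eps).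
Proof.
move=> k1 tk e0 adm sl l1 l0 hst; have k0 : (0 < k)%N by exact: ltnW.
have t1 : 1 <= t by apply: ltW; apply: le_lt_trans tk; rewrite lerDr.
have [eta1 eta10 [C C0 h1]] := major_block_estimate k1 t1 e0 adm.
set x := 1 - lam in hst *.
have x0 : 0 < x by rewrite subr_gt0.
have x1 : x <= 1 by rewrite gerDl oppr_le0.
exists (Num.min x (x * eta1)); first by rewrite lt_min x0 mulr_gt0.
exists (2 * C); first by rewrite mulr_gt0.
move=> alpha beta P R W q a d l K q0 d0 cqa al P2 W1 dW Ws R2 Re qX bM alt Pl lK WK.
have P0 : 0 < P by apply: lt_le_trans P2.
have P1 : 1 <= P by apply: le_trans P2; rewrite ler1n.
have R0 : 0 < R by apply: lt_le_trans R2.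
have R1 : 1 <= R by apply: le_trans R2; rewrite ler1n.
have W0 : 0 < W by exact: lt_le_trans W1.
have pp y : 0 < P `^ y by exact: powR_gt0.
set M := P `^ lam in bM alt; set X := P `^ x in qX.
have X0 : 0 < X by exact: pp.
have PE : P = M * X by rewrite -powR_add // /x addrCA subrr addr0 powRr1 // ltW.
have RX : R <= X by apply: le_trans Re _; apply: ler_powR => //; rewrite ge_min lexx.
have RX1 : R <= X `^ eta1.
  by apply: le_trans Re _; rewrite -powRrM; apply: ler_powR => //; rewrite ge_min lexx orbT.
have MW : 1 < M / W.
  rewrite ltr_pdivlMr // mul1r; apply: le_lt_trans Ws _.
  rewrite /M /powR (gt_eqF P0) ltr_expR ltr_pM2r // ln_gt0 //.
  by apply: lt_le_trans P2; rewrite ltr1n.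
have XP : X <= P by rewrite -[leRHS]powRr1 ?(ltW P0) //; exact: ler_powR.
(* The level at which the first term [M / W * R * A] is exactly [R P ^ (1 - s)]. *)
pose A := X * W * P `^ (- s).
have A0 : 0 < A by rewrite !mulr_gt0.
have /= := h1 alpha beta M P R W X A q a d l K q0 d0 cqa al (pp _) W1 dW R2 RX RX1 PE MW qX bM alt
  (le_lt_trans XP Pl) lK WK A0.
set LHS := normc _ => h; apply: le_trans h _.
set Z := P `^ (1 - s + (k%:R + 2) * eps).
have Z1 : M / W * R * A <= R * Z.
  have -> : M / W * R * A = R * P `^ (1 - s).
    rewrite powR_add // powRr1 ?(ltW P0) // /A; set p := P `^ (- s).
    have -> : M / W * R * (X * W * p) = R * ((M * X) * p) by field; rewrite gt_eqF.
    by rewrite -PE.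
  by rewrite ler_pM2l //; apply: ler_powR => //; rewrite lerDl mulr_ge0 ?addr_ge0 // ltW.
have Z2 : A `^ (1 - t) * (q%:R `^ eps * W ^+ k.-1 * X `^ (t + D + eps)) <= Z.
  (* Here [k + 1 < t] makes the powers of [W] harmless: their exponents add up to [k - t]. *)
  have WW : W `^ (1 - t) * W ^+ k.-1 <= 1.
    rewrite -powR_mulrn ?(ltW W0) // -powR_add // -[leRHS](powRr0 W); apply: ler_powR => //.
    have : k.-1%:R + 1 = k%:R :> F by rewrite natr1 prednK.
    by move=> kk; move: tk; rewrite -kk; clear; lra.
  have qe : q%:R `^ eps <= P `^ (k%:R * eps).
    rewrite powRrM powR_mulrn ?(ltW P0) //; apply: ge0_ler_powR; rewrite ?nnegrE ?(ltW e0) ?exprn_ge0 ?(ltW P0) //.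
    by apply: le_trans qX _; apply: lerXn2r; rewrite ?nnegrE ?(ltW X0) ?(ltW P0).
  have -> : A `^ (1 - t) = P `^ (x * (1 - t)) * W `^ (1 - t) * P `^ (- s * (1 - t)).
    by rewrite /A !powRM ?mulr_ge0 ?(ltW X0) ?(ltW W0) ?(ltW (pp _)) // -!powRrM.
  have -> : X `^ (t + D + eps) = P `^ (x * (t + D + eps)) by rewrite -powRrM.
  set a1 := P `^ (x * (1 - t)); set a2 := P `^ (- s * (1 - t)); set a3 := P `^ (x * (t + D + eps)).
  have -> : a1 * W `^ (1 - t) * a2 * (q%:R `^ eps * W ^+ k.-1 * a3) =
     (q%:R `^ eps * (W `^ (1 - t) * W ^+ k.-1)) * (a1 * a2 * a3) by ring.
  apply: (@le_trans _ _ ((P `^ (k%:R * eps) * 1) * (a1 * a2 * a3))).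
    apply: ler_wpM2r; first by rewrite !mulr_ge0 // ltW // pp.
    by apply: ler_pM; rewrite ?mulr_ge0 ?powR_ge0 ?exprn_ge0 // ltW.
  (* The exponents add up to [s t + x (1 + D) - s + (k + x) eps], and [hst] bounds the first two
     terms by [1 + eps]. *)
  rewrite mulr1 /a1 /a2 /a3 -!powR_add //; apply: ler_powR => //.
  have : x * eps <= eps by rewrite ler_piMl // ltW.
  move: hst; clear; nra.
have -> : 2 * C * (R ^+ 2 * l.+1%:R) * Z = C * (R * l.+1%:R) * (R * Z + R * Z) by ring.
rewrite ler_wpM2l ?mulr_ge0 // ?(ltW C0) ?(ltW R0) //.
apply: lerD => //; apply: le_trans Z2 _; rewrite ler_peMl // ltW //; exact: pp.
Qed.

End MajorCase.

Section MinorCase.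
Context {F : realType}.
Local Notation normc := (@Normc.normc F).

Lemma powR_root (y : F) n : (0 < n)%N -> 0 <= y -> (y `^ n%:R^-1) ^+ n = y.
Proof.
move=> n0 y0; rewrite -powR_mulrn ?powR_ge0 // -powRrM mulVf ?powRr1 //.
by rewrite pnatr_eq0 -lt0n.
Qed.

(** The bilinear estimate costs [W ^ (k / (2 n ^ 2))] through [G], with [n = w.+1], and [W ^ tau]
    when [V ^ (- 2 tau)] is replaced by [P ^ (- s)]. The hypothesis on [k / (2 n ^ 2) + tau] keeps
    the product at most [W], which the length [P / W] absorbs. *)
Lemma minor_case (k w : nat) (D tau s x eps : F) : (1 < k)%N -> 0 < eps ->
  weight_uniform_admissible k (2 * w.+1%:R) D ->
  0 < tau -> tau <= 1 / 2 -> k%:R - 2 * D = 4 * w.+1%:R ^+ 2 * tau ->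
  k%:R / (2 * w.+1%:R ^+ 2) + tau <= 1 -> 0 < x -> s = 2 * tau * x ->
  exists2 eta : F, 0 < eta & exists2 C : F, 0 < C &
  forall (alpha beta P R W : F) (q a d l K : nat),
  (0 < q)%N -> (0 < d)%N -> coprime q a -> alpha = a%:R / q%:R + beta ->
  2 <= P -> 1 <= W -> d%:R <= W -> W <= P `^ s -> 2 <= R -> R <= P `^ eta ->
  q%:R <= 2 * P `^ (k%:R / 2) -> P ^+ k * `|q%:R * beta| <= 2 * P `^ (k%:R / 2) ->
  ((P `^ x) ^+ k <= 2 * R ^+ k * q%:R \/
     (P `^ x) ^+ k <= 2 * R ^+ k * (P ^+ k * `|q%:R * beta|)) ->
  P < (2 ^ l)%:R -> (2 ^ l <= K)%N -> P / W < K%:R ->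
  normc (\sum_(0 <= n < K) block k q R (alpha * d%:R ^+ k) (P / W) n) <=
  C * (R ^+ 15 * l.+1%:R) * P `^ (1 - s + eps).
Proof.
move=> k1 e0 adm tau0 tau1 hD ht x0 hs; have k0 : (0 < k)%N by exact: ltnW.
have [eta1 eta10 [C1 C10 h1]] := minor_block_estimate k1 e0 adm.
set n : F := w.+1%:R in hD ht h1.
have n1 : 1 <= n by rewrite /n ler1n.
have n0 : 0 < n by exact: lt_le_trans n1.
(* The reciprocal of the exponent [2 * w.+1 * w.+1] in the bilinear estimate. *)
pose th := (2 * n ^+ 2)^-1.
have th0 : 0 < th by rewrite invr_gt0 !mulr_gt0.
have th1 : 2 * th <= 1.
  rewrite /th invfM mulrA divff ?pnatr_eq0 // mul1r invf_le1 ?exprn_gt0 //.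
  by rewrite exprn_ege1.
(* [x / 20] gives [R ^ 5 <= P ^ (x / 4)], which with [Wh <= P ^ (x / 2)] leaves [U >= P ^ (x / 4)];
   the second entry then yields [R <= (U R) ^ eta1]. *)
exists (Num.min (x / 20) (x / 4 * eta1)); first by rewrite lt_min !mulr_gt0 // invr_gt0.
exists (8 * C1 `^ th); first by rewrite mulr_gt0 // powR_gt0.
move=> alpha beta P R W q a d l K q0 d0 cqa al P2 W1 dW Ws R2 Re qP bP alt Pl lK WK.
have P0 : 0 < P by apply: lt_le_trans P2.
have P1 : 1 <= P by apply: le_trans P2; rewrite ler1n.
have R0 : 0 < R by apply: lt_le_trans R2.
have R1 : 1 <= R by apply: le_trans R2; rewrite ler1n.
have W0 : 0 < W by exact: lt_le_trans W1.
have qF : 1 <= q%:R :> F by rewrite ler1n.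
have powle (y z : F) : 0 <= y -> 0 <= z -> y ^+ k <= z ^+ k -> y <= z.
  by move=> y0 z0; rewrite ler_pXn2r.
pose La := Num.max q%:R (P ^+ k * `|q%:R * beta|).
have La1 : 1 <= La by rewrite le_max qF.
have La0 : 0 < La by exact: lt_le_trans La1.
have LaP : La <= 2 * P `^ (k%:R / 2) by rewrite ge_max qP.
have Rk0 : 0 < R ^+ k by rewrite exprn_gt0.
have XLa : (P `^ x) ^+ k <= 2 * R ^+ k * La.
  by case: alt => h; apply: le_trans h _; rewrite ler_pM2l ?mulr_gt0 // le_max lexx ?orbT.
pose Wh := W `^ 2^-1.
have Wh2 : Wh ^+ 2 = W by rewrite /Wh powR_root // ltW.
have Wh0 : 0 < Wh by exact: powR_gt0.
have Wk0 : 0 < Wh ^+ k by rewrite exprn_gt0.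
pose G := Wh ^+ k * R ^+ (3 * k).
have R3 : R ^+ (3 * k) = R ^+ k * R ^+ k * R ^+ k by rewrite mulnC exprM; ring.
have R3k : 0 < R ^+ (3 * k) by rewrite exprn_gt0.
have G0 : 0 < G by rewrite mulr_gt0.
pose U := (La / G) `^ k%:R^-1.
have Uk : U ^+ k = La / G by rewrite /U powR_root // divr_ge0 // ltW.
have U0 : 0 < U by rewrite powR_gt0 // divr_gt0.
have GE : G ^+ 2 = W ^+ k * R ^+ (6 * k).
  have e1 : (Wh ^+ k) ^+ 2 = W ^+ k by rewrite -exprM mulnC exprM Wh2.
  have e2 : (R ^+ (3 * k)) ^+ 2 = R ^+ (6 * k) by rewrite -exprM mulnAC.
  by rewrite /G exprMn e1 e2.
have LaE : La = U ^+ k * G by rewrite Uk mulfVK // gt_eqF.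
pose V := U * R.
have V0 : 0 < V by rewrite mulr_gt0.
have Rk2 : 2 <= R ^+ k by apply: le_trans R2 _; rewrite ler_eXnr.
have Rk4 : 4 <= R ^+ k.
  apply: (@le_trans _ _ (R ^+ 2)).
    have -> : 4 = 2 ^+ 2 :> F by ring.
    by apply: lerXn2r => //; rewrite nnegrE ltW.
  by apply: ler_weXn2l.
have VRW0 : 0 < V * R ^+ 4 * Wh by exact: mulr_gt0 (mulr_gt0 V0 (exprn_gt0 4 R0)) Wh0.
have XV : P `^ x <= V * R ^+ 4 * Wh.
  apply: powle; rewrite ?powR_ge0 ?(ltW VRW0) //.
  have -> : (V * R ^+ 4 * Wh) ^+ k = La * (R ^+ k * R ^+ k).
    have e4 : (R ^+ 4) ^+ k = R ^+ k * R ^+ k * R ^+ k * R ^+ k by rewrite -exprM mulnC exprM; ring.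
    rewrite 2!exprMn e4 /V exprMn Uk /G R3.
    by field; rewrite (gt_eqF Wk0) (gt_eqF Rk0).
  apply: le_trans XLa _; rewrite mulrC ler_pM2l // ler_pM2r //.
have XU : P `^ x <= U * R ^+ 5 * Wh by apply: le_trans XV _; rewrite /V le_eqVlt; apply/orP; left; apply/eqP; ring.
have pp y : 0 < P `^ y by exact: powR_gt0.
have mono (y z : F) : y <= z -> P `^ y <= P `^ z by exact: ler_powR.
have Ux : P `^ (x / 4) <= U.
  have R5 : R ^+ 5 <= P `^ (x / 4).
    apply: (@le_trans _ _ ((P `^ (x / 20)) ^+ 5)).
      apply: lerXn2r; rewrite ?nnegrE ?powR_ge0 ?(ltW R0) //.
      by apply: le_trans Re _; apply: mono; rewrite ge_min lexx.
    rewrite -powR_mulrn ?powR_ge0 // -powRrM; apply: mono.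
    by rewrite le_eqVlt; apply/orP; left; apply/eqP; field.
  have WhP : Wh <= P `^ (x / 2).
    apply: (@le_trans _ _ ((P `^ s) `^ 2^-1)).
      by apply: ge0_ler_powR; rewrite ?nnegrE ?invr_ge0 ?powR_ge0 // ltW.
    rewrite -powRrM; apply: mono; rewrite hs.
    have : tau * x <= 1 / 2 * x by rewrite ler_pM2r.
    clear; lra.
  rewrite -(ler_pM2r (mulr_gt0 (pp (x / 4)) (pp (x / 2)))) -!powR_add //.
  have -> : x / 4 + (x / 4 + x / 2) = x by field.
  apply: le_trans XU _; rewrite powR_add // -mulrA ler_pM2l //.
  by apply: ler_pM => //; rewrite ?exprn_ge0 // ltW.
have U1 : 1 < U.
  apply: lt_le_trans Ux; rewrite /powR (gt_eqF P0) expR_gt1 mulr_gt0 ?divr_gt0 // ln_gt0 //.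
  by apply: lt_le_trans P2; rewrite ltr1n.
have VU : U <= V by rewrite /V ler_peMr // ltW.
have V1 : 1 <= V by apply: le_trans VU; exact: ltW.
have RV : R <= (U * R) `^ eta1.
  apply: le_trans Re _; apply: (@le_trans _ _ (P `^ (x / 4 * eta1))).
    by apply: mono; rewrite ge_min lexx orbT.
  rewrite powRrM; apply: ge0_ler_powR; rewrite ?nnegrE ?powR_ge0 ?(ltW eta10) ?(ltW V0) //.
  exact: le_trans VU.
(* The k-th power of the left side times [W] is [La ^ 2 / R ^ k]; the surplus [R ^ k >= 4] absorbs
   the square of the 2 in [LaP]. *)
have UN : U ^+ 2 * R ^+ 5 <= P / W.
  have URW0 : 0 < U ^+ 2 * R ^+ 5 * W by exact: mulr_gt0 (mulr_gt0 (exprn_gt0 2 U0) (exprn_gt0 5 R0)) W0.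
  rewrite ler_pdivlMr //; apply: powle; rewrite ?(ltW P0) ?(ltW URW0) //.
  have -> : (U ^+ 2 * R ^+ 5 * W) ^+ k = La ^+ 2 / R ^+ k.
    have e2 : (U ^+ 2) ^+ k = (La / G) ^+ 2 by rewrite -exprM mulnC exprM Uk.
    have e5 : (R ^+ 5) ^+ k = R ^+ k * R ^+ k * R ^+ k * R ^+ k * R ^+ k by rewrite -exprM mulnC exprM; ring.
    have e6 : W ^+ k = (Wh ^+ k) ^+ 2 by rewrite -{1}Wh2 -!exprM mulnC.
    rewrite 2!exprMn e2 e5 e6 /G R3.
    by field; rewrite (gt_eqF Wk0) (gt_eqF Rk0).
  rewrite ler_pdivrMr //; apply: (@le_trans _ _ ((2 * P `^ (k%:R / 2)) ^+ 2)).
    by apply: lerXn2r; rewrite ?nnegrE ?mulr_ge0 ?powR_ge0 // ltW.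
  rewrite exprMn -[(P `^ _) ^+ 2]powR_mulrn ?powR_ge0 // -powRrM.
  have -> : k%:R / 2 * 2%:R = k%:R :> F by field.
  rewrite powR_mulrn ?(ltW P0) // mulrC ler_pM2l ?exprn_gt0 //.
  by have -> : 2 ^+ 2 = 4 :> F by ring.
have VP : V <= P.
  apply: (@le_trans _ _ (P / W)); last by rewrite ler_pdivrMr // ler_peMr // ltW.
  apply: le_trans UN; rewrite /V; apply: ler_pM; rewrite ?(ltW U0) ?(ltW R0) //.
    by rewrite ler_eXnr // ltW.
  by rewrite ler_eXnr.
pose E := 4 * n ^+ 2 - 2 * k%:R + 2 * D + 2 * eps.
(* [La = U ^ k G] is replaced by [V ^ k G], so that only powers of [V] remain. *)
pose Y := C1 * (G ^+ 2 * R ^+ k * V `^ (k%:R + E)).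
have Y0 : 0 <= Y by rewrite /Y !mulr_ge0 ?exprn_ge0 ?powR_ge0 // ltW.
pose B := Y `^ th.
have BE : B ^+ (2 * w.+1 * w.+1) = Y.
  rewrite /B -powR_mulrn ?powR_ge0 // -powRrM.
  have -> : th * (2 * w.+1 * w.+1)%:R = 1 by rewrite /th /n !natrM; field; rewrite gt_eqF.
  by rewrite powRr1.
have hB : C1 * (G * R ^+ k * La * (U * R) `^ E) <= B ^+ (2 * w.+1 * w.+1).
  rewrite BE /Y ler_pM2l // (@powR_add F V k%:R E V0) powR_mulrn ?(ltW V0) // -/V.
  have -> : G ^+ 2 * R ^+ k * (V ^+ k * V `^ E) = G * R ^+ k * (V ^+ k * G) * V `^ E by ring.
  apply: ler_wpM2r; first exact: powR_ge0.
  apply: ler_wpM2l; first exact: mulr_ge0 (ltW G0) (ltW Rk0).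
  rewrite {1}LaE ler_pM2r //.
  by apply: lerXn2r; rewrite ?nnegrE ?(ltW U0) ?(ltW V0).
have altL : La = q%:R \/ La = P ^+ k * `|q%:R * beta|.
  by rewrite /La; case: (leP q%:R _) => _; [right|left].
have qLa : q%:R <= La by rewrite le_max lexx.
have bLa : P ^+ k * `|q%:R * beta| <= La by rewrite le_max lexx orbT.
have := h1 alpha beta La G P R W U B q a d l K q0 d0 cqa al W1 dW R2 U1 RV P0 LaE GE G0 UN qLa bLa altL
  (le_lt_trans VP Pl) lK WK (powR_ge0 _ _) hB.
set LHS := normc _ => h; apply: le_trans h _.
have kth : k%:R * th <= 1 - tau by move: ht; rewrite -/th; clear; lra.
have GB : (G ^+ 2) `^ th <= W `^ (1 - tau) * R ^+ 6.
  rewrite GE powRM ?exprn_ge0 ?(ltW W0) ?(ltW R0) //.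
  rewrite -!powR_mulrn ?(ltW W0) ?(ltW R0) // -!powRrM.
  apply: ler_pM; rewrite ?powR_ge0 //; apply: ler_powR => //.
  rewrite natrM -mulrA ler_piMr //; apply: le_trans kth _; rewrite gerDl oppr_le0; exact: ltW.
have RB : (R ^+ k) `^ th <= R.
  rewrite -powR_mulrn ?(ltW R0) // -powRrM -[leRHS]powRr1 ?(ltW R0) //; apply: ler_powR => //.
  by apply: le_trans kth _; rewrite gerDl oppr_le0 ltW.
have VB : (V `^ (k%:R + E)) `^ th <= V ^+ 2 * (R ^+ 4 * W `^ tau * P `^ (- s)) * P `^ eps.
  rewrite -powRrM.
  (* By [hD], [k + E = 4 n ^ 2 (1 - tau) + 2 eps]. The term [2] cancels against [U ^ 2] up to powers
     of [R], and [- 2 tau] is the saving. *)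
  have -> : (k%:R + E) * th = 2%:R + (- (2 * tau)) + 2 * th * eps.
    have -> : k%:R + E = 4 * n ^+ 2 * (1 - tau) + 2 * eps by rewrite /E; move: hD; clear; lra.
    by rewrite /th; field; rewrite gt_eqF.
  rewrite (@powR_add F V (2%:R + - (2 * tau)) _ V0) (@powR_add F V 2%:R _ V0) powR_mulrn ?(ltW V0) //.
  apply: ler_pM; last 1 first.
  - apply: (@le_trans _ _ (V `^ eps)); first by apply: ler_powR => //; rewrite ler_piMl // ltW.
    by apply: ge0_ler_powR; rewrite ?nnegrE ?(ltW e0) ?(ltW V0) ?(ltW P0).
  - exact: mulr_ge0 (exprn_ge0 2 (ltW V0)) (powR_ge0 _ _).
  - exact: powR_ge0.
  - apply: ler_wpM2l; first exact: exprn_ge0 (ltW V0).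
    rewrite powRN -[leLHS]mul1r ler_pdivrMr ?powR_gt0 //.
    have : (P `^ x) `^ (2 * tau) <= (V * R ^+ 4 * Wh) `^ (2 * tau).
      by apply: ge0_ler_powR; rewrite ?nnegrE ?mulr_ge0 ?powR_ge0 ?exprn_ge0 // ltW.
    rewrite -powRrM [x * _]mulrC -hs.
    rewrite (powRM _ (ltW (mulr_gt0 V0 (exprn_gt0 4 R0))) (ltW Wh0)) (powRM _ (ltW V0) (ltW (exprn_gt0 4 R0))).
    have -> : Wh `^ (2 * tau) = W `^ tau by rewrite -powRrM mulrA mulVf ?mul1r // pnatr_eq0.
    have R8 : (R ^+ 4) `^ (2 * tau) <= R ^+ 4.
      rewrite -[leRHS]powRr1 ?exprn_ge0 ?(ltW R0) //; apply: ler_powR; first by rewrite exprn_ege1.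
      by move: tau1; clear; lra.
    move=> hX; rewrite powRN mulrAC ler_pdivlMr // mul1r; apply: le_trans hX _.
    rewrite [leRHS]mulrC [leRHS]mulrA; apply: ler_wpM2r; first exact: powR_ge0.
    by apply: ler_wpM2l => //; exact: powR_ge0.
have BB : B <= C1 `^ th * (W `^ (1 - tau) * R ^+ 6 * R * (V ^+ 2 * (R ^+ 4 * W `^ tau * P `^ (- s)) * P `^ eps)).
  have G2 := ltW (exprn_gt0 2 G0); have Rk' := ltW Rk0; have VE := powR_ge0 V (k%:R + E).
  rewrite /B /Y (powRM _ (ltW C10) (mulr_ge0 (mulr_ge0 G2 Rk') VE)) (powRM _ (mulr_ge0 G2 Rk') VE).
  rewrite (powRM _ G2 Rk'); apply: ler_wpM2l; first exact: powR_ge0.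
  apply: ler_pM; rewrite ?mulr_ge0 ?powR_ge0 //.
  by apply: ler_pM; rewrite ?powR_ge0.
have c0 : 0 <= 8 * R ^+ 2 * l.+1%:R * (P / W / U ^+ 2).
  by rewrite !mulr_ge0 ?invr_ge0 ?exprn_ge0 // ltW.
apply: le_trans (ler_wpM2l c0 BB) _; rewrite le_eqVlt; apply/orP; left; apply/eqP.
have -> : P `^ (1 - s + eps) = P * P `^ (- s) * P `^ eps.
  by rewrite !powR_add // powRr1 // ltW.
have WE : W `^ (1 - tau) * W `^ tau = W by rewrite -powR_add // subrK powRr1 // ltW.
rewrite /V -{1}WE; move: (powR_gt0 (1 - tau) W0) (powR_gt0 tau W0) => w1 w2.
by field; rewrite (gt_eqF w1) (gt_eqF w2) (gt_eqF U0).
Qed.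

End MinorCase.

(** * Assembly of the minor arc bound *)

Section MinorArcs.
Context {F : realType}.
Local Notation normc := (@Normc.normc F).

(** Bernoulli's inequality for [2 ^ eps = 1 + x] bounds the number of binary digits by a multiple of
    [P ^ eps]. *)
Lemma dyadic_length (eps : F) : 0 < eps -> exists2 C : F, 0 < C &
  forall P : F, 2 <= P -> exists l, [/\ P < (2 ^ l)%:R, (2 ^ l)%:R <= 2 * P & l.+1%:R <= C * P `^ eps].
Proof.
move=> e0; pose x : F := 2 `^ eps - 1.
have x0 : 0 < x.
  rewrite /x subr_gt0 /powR pnatr_eq0 expR_gt1 mulr_gt0 // ln_gt0 // ltr1n //.
have bern n : 1 + n%:R * x <= (1 + x) ^+ n.
  elim: n => [|n IH]; first by rewrite mul0r addr0 expr0.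
  rewrite exprS; have x10 : 0 <= 1 + x by rewrite addr_ge0 // ltW.
  apply: le_trans (ler_wpM2l x10 IH).
  have h : 0 <= n%:R * x * x by rewrite !mulr_ge0 // ltW.
  rewrite -natr1; move: h; clear; nra.
exists (2 + x^-1); first by rewrite addr_gt0 ?invr_gt0.
move=> P P2; have P0 : 0 < P by apply: lt_le_trans P2.
have tP : (0 < Num.truncn P)%N.
  by rewrite truncn_ge_nat ?(ltW P0) //; apply: le_trans P2; rewrite ler1n.
have /andP[h1 h2] := trunc_log_bounds (isT : (1 < 2)%N) tP.
set m := trunc_log 2 _ in h1 h2.
have mP : (2 ^ m)%:R <= P by rewrite -truncn_ge_nat ?(ltW P0).
exists m.+1; split.
- by rewrite -truncn_lt_nat ?(ltW P0).
- by rewrite expnS natrM ler_pM2l.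
have e1 : (1 + x) ^+ m <= P `^ eps.
  rewrite /x addrC subrK -powR_mulrn ?powR_ge0 // -powRrM mulrC powRrM.
  apply: ge0_ler_powR; rewrite ?nnegrE ?powR_ge0 ?(ltW e0) ?(ltW P0) //.
  by rewrite powR_mulrn // -natrX.
have e2 := le_trans (bern m) e1.
have g1 : 1 <= P `^ eps by apply: le_trans e2; rewrite lerDl mulr_ge0 // ltW.
rewrite -natr1 -natr1 -addrA mulrDl addrC; apply: lerD; first by move: g1; clear; lra.
by rewrite mulrC ler_pdivlMr //; apply: le_trans e2; rewrite lerDr.
Qed.

Lemma smooth_weyl_sum_le_count k (alpha P R : F) :
  normc (smooth_weyl_sum k alpha P R) <= \sum_(1 <= n < (Num.truncn P).+1 | smooth P R n) 1.
Proof.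
apply: le_trans (normc_sum _ _ _) _; apply: ler_sum => n _.
by rewrite mul1r normc_expe.
Qed.

(** Since [k + 4 w ^ 2 tau = 2 (k - D)], the last hypothesis says [w ^ 2 <= k - D]: the mean value
    is then so small that the diagonal solutions alone limit the number of smooth numbers. *)
Lemma small_count_bound (k w : nat) (D tau s eps : F) : (1 < k)%N -> 0 < eps -> (0 < w)%N ->
  weight_uniform_admissible k (2 * w%:R) D -> k%:R - 2 * D = 4 * w%:R ^+ 2 * tau ->
  0 < s -> s <= tau -> 2 * w%:R ^+ 2 <= k%:R + 4 * w%:R ^+ 2 * tau ->
  exists2 eta : F, 0 < eta & exists2 C : F, 0 < C &
  forall P R alpha : F, 2 <= R -> R <= P -> R <= P `^ eta ->
    normc (smooth_weyl_sum k alpha P R) <= C * P `^ (1 - s + eps).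
Proof.
move=> k1 e0 w0 adm hD s0 st hw.
have [eta eta0 [C C0 h]] := sum_power_sum_reps_sq_le e0 w0 adm.
have wF : 1 <= w%:R :> F by rewrite ler1n.
have w0F : 0 < w%:R :> F by rewrite ltr0n.
exists eta => //; exists (C `^ w%:R^-1); first by rewrite powR_gt0.
move=> P R alpha R2 RP Re.
have P0 : 0 < P by apply: lt_le_trans RP; apply: lt_le_trans R2.
have P1 : 1 <= P by apply: le_trans RP; apply: le_trans R2; rewrite ler1n.
apply: le_trans (smooth_weyl_sum_le_count _ _ _ _) _.
set S := \sum_(_ <= n < _ | _) _.
have S0 : 0 <= S by apply: sumr_ge0.
have := le_trans (smooth_count_le_mean k w P R) (h P R R2 RP Re).
rewrite -/S lee_fin => hS.
rewrite -(@ler_pXn2r _ w) ?nnegrE ?mulr_ge0 ?powR_ge0 //.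
apply: le_trans hS _; rewrite exprMn powR_root ?(ltW C0) // ler_pM2l //.
rewrite -powR_mulrn ?powR_ge0 // -powRrM; apply: ler_powR => //.
(* Twice the required inequality [2 w - k + D <= w (1 - s)], rearranged, with [D] eliminated by
   [hD]. *)
have key : 2 * w%:R * (1 + s) <= k%:R + 4 * w%:R ^+ 2 * tau.
  have [w2|w2] := ltnP 1 w; last first.
    have -> : w = 1%N by apply/eqP; rewrite eqn_leq w2.
    have : 2 <= k%:R :> F by rewrite ler_nat.
    by move: st s0; rewrite expr1n !mulr1; clear; lra.
  have w2F : 2 <= w%:R :> F by rewrite ler_nat.
  have [s1|s1] := leP s 1.
    apply: le_trans hw; rewrite expr2 mulrA ler_pM2l ?mulr_gt0 //.
    by move: s1 w2F; clear; lra.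
  have a1 : w%:R * 2 <= w%:R ^+ 2 :> F by rewrite expr2 ler_pM2l.
  have a2 : 4 * (w%:R * 2) * s <= 4 * w%:R ^+ 2 * tau.
    by apply: ler_pM; rewrite ?mulr_ge0 ?(ltW s0) // ler_pM2l.
  have a3 : w%:R * 1 <= w%:R * s by rewrite ler_pM2l // ltW.
  have : 0 <= k%:R :> F by [].
  by move: a2 a3 w0F; clear; lra.
have : eps <= eps * w%:R by rewrite ler_peMr // ltW.
by move: key hD; clear; lra.
Qed.

Lemma minor_arc_bound (k w : nat) (D t Dt tau s lam e : F) : (1 < k)%N -> 0 < e ->
  weight_uniform_admissible k (2 * w.+1%:R) D -> k%:R - 2 * D = 4 * w.+1%:R ^+ 2 * tau ->
  k%:R + 4 * w.+1%:R ^+ 2 * tau <= 2 * w.+1%:R ^+ 2 ->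
  0 < tau -> 1 / 2 < lam -> lam < 1 -> s = 2 * tau * (1 - lam) ->
  weight_uniform_admissible k t Dt -> k%:R + 1 < t ->
  s * t + (1 - lam) * (1 + Dt) <= 1 + e ->
  exists2 eta : F, 0 < eta & exists2 C : F, 0 < C &
  forall P R alpha : F, 2 <= R -> R <= P -> R <= P `^ eta -> minor_arcs k P (P `^ lam * R) alpha ->
    normc (smooth_weyl_sum k alpha P R) <= C * P `^ (1 - s + (2 * k%:R + 7) * e).
Proof.
move=> k1 e0 adw hD hw tau0 lam1 lam2 hs adt tk hst; have k0 : (0 < k)%N by exact: ltnW.
have w1 : 1 <= w.+1%:R :> F by rewrite ler1n.
have w2 : 0 < w.+1%:R ^+ 2 :> F by rewrite exprn_gt0.
have kF : 0 < k%:R :> F by rewrite ltr0n.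
have tauh : tau <= 1 / 2.
  rewrite -(ler_pM2l (mulr_gt0 (ltr0n F 4) w2)); apply: le_trans (_ : 2 * w.+1%:R ^+ 2 <= _).
    by apply: le_trans hw; rewrite lerDr.
  by clear; lra.
set x := 1 - lam in hs hst.
have x0 : 0 < x by rewrite subr_gt0.
have sx : s <= x by rewrite hs ler_piMl ?(ltW x0) //; move: tauh; clear; lra.
have sl : s < lam by move: sx lam1; rewrite /x; clear; lra.
have l0 : 0 <= lam by move: lam1; clear; lra.
have ht : k%:R / (2 * w.+1%:R ^+ 2) + tau <= 1.
  have c : 0 < 2 * w.+1%:R ^+ 2 :> F by rewrite mulr_gt0.
  rewrite -(ler_pM2r c) mulrDl divfK ?gt_eqF // mul1r; apply: le_trans hw.
  rewrite lerD2l mulrC ler_pM2r // ler_pM2r // ler_nat //.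
have [etaA etaA0 [CA CA0 hA]] := major_case k1 tk e0 adt sl lam2 l0 hst.
have [etaB etaB0 [CB CB0 hB]] := minor_case k1 e0 adw tau0 tauh hD ht x0 hs.
have [CL CL0 hL] := dyadic_length e0.
have [CN CN0 hN] := count_pi_nat_le e0.
exists (Num.min (e / 15) (Num.min etaA etaB)).
  by rewrite !lt_min etaA0 etaB0 divr_gt0.
pose CC := CA + CB + 1.
have CC0 : 0 < CC by rewrite /CC !addr_gt0.
exists (CN * CL * CC * CL); first by rewrite !mulr_gt0.
move=> P R alpha R2 RP Re [al01 nmaj].
have P2 : 2 <= P by exact: le_trans RP.
have P0 : 0 < P by apply: lt_le_trans P2.
have P1 : 1 <= P by apply: le_trans P2; rewrite ler1n.
have R0 : 0 < R by apply: lt_le_trans R2.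
have R1 : 1 <= R by apply: le_trans R2; rewrite ler1n.
have pp y : 0 < P `^ y by exact: powR_gt0.
have mono (y z : F) : y <= z -> P `^ y <= P `^ z by exact: ler_powR.
have ReA : R <= P `^ etaA by apply: le_trans Re _; apply: mono; rewrite !ge_min lexx !orbT.
have ReB : R <= P `^ etaB by apply: le_trans Re _; apply: mono; rewrite !ge_min lexx !orbT.
have R15 : R ^+ 15 <= P `^ e.
  apply: (@le_trans _ _ ((P `^ (e / 15)) ^+ 15)).
    apply: lerXn2r; rewrite ?nnegrE ?powR_ge0 ?(ltW R0) //.
    by apply: le_trans Re _; apply: mono; rewrite !ge_min lexx.
  by rewrite -powR_mulrn ?powR_ge0 // -powRrM divfK // pnatr_eq0.
have [l [Pl lP lC]] := hL P P2.
have Ph1 : 1 <= P `^ (k%:R / 2) by rewrite -[leLHS](powRr0 P); apply: mono; rewrite divr_ge0.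
have N0 : (0 < Num.truncn (P `^ (k%:R / 2)))%N by rewrite truncn_ge_nat ?(ltW (pp _)) //.
have [q [a [/andP[q0 qN] aq cqa hq]]] := dirichlet_approx al01 N0.
set Ph := P `^ (k%:R / 2) in Ph1 N0 qN hq.
have Ph2 : Ph * Ph = P ^+ k.
  by rewrite -powR_add // -splitr powR_mulrn // ltW.
have Ph0 : 0 < Ph by exact: pp.
have qPh : q%:R <= Ph by rewrite -truncn_ge_nat ?(ltW Ph0).
have qF : 0 < q%:R :> F by rewrite ltr0n.
have qF1 : 1 <= q%:R :> F by rewrite ler1n.
pose beta := alpha - a%:R / q%:R.
have alE : alpha = a%:R / q%:R + beta by rewrite /beta addrC subrK.
have qbE : q%:R * alpha - a%:R = q%:R * beta by rewrite /beta; field; rewrite gt_eqF.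
rewrite qbE in hq.
have Pk0 : 0 < P ^+ k by rewrite exprn_gt0.
(* The factor 2 pays for truncating [Ph] to an integer in Dirichlet's theorem. *)
have bPh : P ^+ k * `|q%:R * beta| <= 2 * Ph.
  have NF : 0 < (Num.truncn Ph)%:R :> F by rewrite ltr0n.
  have PhN : Ph <= 2 * (Num.truncn Ph)%:R.
    apply: ltW; apply: lt_le_trans (_ : (Num.truncn Ph).+1%:R <= _).
      by rewrite -truncn_lt_nat ?(ltW Ph0).
    by rewrite -natr1 mulr_natl mulr2n lerD2l ler1n.
  apply: le_trans (ler_wpM2l (ltW Pk0) hq) _.
  by rewrite -Ph2 ler_pdivrMr // [2 * _]mulrC -mulrA ler_pM2l.
set M := P `^ lam; set X := P `^ x.
have X0 : 0 < X by exact: pp.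
have M0 : 0 < M by exact: pp.
have PE : P = M * X by rewrite -powR_add // /x addrCA subrr addr0 powRr1 // ltW.
have minor : M * R < q%:R \/ M * R < `|q%:R * beta| * P ^+ k.
  have [h|h] := ltP (M * R) q%:R; [by left|right].
  rewrite ltNge; apply/negP => h2; apply: nmaj; split => //; exists q, a; split => //.
  by rewrite qbE powRN powR_mulrn ?(ltW P0) // ler_pdivlMr.
pose Z := P `^ (1 - s + (k%:R + 2) * e).
have Z0 : 0 < Z by exact: pp.
pose Bd := CC * (R ^+ 15 * l.+1%:R) * Z.
have RR0 : 0 < R ^+ 15 * l.+1%:R by rewrite mulr_gt0 ?exprn_gt0.
have Bd0 : 0 <= Bd by rewrite /Bd ltW //; exact: mulr_gt0 (mulr_gt0 CC0 RR0) Z0.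
have PK : P < (2 ^ l)%:R by [].
apply: le_trans (smooth_weyl_sum_le_blocks q0 (ltW P0) PK PK Bd0 _) _.
  move=> d j d0; set W := d%:R * _.
  have d1 : 1 <= d%:R :> F by rewrite ler1n.
  have j1 : 1 <= (2 ^ j)%:R :> F by rewrite ler1n expn_gt0.
  have dW : d%:R <= W by rewrite /W ler_peMr // ltW // (lt_le_trans _ d1).
  have W1 : 1 <= W by exact: le_trans dW.
  have W0 : 0 < W by exact: lt_le_trans W1.
  have PWK : P / W < (2 ^ l)%:R.
    by apply: le_lt_trans Pl; rewrite ler_pdivrMr // ler_peMr // ltW.
  have [Ws|Ws] := leP W (P `^ s); last first.
    apply: le_trans (norm_block_sum_le _ _ _ _ _ _) _; first by rewrite divr_ge0 // ltW.
    apply: (@le_trans _ _ (P `^ (1 - s))).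
      rewrite powR_add // powRr1 ?(ltW P0) // powRN ler_pM2l // lef_pV2 ?posrE //; exact: ltW.
    apply: (@le_trans _ _ Z); first by apply: mono; rewrite lerDl mulr_ge0 ?addr_ge0 // ltW.
    rewrite /Bd ler_peMl ?(ltW Z0) //.
    have : 1 <= R ^+ 15 by rewrite exprn_ege1.
    have : 1 <= l.+1%:R :> F by rewrite ler1n.
    have : 1 <= CC by rewrite /CC lerDr addr_ge0 // ltW.
    by move=> a1 a2 a3; do 2! [apply: mulr_ege1 => //].
  case: (boolP ((q%:R <= X ^+ k) && (`|q%:R * beta| * (M * R) ^+ k <= 1 / 2))).
    move=> /andP[qX bM].
    have h := hA alpha beta P R W q a d l (2 ^ l)%N q0 d0 cqa alE P2 W1 dW Ws R2 ReA qX bM minor Pl (leqnn _) PWK.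
    apply: le_trans h _; apply: ler_wpM2r; first exact: ltW.
    apply: ler_pM; rewrite ?(ltW CA0) ?mulr_ge0 ?exprn_ge0 ?(ltW R0) //.
      by rewrite /CC -addrA lerDl addr_ge0 // ltW.
    by rewrite ler_wpM2r // ler_weXn2l.
  rewrite negb_and -!ltNge => nA.
  (* For [beta] this follows from [P R = X (M R)]: failure of the first case means
     [|q beta| (M R) ^ k > 1 / 2]. *)
  have alt : X ^+ k <= 2 * R ^+ k * q%:R \/ X ^+ k <= 2 * R ^+ k * (P ^+ k * `|q%:R * beta|).
    case/orP: nA => h; [left|right].
      apply: le_trans (ltW h) _; rewrite ler_peMl ?(ltW qF) //.
      have : 1 <= R ^+ k by rewrite exprn_ege1.
      by clear; lra.
    have Xk0 : 0 < X ^+ k by rewrite exprn_gt0.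
    have -> : 2 * R ^+ k * (P ^+ k * `|q%:R * beta|) = X ^+ k * (2 * (`|q%:R * beta| * (M * R) ^+ k)).
      by rewrite [in LHS]PE !exprMn; ring.
    by rewrite ler_peMr ?(ltW Xk0) //; move: h; clear; lra.
  have qPh2 : q%:R <= 2 * Ph by apply: le_trans qPh _; rewrite ler_peMl ?(ltW Ph0) // ler1n.
  have h := hB alpha beta P R W q a d l (2 ^ l)%N q0 d0 cqa alE P2 W1 dW Ws R2 ReB qPh2 bPh alt Pl (leqnn _) PWK.
  apply: le_trans h _; apply: ler_pM; rewrite ?powR_ge0 //.
  - by rewrite mulr_ge0 ?(ltW CB0) ?(ltW RR0).
  - by apply: ler_wpM2r; rewrite ?(ltW RR0) // /CC addrAC lerDr addr_ge0 // ltW.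
  - apply: mono; rewrite lerD2l ler_peMl ?(ltW e0) //.
    by move: kF; clear; lra.
have cnt : \sum_(0 <= d < 2 ^ l | \pi(q).-nat d) 1 <= CN * P `^ ((k%:R + 2) * e).
  apply: le_trans (hN q (2 ^ l)%N q0) _; rewrite -mulrA ler_pM2l // mulrDl powR_add //.
  have qP : q%:R <= P ^+ k by apply: le_trans qPh _; rewrite -Ph2 ler_peMl // ltW.
  apply: ler_pM; rewrite ?powR_ge0 //.
    rewrite powRrM powR_mulrn ?(ltW P0) //.
    by apply: ge0_ler_powR; rewrite ?nnegrE ?(ltW e0) ?(ltW Pk0).
  rewrite powRrM powR_mulrn ?(ltW P0) //.
  apply: ge0_ler_powR; rewrite ?nnegrE ?(ltW e0) ?exprn_ge0 ?(ltW P0) //.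
  by apply: le_trans lP _; rewrite expr2 ler_pM2r.
have lC' : l%:R <= CL * P `^ e by apply: le_trans lC; rewrite ler_nat.
apply: (@le_trans _ _ (CN * P `^ ((k%:R + 2) * e) * (CL * P `^ e * (CC * (P `^ e * (CL * P `^ e)) * Z)))).
  apply: ler_pM => //; first by apply: sumr_ge0.
    exact: mulr_ge0.
  apply: ler_pM => //; apply: ler_wpM2r; first exact: ltW.
  apply: ler_wpM2l; first exact: ltW.
  by apply: ler_pM => //; rewrite exprn_ge0 // ltW.
rewrite le_eqVlt; apply/orP; left; apply/eqP.
(* The budget: [k + 2] from the number of [d], one each from the number of dyadic ranges, from
   [R ^ 15] and from [l.+1], and [k + 2] from the blocks. *)
have -> : 1 - s + (2 * k%:R + 7) * e = (k%:R + 2) * e + e + e + e + (1 - s + (k%:R + 2) * e) by ring.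
rewrite (@powR_add F P ((k%:R + 2) * e + e + e + e)) // -/Z !(@powR_add F P _ e) //.
by ring.
Qed.

End MinorArcs.

Lemma smooth_count_le (F : realType) (P R : F) : 0 <= P ->
  \sum_(1 <= n < (Num.truncn P).+1 | smooth P R n) 1 <= P.
Proof.
move=> P0; rewrite -big_filter big_const_seq count_predT iter_addr_0; apply: size_head_le => //.
  by rewrite filter_uniq ?iota_uniq.
by move=> u; rewrite mem_filter => /andP[/and3P[]].
Qed.

(** With [sigma > 0], the bound [lambda < 1] forces [tau] to be positive, and [lambda > 1 / 2] then
    gives [sigma < tau]. *)
Lemma sigma_tau_bounds (F : realFieldType) (tau sigma lambda : F) :
  lambda = 1 - sigma / (2 * tau) -> 1 / 2 < lambda < 1 -> 0 < sigma ->
  [/\ 0 < tau, sigma = 2 * tau * (1 - lambda) & sigma < tau].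
Proof.
move=> hl /andP[h1 h2] s0.
have q0 : 0 < sigma / (2 * tau) by move: h2; rewrite hl; lra.
have t0 : 0 < tau by move: q0; rewrite pmulr_rgt0 // invr_gt0 pmulr_rgt0.
have e : sigma = 2 * tau * (1 - lambda) by rewrite hl; field; rewrite gt_eqF.
split => //; rewrite e; nra.
Qed.

Theorem theorem3p3 (F : realType) (k : nat) (hk : (2 <= k)%N)
  (Delta : F -> F)
  (hDelta : forall s : F, 0 < s -> weight_uniform_admissible k s (Delta s))
  (tau sigma lambda : F)
  (htau : is_maximum
     [set (k%:R - 2 * Delta (2 * w%:R)) / (4 * w%:R ^+ 2)
       | w in [set w : nat | (1 <= w)%N]] tau)
  (hsigma : sigma^-1 =
     inf [set t + (1 + Delta t) / (2 * tau) | t in [set t : F | k%:R + 1 < t]])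
  (hlambda : lambda = 1 - sigma / (2 * tau))
  (hlambda_range : 1 / 2 < lambda < 1) :
  forall eps : F, 0 < eps ->
  exists2 eta : F, 0 < eta &
  exists2 C : F, 0 < C &
  forall P R : F, 2 <= R -> R <= P -> R <= P `^ eta ->
    (ereal_sup [set (Normc.normc (smooth_weyl_sum k alpha P R))%:E
                 | alpha in minor_arcs k P (P `^ lambda * R)]
     <= (C * P `^ (1 - sigma + eps))%:E)%E.
Proof.
move=> eps eps0.
suff [eta eta0 [C C0 h]] : exists2 eta : F, 0 < eta & exists2 C : F, 0 < C &
    forall P R alpha : F, 2 <= R -> R <= P -> R <= P `^ eta ->
      minor_arcs k P (P `^ lambda * R) alpha ->
      Normc.normc (smooth_weyl_sum k alpha P R) <= C * P `^ (1 - sigma + eps).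
  exists eta => //; exists C => // P R R2 RP Re.
  by apply: ge_ereal_sup => _ [alpha al <-]; rewrite lee_fin; exact: h.
(* For [sigma <= 0] the claim is weaker than the trivial bound [P]. *)
have [s0|s0] := leP sigma 0.
  exists 1 => //; exists 1 => // P R alpha R2 RP _ _.
  have P0 : 0 < P by apply: lt_le_trans RP; apply: lt_le_trans R2.
  have P1 : 1 <= P by apply: le_trans RP; apply: le_trans R2; rewrite ler1n.
  apply: le_trans (smooth_weyl_sum_le_count _ _ _ _) _.
  apply: le_trans (smooth_count_le _ (ltW P0)) _; rewrite mul1r -[leLHS]powRr1 ?(ltW P0) //.
  by apply: ler_powR => //; move: s0 eps0; lra.
have [tau0 hs st] := sigma_tau_bounds hlambda hlambda_range s0.
have /andP[lam1 lam2] := hlambda_range.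
case: htau => -[w /= w1 hw] _.
have wF : 0 < w%:R :> F by rewrite ltr0n.
have hD : k%:R - 2 * Delta (2 * w%:R) = 4 * w%:R ^+ 2 * tau.
  by rewrite -hw [RHS]mulrC divfK // gt_eqF // mulr_gt0 // exprn_gt0.
have adm : weight_uniform_admissible k (2 * w%:R) (Delta (2 * w%:R)).
  by apply: hDelta; rewrite mulr_gt0.
(* As [k + 4 w ^ 2 tau = 2 (k - Delta (2 w))], this compares [w ^ 2] with [k - Delta (2 w)]. *)
have [big|small] := leP (2 * w%:R ^+ 2) (k%:R + 4 * w%:R ^+ 2 * tau).
  have [eta eta0 [C C0 h]] := small_count_bound hk eps0 w1 adm hD s0 (ltW st) big.
  by exists eta => //; exists C => // P R alpha R2 RP Re _; exact: h.
have c0 : 0 < 2 * k%:R + 7 :> F by rewrite ltr_wpDl // mulr_ge0.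
pose e := eps / (2 * k%:R + 7).
have eE : (2 * k%:R + 7) * e = eps by rewrite /e mulrC divfK // gt_eqF.
have e0 : 0 < e by rewrite divr_gt0.
set E := [set _ | t in _] in hsigma.
(* By convention [inf] is 0 when there is no infimum, which would contradict [sigma^-1 > 0]. *)
have hE : has_inf E.
  apply: contrapT => /inf_out h; move: s0; rewrite -invr_gt0 hsigma h ltxx //.
have s1 : sigma <= 1.
  have wk : 4 * w%:R ^+ 2 * tau < 2 * w%:R ^+ 2.
    by apply: le_lt_trans small; rewrite lerDr.
  have : tau * (2 * w%:R ^+ 2) < 1 * (2 * w%:R ^+ 2).
    have : 0 < w%:R ^+ 2 * tau by rewrite mulr_gt0 ?exprn_gt0.
    by move: wk; clear; lra.
  rewrite ltr_pM2r ?mulr_gt0 ?exprn_gt0 // => t1.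
  by apply: ltW; exact: lt_trans t1.
(* The infimum need not be attained, so [t] is chosen within [e] of it; multiplying by [sigma <= 1]
   keeps the excess at most [e]. *)
have [_ [t /= tk <-] ht] := inf_adherent e0 hE.
have hst : sigma * t + (1 - lambda) * (1 + Delta t) <= 1 + e.
  rewrite -hsigma in ht; have := ltW ht; rewrite -(ler_pM2l s0).
  have -> : sigma * (t + (1 + Delta t) / (2 * tau)) = sigma * t + (1 - lambda) * (1 + Delta t).
    by rewrite mulrDr {2}hs; field; rewrite gt_eqF.
  move=> h; apply: le_trans h _; rewrite mulrDr divff ?gt_eqF // lerD2l.
  by rewrite ler_piMl // ltW.
have t0 : 0 < t by apply: le_lt_trans tk; rewrite addr_ge0.
rewrite -(prednK w1) in adm hD small.
have [eta eta0 [C C0 h]] := minor_arc_bound hk e0 adm hD (ltW small) tau0 lam1 lam2 hs (hDelta t t0) tk hst.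
exists eta => //; exists C => // P R alpha R2 RP Re al.
by have := h P R alpha R2 RP Re al; rewrite eE.
Qed.
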